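(* Let $n\ge1$ and $m\ge0$ be integers and $\nu>0$. For $R>0$ let $\alpha=\nu R^2$ and let $K_R$ be the reproducing kernel of the weighted Bergman-Dirichlet space $\mathcal{A}^{2,\alpha}_m(\mathbb{B}^n_R)$ on the ball $\mathbb{B}^n_R=\{z\in\mathbb{C}^n:|z|<R\}$, i.e. the space of holomorphic $f$ on $\mathbb{B}^n_R$ with $$\|f\|_{\alpha,m,R}^2:=\|f_{1,m}\|_{\alpha,R}^2+\sum_{|l|=m}\frac{m!}{l!}\|D^lf\|_{\alpha,R}^2<\infty,\qquad \|g\|_{\alpha,R}^2=\int_{\mathbb{B}^n_R}|g(z)|^2\Big(1-\frac{|z|^2}{R^2}\Big)^{\alpha}d\lambda(z).$$ Let $K$ be the reproducing kernel of the Bargmann-Dirichlet space $\mathcal{F}^{2,\nu}_m(\mathbb{C}^n)$ of entire functions $f$ with $\|f\|_{\nu,m}^2:=\|f_{1,m}\|_\nu^2+\sum_{|l|=m}\frac{m!}{l!}\|D^lf\|_\nu^2<\infty$, $\|g\|_\nu^2=\int_{\mathbb{C}^n}|g(z)|^2e^{-\nu|z|^2}d\lambda(z)$. Then $K_R(z,w)\to K(z,w)$ as $R\to+\infty$, pointwise for every $(z,w)\in\mathbb{C}^n\times\mathbb{C}^n$ and uniformly on compact subsets of $\mathbb{C}^n\times\mathbb{C}^n$ (for a compact set, $K_R$ being defined on it once $R$ is large enough).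
   Context: $\langle z,w\rangle=\sum_j z_j\overline{w_j}$, $|z|=\sqrt{\langle z,z\rangle}$, $d\lambda$ is Lebesgue measure on $\mathbb{C}^n$. Multi-index notation: for $l=(l_1,\dots,l_n)$ nonnegative integers, $|l|=\sum l_j$, $l!=\prod l_j!$, $z^l=\prod z_j^{l_j}$, $D^l=\frac{\partial^{|l|}}{\partial z_1^{l_1}\cdots\partial z_n^{l_n}}$. For $f=\sum_pa_pz^p$, $f_{1,m}=\sum_{|p|<m}a_pz^p$. Both spaces are Hilbert spaces with the inner products associated with the given norms, and the reproducing kernel $K_X(z,w)$ of such a space $X$ is the function with $K_X(\cdot,w)\in X$ and $f(w)=\langle f,K_X(\cdot,w)\rangle_X$ for all $f\in X$. *)

(* Defs.v *)
From HB Require Import structures.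
From mathcomp Require Import all_boot all_order all_algebra.
From mathcomp Require Import all_classical all_reals all_analysis.
From mathcomp Require Import complex.
Set Implicit Arguments. Unset Strict Implicit. Unset Printing Implicit Defensive.
Import Order.TTheory GRing.Theory Num.Theory.
Import numFieldNormedType.Exports.
Local Open Scope classical_set_scope.
Local Open Scope ring_scope.

Section BergmanDirichlet.
Context {R : realType}.
Local Notation C := (R[i]).

(* C^n as the normed C-module of row vectors, and C as a normed C-module.
   (These only fix the canonical topology/normed structures; the carrier
   types are 'rV[R[i]]_n and R[i].) *)
Definition Cn n : normedModType C := 'rV[C]_n.
Definition CC : normedModType C := C^o.

Definition iC : C := Complex 0 1.

Definition cabs2 (w : C) : R := (@complex.Re R w) ^+ 2 + (@complex.Im R w) ^+ 2.

Definition cnorm2 n (z : Cn n) : R := \sum_(j < n) cabs2 (z 0 j).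

Definition cball n (r : R) : set (Cn n) := [set z | cnorm2 z < r ^+ 2].

Definition toCo n (f : Cn n -> C) : Cn n -> CC := f.

(* Holomorphy on a set: complex (C-linear) Frechet differentiability at every
   point, where C^n is the normed C-module Cn n and the target is C. *)
Definition holomorphic_on n (U : set (Cn n)) (f : Cn n -> C) : Prop :=
  forall z, U z -> differentiable (toCo f) z.

Definition pderiv n (j : 'I_n) (f : Cn n -> C) : Cn n -> C :=
  fun z => 'D_(delta_mx 0 j) (toCo f) z.

Definition Dmulti n (l : 'I_n -> nat) (f : Cn n -> C) : Cn n -> C :=
  foldr (fun j g => iter (l j) (pderiv j) g) f (enum 'I_n).

Definition mabs n (l : 'I_n -> nat) : nat := (\sum_(j < n) l j)%N.
Definition mfact n (l : 'I_n -> nat) : nat := (\prod_(j < n) (l j)`!)%N.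

Definition mono n (p : 'I_n -> nat) (z : Cn n) : C :=
  \prod_(j < n) (z 0 j) ^+ (p j).

(* f_{1,m} = sum_{|p| < m} a_p z^p, with a_p = D^p f(0) / p! the Taylor
   coefficients of f at the origin. *)
Definition trunc n (m : nat) (f : Cn n -> C) : Cn n -> C :=
  fun z => \sum_(p : {ffun 'I_n -> 'I_m} | (mabs (fun j => nat_of_ord (p j)) < m)%N)
    (Dmulti (fun j => nat_of_ord (p j)) f 0 / (mfact (fun j => nat_of_ord (p j)))%:R
      * mono (fun j => nat_of_ord (p j)) z).

(* Lebesgue integral over C^n = R^{2n} (coordinates z_j = x_{2j} + i x_{2j+1}),
   written as an iterated one-dimensional Lebesgue integral (for the
   nonnegative integrands used below this is the Lebesgue integral by Tonelli). *)
Fixpoint iter_int (k : nat) (g : (nat -> R) -> \bar R) (x : nat -> R) : \bar R :=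
  match k with
  | 0 => g x
  | k'.+1 => (\int[@lebesgue_measure R]_(t in [set: R])
                iter_int k' g (fun i => if i == k' then t else x i))%E
  end.

Definition intCn n (g : Cn n -> \bar R) : \bar R :=
  iter_int n.*2 (fun x => g ((\row_(j < n) Complex (x (j : nat).*2) (x (j : nat).*2.+1)) : Cn n))
    (fun _ => 0).

Definition ball_norm2 n (alpha r : R) (g : Cn n -> C) : \bar R :=
  intCn (fun z => if cnorm2 z < r ^+ 2
                  then (cabs2 (g z) * (1 - cnorm2 z / r ^+ 2) `^ alpha)%:E
                  else 0%E).

Definition fock_norm2 n (nu : R) (g : Cn n -> C) : \bar R :=
  intCn (fun z => (cabs2 (g z) * expR (- (nu * cnorm2 z)))%:E).

Definition dir_norm2 n (m : nat) (N : (Cn n -> C) -> \bar R)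
    (f : Cn n -> C) : \bar R :=
  (N (trunc m f) +
   \sum_(l : {ffun 'I_n -> 'I_m.+1} | mabs (fun j => nat_of_ord (l j)) == m)
     ((m`!)%:R / (mfact (fun j => nat_of_ord (l j)))%:R)%:E
       * N (Dmulti (fun j => nat_of_ord (l j)) f))%E.

Definition in_space n (U : set (Cn n)) (N : (Cn n -> C) -> \bar R)
    (f : Cn n -> C) : Prop :=
  holomorphic_on U f /\ (N f < +oo)%E.

(* The inner product associated with the norm (polarization identity):
   <f, g> = 1/4 sum_{k=0}^{3} i^k ||f + i^k g||^2. *)
Definition ip n (N : (Cn n -> C) -> \bar R) (f g : Cn n -> C) : C :=
  4^-1 * \sum_(k < 4) iC ^+ k * Complex (fine (N (fun z => f z + iC ^+ k * g z))) 0.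

Definition is_rkernel n (U : set (Cn n)) (N : (Cn n -> C) -> \bar R)
    (K : Cn n -> Cn n -> C) : Prop :=
  forall w, U w ->
    in_space U N (fun z => K z w) /\
    forall f, in_space U N f -> f w = ip N f (fun z => K z w).

End BergmanDirichlet.

Arguments Cn R n : clear implicits.
Arguments CC R : clear implicits.
Arguments cball {R} n r.

(* Main.v *)
(* Every rotation-invariant norm of this kind makes the monomials z^p orthogonal, so the
   reproducing property forces K_R(z,w) = sum_p z^p conj(w^p) / c_p(R) with c_p(R) = ||z^p||^2,
   and likewise for K with c_p = c_p(oo). Since t |-> (1 - t/R^2)^(nu R^2) increases with R to
   exp(-nu t), the c_p(R) increase to c_p; hence on a polydisc of radius rho the p-th term is
   dominated, for R >= R_0, by rho^(2|p|) / c_p(R_0), which is summable because it is the series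
   of K_{R_0} on the diagonal, and dominated convergence of series gives the uniform limit.

   Orthogonality is obtained without interchanging integral and series: averaging f over the
   rotations by N-th roots of unity, Jensen's inequality and Fatou's lemma give
   ||a_p z^p|| <= ||f||, and the parallelogram law upgrades this to the Pythagorean identity. *)
Require Import Defs.
From HB Require Import structures.
From mathcomp Require Import all_boot all_order all_algebra.
From mathcomp Require Import all_classical all_reals all_analysis measurable_realfun.
From mathcomp Require Import complex.
From mathcomp Require Import ring lra.
Import Order.TTheory GRing.Theory Num.Theory.
Import numFieldNormedType.Exports.
Import Normc.
Set Implicit Arguments. Unset Strict Implicit. Unset Printing Implicit Defensive.
Local Open Scope classical_set_scope.
Local Open Scope ring_scope.

(** * Goursat's theorem and power series in one variable *)

(** Holomorphy is given as bare complex differentiability at each point, with no continuity of the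
    derivative, so power series have to be earned from Goursat's subdivision argument. In several
    variables, iterated Cauchy integrals would require control of each integral as a function of the
    remaining variables; instead, one-variable interpolation at roots of unity is composed over the
    coordinates. Each interpolation costs a factor $N$ in sup norm while its error decays
    geometrically in $N$, so the resulting polynomials converge, and a discrete Cauchy estimate
    makes their coefficients converge too.

    The inner product is known only through polarization of a norm with values in $[0,+\infty]$, so
    orthogonality is phrased throughout as an identity between norms. Testing the reproducing
    property on $z^p$ gives the Taylor coefficients of $K(\cdot,w)$ and also $\|z^p\|>0$, since
    $w^p\neq0$ for some $w$. Finiteness of $\|z^p\|$ comes from the Gaussian weight, which dominates
    all ball weights. Integrals over $\mathbb C^n$ are iterated one-dimensional ones, so rotation
    invariance is reduced to translation invariance on the line. *)

Section ComplexModulus.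
Context {R : realType}.
Local Notation C := R[i].
Implicit Types z w : C.

Lemma cReD z w : complex.Re (z + w) = complex.Re z + complex.Re w.
Proof. by case: z; case: w. Qed.
Lemma cImD z w : complex.Im (z + w) = complex.Im z + complex.Im w.
Proof. by case: z; case: w. Qed.
Lemma cReN z : complex.Re (- z) = - complex.Re z. Proof. by case: z. Qed.
Lemma cImN z : complex.Im (- z) = - complex.Im z. Proof. by case: z. Qed.
Lemma cReM z w : complex.Re (z * w) =
  complex.Re z * complex.Re w - complex.Im z * complex.Im w.
Proof. by case: z; case: w. Qed.
Lemma cImM z w : complex.Im (z * w) =
  complex.Re z * complex.Im w + complex.Im z * complex.Re w.
Proof. by case: z; case: w. Qed.

Lemma complexP z w : complex.Re z = complex.Re w -> complex.Im z = complex.Im w -> z = w.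
Proof. by case: z => a b; case: w => c d /= -> ->. Qed.

(** The norm of [R[i]] takes values in [R[i]] itself; estimates are carried out with the real-valued
    [normc] and converted through this equation. *)
Lemma normCE z : `|z| = Complex (normc z) 0.
Proof. by []. Qed.

Lemma normc_ge0 z : 0 <= normc z.
Proof. by case: z => a b /=; exact: sqrtr_ge0. Qed.

Lemma normcD z w : normc (z + w) <= normc z + normc w.
Proof. exact: (@le_normcD R). Qed.

Lemma normcN z : normc (- z) = normc z.
Proof. exact: (@normcN R). Qed.

Lemma normcB z w : normc (z - w) <= normc z + normc w.
Proof. by rewrite -[normc w]normcN; exact: normcD. Qed.

Lemma normc_distC z w : normc (z - w) = normc (w - z).
Proof. by rewrite -normcN opprB. Qed.

Lemma normcR (x : R) : normc (Complex x 0) = `|x|.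
Proof. by rewrite /= expr0n /= addr0 sqrtr_sqr. Qed.

Lemma normcX z k : normc (z ^+ k) = normc z ^+ k.
Proof. by elim: k => [|k IH]; rewrite ?expr0 ?normc1 // !exprS normcM IH. Qed.

Lemma normc_eq0 z : (normc z == 0) = (z == 0).
Proof. by apply/eqP/eqP => [/eq0_normc //|->]; exact: normc0. Qed.

Lemma normc_gt0 z : (0 < normc z) = (z != 0).
Proof. by rewrite lt_neqAle normc_ge0 eq_sym normc_eq0 andbT. Qed.

Lemma normc_sum (I : Type) (r : seq I) (P : pred I) (F : I -> C) :
  normc (\sum_(i <- r | P i) F i) <= \sum_(i <- r | P i) normc (F i).
Proof.
elim/big_ind2 : _ => //; first by rewrite normc0.
by move=> z x w y h1 h2; apply: (le_trans (normcD _ _)); exact: lerD.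
Qed.

Lemma normc_prod (I : Type) (r : seq I) (P : pred I) (F : I -> C) :
  normc (\prod_(i <- r | P i) F i) = \prod_(i <- r | P i) normc (F i).
Proof.
elim/big_rec2 : _ => [|i x y _ <-]; first by rewrite normc1.
by rewrite normcM.
Qed.

Lemma normc_Re z : `|complex.Re z| <= normc z.
Proof.
by case: z => a b /=; rewrite -sqrtr_sqr ler_sqrt ?addr_ge0 ?sqr_ge0 // lerDl sqr_ge0.
Qed.

Lemma normc_Im z : `|complex.Im z| <= normc z.
Proof.
by case: z => a b /=; rewrite -sqrtr_sqr ler_sqrt ?addr_ge0 ?sqr_ge0 // lerDr sqr_ge0.
Qed.

Lemma normc_ReIm z : normc z <= `|complex.Re z| + `|complex.Im z|.
Proof.
case: z => a b; have -> : Complex a b = Complex a 0 + Complex 0 b.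
  by apply: complexP; rewrite ?cReD ?cImD /= ?addr0 ?add0r.
apply: (le_trans (normcD _ _)); rewrite normcR.
by rewrite cReD cImD /= expr0n /= addr0 !add0r sqrtr_sqr.
Qed.

Lemma cabs2E z : cabs2 z = normc z ^+ 2.
Proof. by case: z => a b; rewrite /cabs2 /= sqr_sqrtr // addr_ge0 ?sqr_ge0. Qed.

Lemma normcR_nat k : normc (k%:R : C) = k%:R.
Proof.
have -> : (k%:R : C) = Complex k%:R 0.
  by rewrite -[RHS]/(real_complex R k%:R) rmorph_nat.
by rewrite normcR ger0_norm.
Qed.

End ComplexModulus.

(** * Integrals of complex-valued functions over an interval *)

Section ComplexIntegral.
Context {R : realType}.
Local Notation C := R[i].
Local Notation mu := (@lebesgue_measure R).
Local Notation Re := (@complex.Re R).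
Local Notation Im := (@complex.Im R).

(** Continuity is asked of the two real components within the closed interval, the form from which
    Lebesgue integrability follows directly. *)
Definition ccont (a b : R) (h : R -> C) :=
  {within `[a, b], continuous (Re \o h)} /\ {within `[a, b], continuous (Im \o h)}.

Definition cint (a b : R) (h : R -> C) : C :=
  Complex (\int[mu]_(x in `[a, b]) Re (h x)) (\int[mu]_(x in `[a, b]) Im (h x)).

Lemma within_integrable (a b : R) (f : R -> R) :
  {within `[a, b], continuous f} -> mu.-integrable `[a, b] (EFin \o f).
Proof. by move=> cf; apply: continuous_compact_integrable => //; exact: segment_compact. Qed.

Lemma ccont_eps (a b : R) (h : R -> C) :
  (forall x, a <= x <= b -> forall e : R, 0 < e -> exists2 d : R, 0 < d &
     forall y, a <= y <= b -> `|x - y| < d -> normc (h x - h y) < e) ->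
  ccont a b h.
Proof.
(* [T] stands for the real or the imaginary part; only compatibility with subtraction and the bound
   by the modulus are used. *)
move=> H; suff K (T : C -> R) : (forall z, `|T z| <= normc z) ->
    (forall z w, T (z - w) = T z - T w) -> {within `[a, b], continuous (T \o h)}.
  split; [apply: K => [|z w]; [exact: normc_Re|by rewrite cReD cReN]
         | apply: K => [|z w]; [exact: normc_Im|by rewrite cImD cImN]].
move=> Tn TB; apply/subspace_continuousP => x xab.
apply/cvgrPdist_lt => e e0.
have xab' : a <= x <= b by move: xab; rewrite /= in_itv.
have [d d0 dP] := H x xab' e e0.
rewrite near_withinE; near=> y => yab /=.
rewrite -TB; apply: (le_lt_trans (Tn _)); apply: dP.
  by move: yab; rewrite /= in_itv.
near: y; exact: (@nbhsx_ballx R R x d d0).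
Unshelve. all: by end_near. Qed.

Lemma eq_cint a b g h : (forall x, a <= x <= b -> g x = h x) -> cint a b g = cint a b h.
Proof.
move=> gh; rewrite /cint; congr Complex; apply: eq_Rintegral => x;
  by rewrite inE /= in_itv /= => /gh ->.
Qed.

Lemma ccontD a b g h : ccont a b g -> ccont a b h -> ccont a b (fun x => g x + h x).
Proof.
move=> [g1 g2] [h1 h2]; split.
- rewrite (_ : _ \o _ = (Re \o g) \+ (Re \o h)); last by apply/funext => x /=; rewrite cReD.
  by move=> x; apply: cvgD; [exact: g1|exact: h1].
- rewrite (_ : _ \o _ = (Im \o g) \+ (Im \o h)); last by apply/funext => x /=; rewrite cImD.
  by move=> x; apply: cvgD; [exact: g2|exact: h2].
Qed.

Lemma within_lin a b (f g : R -> R) (c d : R) :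
  {within `[a, b], continuous f} -> {within `[a, b], continuous g} ->
  {within `[a, b], continuous (fun x => c * f x + d * g x)}.
Proof.
move=> cf cg x; apply: cvgD.
  by apply: cvgM; [exact: cvg_cst|exact: cf].
by apply: cvgM; [exact: cvg_cst|exact: cg].
Qed.

Lemma ccontZ a b c h : ccont a b h -> ccont a b (fun x => c * h x).
Proof.
move=> [h1 h2]; split.
- rewrite (_ : _ \o _ = fun x => Re c * (Re \o h) x + (- Im c) * (Im \o h) x).
    exact: within_lin.
  by apply/funext => x /=; rewrite cReM mulNr.
- rewrite (_ : _ \o _ = fun x => Re c * (Im \o h) x + (Im c) * (Re \o h) x).
    exact: within_lin.
  by apply/funext => x /=; rewrite cImM.
Qed.

Lemma Rintegral_lin a b (f g : R -> R) (c d : R) :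
  {within `[a, b], continuous f} -> {within `[a, b], continuous g} ->
  \int[mu]_(x in `[a, b]) (c * f x + d * g x) =
  c * \int[mu]_(x in `[a, b]) f x + d * \int[mu]_(x in `[a, b]) g x.
Proof.
move=> cf cg.
have K (e : R) (u : R -> R) : {within `[a, b], continuous u} ->
    {within `[a, b], continuous (fun x => e * u x)}.
  by move=> cu x; apply: cvgM; [exact: cvg_cst|exact: cu].
rewrite RintegralD //; try by apply: (@within_integrable _ _ (fun x => _ * _)); exact: K.
by rewrite !RintegralZl //; exact: within_integrable.
Qed.

Lemma cintD a b g h : ccont a b g -> ccont a b h ->
  cint a b (fun x => g x + h x) = cint a b g + cint a b h.
Proof.
move=> [g1 g2] [h1 h2]; rewrite /cint -[RHS]/(Complex (_ + _) (_ + _)).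
have := Rintegral_lin 1 1 g1 h1; have := Rintegral_lin 1 1 g2 h2.
rewrite !mul1r /= => <- <-; congr Complex; apply: eq_Rintegral => x _ /=;
  by rewrite ?cReD ?cImD !mul1r.
Qed.

Lemma cintZ a b c h : ccont a b h -> cint a b (fun x => c * h x) = c * cint a b h.
Proof.
move=> [h1 h2]; apply: complexP; rewrite ?cReM ?cImM /=.
  rewrite -mulNr -(Rintegral_lin _ _ h1 h2); apply: eq_Rintegral => x _ /=.
  by rewrite cReM mulNr.
rewrite -(Rintegral_lin _ _ h2 h1); apply: eq_Rintegral => x _ /=.
by rewrite cImM.
Qed.

Lemma ccontB a b g h : ccont a b g -> ccont a b h -> ccont a b (fun x => g x - h x).
Proof.
move=> cg ch; have := ccontD cg (ccontZ (-1) ch); congr ccont.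
by apply/funext => x; rewrite mulN1r.
Qed.

Lemma cintB a b g h : ccont a b g -> ccont a b h ->
  cint a b (fun x => g x - h x) = cint a b g - cint a b h.
Proof.
move=> cg ch; rewrite -mulN1r -cintZ // -cintD //; last exact: ccontZ.
by apply: eq_cint => x _; rewrite mulN1r.
Qed.

Lemma ccont_cst a b c : ccont a b (fun=> c).
Proof. by split; apply: continuous_subspaceT => x; exact: cvg_cst. Qed.

Lemma Rintegral_itv_cst (a b c : R) : a <= b -> \int[mu]_(x in `[a, b]) c = c * (b - a).
Proof.
move=> ab; rewrite Rintegral_cst //= lebesgue_measure_itv /= lte_fin.
by move: ab; rewrite le_eqVlt => /predU1P[->|->]; rewrite ?ltxx ?subrr.
Qed.

Lemma cint_cst a b c : a <= b -> cint a b (fun=> c) = c * Complex (b - a) 0.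
Proof.
move=> ab; rewrite /cint !Rintegral_itv_cst //; apply: complexP;
 by rewrite ?cReM ?cImM /= !mulr0 ?subr0 ?add0r.
Qed.

Lemma cint_split a b c h : a <= c -> c <= b -> ccont a b h ->
  cint a b h = cint a c h + cint c b h.
Proof.
move=> ac cb [h1 h2]; rewrite /cint -[RHS]/(Complex (_ + _) (_ + _)).
suff K (f : R -> R) : {within `[a, b], continuous f} ->
    \int[mu]_(x in `[a, b]) f x = \int[mu]_(x in `[a, c]) f x + \int[mu]_(x in `[c, b]) f x.
  by congr Complex; exact: K.
move=> cf; have fi := within_integrable cf.
have /= := @Rintegral_itvB R f (BLeft a) (BRight b) c fi.
rewrite !bnd_simp => /(_ ac cb) /eqP; rewrite subr_eq addrC => /eqP ->; congr +%R.
apply: Rintegral_itv_obnd_cbnd; apply: integrableS fi => //.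
by apply: subset_itv; rewrite bnd_simp.
Qed.

(** The factor 2 is the price of bounding real and imaginary parts separately; it propagates
    harmlessly into the Cauchy estimates below. *)
Lemma cint_bound a b h M : a <= b -> ccont a b h ->
  (forall x, a <= x <= b -> normc (h x) <= M) -> normc (cint a b h) <= 2 * M * (b - a).
Proof.
move=> ab [h1 h2] hM; apply: (le_trans (normc_ReIm _)); rewrite /cint /=.
suff K (f : R -> R) : {within `[a, b], continuous f} ->
    (forall x, a <= x <= b -> `|f x| <= M) -> `|\int[mu]_(x in `[a, b]) f x| <= M * (b - a).
  rewrite -mulrA mulr_natl mulr2n; apply: lerD; apply: K => // x xab;
   apply: le_trans (hM _ xab); by [exact: normc_Re|exact: normc_Im].
move=> cf fM; have fi := within_integrable cf.
apply: (le_trans (le_normr_Rintegral _ fi)) => //.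
rewrite -Rintegral_itv_cst //; apply: le_Rintegral => //.
- by apply: (@within_integrable _ _ (fun x => `|f x|)) => x; apply: cvg_norm; exact: cf.
- by apply: (@within_integrable _ _ (fun=> M)); apply: continuous_subspaceT => x; exact: cvg_cst.
Qed.

End ComplexIntegral.

(** * Goursat's theorem on rectangles *)

Section Goursat.
Context {R : realType}.
Local Notation C := R[i].

Lemma half_pow_small (w d : R) : 0 < d -> exists k : nat, w / 2 ^+ k < d.
Proof.
move=> d0; exists (Num.bound (w / d)).
rewrite ltr_pdivrMr ?exprn_gt0 // -ltr_pdivrMl //.
rewrite mulrC; apply: (le_lt_trans (ler_norm _)).
apply: (lt_le_trans (archi_boundP (normr_ge0 _))).
rewrite -natrX ler_nat; set N := (X in (_ <= _ ^ X)%N).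
have -> : Num.bound `|w / d| = N.
  by rewrite /N /Num.bound /= normr_id.
exact: ltnW (ltn_expl _ _).
Qed.

(** The supremum of the left endpoints belongs to every interval. *)
Lemma nested_point (x w : nat -> R) :
  (forall k, 0 <= w k) -> (forall k, x k <= x k.+1) ->
  (forall k, x k.+1 + w k.+1 <= x k + w k) ->
  exists s, forall k, x k <= s <= x k + w k.
Proof.
move=> w0 xi xd.
have xi' j k : (j <= k)%N -> x j <= x k.
  by elim: k => [|k IH]; [rewrite leqn0 => /eqP->|
    rewrite leq_eqVlt => /predU1P[->//|/IH h]; exact: le_trans h (xi k)].
have xd' j k : (j <= k)%N -> x k + w k <= x j + w j.
  by elim: k => [|k IH]; [rewrite leqn0 => /eqP->|
    rewrite leq_eqVlt => /predU1P[->//|/IH h]; exact: le_trans (xd k) h].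
have ub j k : x j <= x k + w k.
  have [jk|/ltnW kj] := leqP j k.
    by apply: (le_trans (xi' _ _ jk)); rewrite lerDl.
  by apply: le_trans (xd' _ _ kj); rewrite lerDl.
exists (sup (range x)) => k; apply/andP; split.
  apply: ub_le_sup; last by exists k.
  by exists (x 0 + w 0) => _ [j _ <-].
by apply: ge_sup; [exists (x 0); exists 0 | move=> _ [j _ <-]].
Qed.

(* Goursat's subdivision argument for an arbitrary function of rectangles that is
   subadditive under quartering and locally [eps]-small. *)
Lemma bisection (beta : R -> R -> R -> R -> R) (a c w h eps : R) :
  0 <= w -> 0 <= h ->
  let sub a' c' w' h' := [/\ a <= a', a' + w' <= a + w, c <= c', c' + h' <= c + h & 
     0 <= w' /\ 0 <= h'] in
  (forall a' c' w' h', sub a' c' w' h' -> 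
     let w2 := w' / 2 in let h2 := h' / 2 in
     beta a' c' w' h' <= beta a' c' w2 h2 + beta (a' + w2) c' w2 h2
       + beta a' (c' + h2) w2 h2 + beta (a' + w2) (c' + h2) w2 h2) ->
  (forall s t, a <= s <= a + w -> c <= t <= c + h -> exists2 d : R, 0 < d &
     forall a' c' w' h', sub a' c' w' h' -> a' <= s <= a' + w' -> c' <= t <= c' + h' ->
       w' < d -> h' < d -> beta a' c' w' h' <= eps * (w' + h') ^+ 2) ->
  beta a c w h <= eps * (w + h) ^+ 2.
Proof.
move=> w0 h0 sub quart loc; rewrite leNgt; apply/negP => bad.
pose wk k := w / 2 ^+ k; pose hk k := h / 2 ^+ k.
have wk0 k : 0 <= wk k by rewrite divr_ge0 // exprn_ge0.
have hk0 k : 0 <= hk k by rewrite divr_ge0 // exprn_ge0.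
have wkS k : wk k.+1 = wk k / 2 by rewrite /wk exprSr invfM mulrA.
have hkS k : hk k.+1 = hk k / 2 by rewrite /hk exprSr invfM mulrA.
pose P k (x : R * R) := sub x.1 x.2 (wk k) (hk k) /\
  eps * (wk k + hk k) ^+ 2 < beta x.1 x.2 (wk k) (hk k).
have step (kx : nat * (R * R)) : exists y : R * R, P kx.1 kx.2 ->
   [/\ P kx.1.+1 y, kx.2.1 <= y.1 <= kx.2.1 + wk kx.1.+1 &
     kx.2.2 <= y.2 <= kx.2.2 + hk kx.1.+1].
  case: kx => k [x1 x2] /=.
  have [|nP] := pselect (P k (x1, x2)); last by exists (x1, x2) => /nP.
  move=> [/= sb big]; have := quart _ _ _ _ sb; rewrite /= -wkS -hkS => q.
  have W := wkS k; have H := hkS k; have W0 := wk0 k.+1; have H0 := hk0 k.+1.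
  case: (sb) => /= s1 s2 s3 s4 [s5 s6].
  have E : eps * (wk k + hk k) ^+ 2 = 4 * (eps * (wk k.+1 + hk k.+1) ^+ 2).
    by rewrite W H; field.
  (* Halving both sides divides the right-hand side by exactly 4, so one of the four quarters must
     keep the excess. *)
  pose good y1 y2 := eps * (wk k.+1 + hk k.+1) ^+ 2 < beta y1 y2 (wk k.+1) (hk k.+1).
  have : good x1 x2 \/ good (x1 + wk k.+1) x2 \/ good x1 (x2 + hk k.+1) \/
       good (x1 + wk k.+1) (x2 + hk k.+1).
    have [g1|g1] := ltP (eps * (wk k.+1 + hk k.+1) ^+ 2) (beta x1 x2 (wk k.+1) (hk k.+1)).
      by left.
    have [g2|g2] := ltP (eps * (wk k.+1 + hk k.+1) ^+ 2) (beta (x1 + wk k.+1) x2 (wk k.+1) (hk k.+1)).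
      by right; left.
    have [g3|g3] := ltP (eps * (wk k.+1 + hk k.+1) ^+ 2) (beta x1 (x2 + hk k.+1) (wk k.+1) (hk k.+1)).
      by right; right; left.
    by right; right; right; rewrite /good; lra.
  rewrite /good; case=> [g|[g|[g|g]]].
  - exists (x1, x2) => _; clear -W H W0 H0 s1 s2 s3 s4 s5 s6 g; split; [split => //=; split; try lra; try split; lra|..]; apply/andP; rewrite /=; split; lra.
  - exists (x1 + wk k.+1, x2) => _; clear -W H W0 H0 s1 s2 s3 s4 s5 s6 g; split; [split => //=; split; try lra; try split; lra|..]; apply/andP; rewrite /=; split; lra.
  - exists (x1, x2 + hk k.+1) => _; clear -W H W0 H0 s1 s2 s3 s4 s5 s6 g; split; [split => //=; split; try lra; try split; lra|..]; apply/andP; rewrite /=; split; lra.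
  - exists (x1 + wk k.+1, x2 + hk k.+1) => _; clear -W H W0 H0 s1 s2 s3 s4 s5 s6 g; split; [split => //=; split; try lra; try split; lra|..]; apply/andP; rewrite /=; split; lra.
have [f fP] := choice step.
pose u := fix u k := if k is k'.+1 then f (k', u k') else (a, c).
have uP k : P k (u k).
  elim: k => [|k IH]; last by have [] := fP (k, u k) IH.
  by rewrite /P /wk /hk expr0 !divr1; split => //; split.
have [s sP] := @nested_point (fun k => (u k).1) wk wk0
   (fun k => (let: And3 _ A _ := fP (k, u k) (uP k) in proj1 (andP A)))
   (fun k => ltac:(have [_ /andP[_ A] _] := fP (k, u k) (uP k); have := wkS k; move: A => /=; lra)).
have [t tP] := @nested_point (fun k => (u k).2) hk hk0
   (fun k => (let: And3 _ _ A := fP (k, u k) (uP k) in proj1 (andP A)))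
   (fun k => ltac:(have [_ _ /andP[_ A]] := fP (k, u k) (uP k); have := hkS k; move: A => /=; lra)).
have [||d d0 dP] := loc s t.
- by have := sP 0; rewrite /wk expr0 divr1.
- by have := tP 0; rewrite /hk expr0 divr1.
(* Once both sides are below [d], the local bound at the common point [(s, t)] contradicts the
   excess kept at stage [k]. *)
have [k] := half_pow_small (w + h) d0; rewrite mulrDl => kd.
have [sb big] := uP k.
have := dP _ _ _ _ sb (sP k) (tP k); have := wk0 k; have := hk0 k.
rewrite /wk /hk => ? ? D; have : beta (u k).1 (u k).2 (wk k) (hk k) <= eps * (wk k + hk k) ^+ 2.
  by apply: D; lra.
by rewrite leNgt big.
Qed.

(* Complex differentiability at [s + i t] in real coordinates. *)
Definition cdiff2 (H : R -> R -> C) (s t : R) := exists d : C, forall e : R, 0 < e ->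
  exists2 r : R, 0 < r & forall x y, `|x| < r -> `|y| < r ->
    normc (H (s + x) (t + y) - H s t - d * Complex x y) <= e * (`|x| + `|y|).

Lemma cdiff2_cont H s t : cdiff2 H s t -> forall e : R, 0 < e -> exists2 r : R, 0 < r &
  forall x y, `|s - x| < r -> `|t - y| < r -> normc (H s t - H x y) < e.
Proof.
move=> [d dP] e e0; have [r r0 rP] := dP 1 ltr01.
have nd := normc_ge0 d.
exists (Num.min r (e / (4 * (1 + normc d)))).
  by rewrite lt_min r0 divr_gt0 //; lra.
move=> x y; rewrite !lt_min => /andP[x1 x2] /andP[y1 y2].
have := rP (x - s) (y - t); rewrite !(distrC _ s) !(distrC _ t) => /(_ x1 y1).
rewrite !subrKC mul1r => K.
have M : normc (d * Complex (x - s) (y - t)) <= normc d * (`|s - x| + `|t - y|).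
  rewrite normcM ler_wpM2l //; apply: (le_trans (normc_ReIm _)) => /=.
  by rewrite (distrC x) (distrC y).
have T := normcD (H x y - H s t - d * Complex (x - s) (y - t)) (d * Complex (x - s) (y - t)).
rewrite subrK in T; rewrite normc_distC.
have Q : `|s - x| + `|t - y| < e / (2 * (1 + normc d)).
  have -> : e / (2 * (1 + normc d)) = e / (4 * (1 + normc d)) + e / (4 * (1 + normc d)).
    by field; lra.
  exact: ltrD.
rewrite ltr_pdivlMr in Q; last lra.
have := mulr_ge0 nd (addr_ge0 (normr_ge0 (s - x)) (normr_ge0 (t - y))).
nra.
Qed.

(** The contour integral of $H\,dz$ counterclockwise around $[a,b]\times[c,d]$, with opposite sides
    paired. *)
Definition bdry (H : R -> R -> C) (a b c d : R) : C :=
  cint a b (fun x => H x c - H x d) + iC * cint c d (fun y => H b y - H a y).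

Lemma ccont_fst H a b c : (forall x, a <= x <= b -> cdiff2 H x c) -> ccont a b (H ^~ c).
Proof.
move=> hH; apply: ccont_eps => x xab e e0.
have [r r0 rP] := cdiff2_cont (hH x xab) e0; exists r => // y _ xy; apply: rP => //.
by rewrite subrr normr0.
Qed.

Lemma ccont_snd H a b c : (forall x, a <= x <= b -> cdiff2 H c x) -> ccont a b (H c).
Proof.
move=> hH; apply: ccont_eps => x xab e e0.
have [r r0 rP] := cdiff2_cont (hH x xab) e0; exists r => // y _ xy; apply: rP => //.
by rewrite subrr normr0.
Qed.

Section Rect.
Variables (H : R -> R -> C) (a b c d : R).
Hypothesis hH : forall x y, a <= x <= b -> c <= y <= d -> cdiff2 H x y.

Lemma rect_ccont1 a' b' y : a <= a' -> b' <= b -> c <= y <= d -> ccont a' b' (H ^~ y).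
Proof. by move=> aa bb yc; apply: ccont_fst => x /andP[x1 x2]; apply: hH => //; lra. Qed.

Lemma rect_ccont2 c' d' x : c <= c' -> d' <= d -> a <= x <= b -> ccont c' d' (H x).
Proof. by move=> aa bb yc; apply: ccont_snd => y /andP[y1 y2]; apply: hH => //; lra. Qed.

Lemma bdry_splitx a' m b' c' d' : a <= a' -> a' <= m -> m <= b' -> b' <= b ->
  c <= c' -> c' <= d' -> d' <= d ->
  bdry H a' b' c' d' = bdry H a' m c' d' + bdry H m b' c' d'.
Proof.
move=> *; rewrite /bdry (@cint_split _ a' b' m) //; last first.
  by apply: ccontB; apply: rect_ccont1; lra.
rewrite (@eq_cint _ c' d' _ (fun y => (H m y - H a' y) + (H b' y - H m y))); last first.
  by move=> *; ring.
rewrite (@cintD _ c' d' (fun y => H m y - H a' y) (fun y => H b' y - H m y)); first by ring.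
  by apply: ccontB; apply: rect_ccont2; lra.
by apply: ccontB; apply: rect_ccont2; lra.
Qed.

Lemma bdry_splity a' m b' c' d' : a <= a' -> a' <= b' -> b' <= b ->
  c <= c' -> c' <= m -> m <= d' -> d' <= d ->
  bdry H a' b' c' d' = bdry H a' b' c' m + bdry H a' b' m d'.
Proof.
move=> *; rewrite /bdry (@cint_split _ c' d' m) //; last first.
  by apply: ccontB; apply: rect_ccont2; lra.
rewrite (@eq_cint _ a' b' _ (fun y => (H y c' - H y m) + (H y m - H y d'))); last first.
  by move=> *; ring.
rewrite (@cintD _ a' b' (fun y => H y c' - H y m) (fun y => H y m - H y d')); first by ring.
  by apply: ccontB; apply: rect_ccont1; lra.
by apply: ccontB; apply: rect_ccont1; lra.
Qed.

(** An affine function of $x+iy$ integrates to zero around a rectangle, so only the remainder [E] of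
    the first-order expansion at $(s,t)$ contributes: it is $O(w+h)$ with a small constant, on sides
    of total length $2(w+h)$. *)
Lemma bdry_local s t (e : R) : a <= s <= b -> c <= t <= d -> 0 < e ->
  exists2 r : R, 0 < r & forall a' c' w h, a <= a' -> a' + w <= b -> c <= c' -> c' + h <= d ->
    0 <= w -> 0 <= h -> a' <= s <= a' + w -> c' <= t <= c' + h -> w < r -> h < r ->
    normc (bdry H a' (a' + w) c' (c' + h)) <= e * (w + h) ^+ 2.
Proof.
move=> sab tcd e0; have [D DP] := hH sab tcd.
(* In the 4, one factor 2 pays for subtracting opposite sides and the other for [cint_bound]. *)
have [r r0 rP] : exists2 r : R, 0 < r & forall x y, `|x| < r -> `|y| < r ->
    normc (H (s + x) (t + y) - H s t - D * Complex x y) <= (e / 4) * (`|x| + `|y|).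
  by apply: DP; lra.
exists r => // a' c' w h a1 a2 c1 c2 w0 h0 /andP[s1 s2] /andP[t1 t2] wr hr.
pose E x y : C := H x y - H s t - D * Complex (x - s) (y - t).
have EP x y : a' <= x <= a' + w -> c' <= y <= c' + h -> normc (E x y) <= e / 4 * (w + h).
  move=> /andP[x1 x2] /andP[y1 y2].
  have X : `|x - s| <= w by rewrite ler_norml; lra.
  have Y : `|y - t| <= h by rewrite ler_norml; lra.
  have := rP (x - s) (y - t) (le_lt_trans X wr) (le_lt_trans Y hr).
  rewrite !subrKC => /le_trans; apply; apply: ler_wpM2l; lra.
have L1 y : ccont a' (a' + w) (fun x => D * Complex (x - s) (y - t)).
  apply: ccontZ; split; apply: continuous_subspaceT => x /=.
    by apply: cvgB; [exact: cvg_id|exact: cvg_cst].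
  exact: cvg_cst.
have L2 x : ccont c' (c' + h) (fun y => D * Complex (x - s) (y - t)).
  apply: ccontZ; split; apply: continuous_subspaceT => y /=.
    exact: cvg_cst.
  by apply: cvgB; [exact: cvg_id|exact: cvg_cst].
have E1 y : c <= y <= d -> ccont a' (a' + w) (E ^~ y).
  move=> yc; apply: ccontB => //; apply: ccontB; last exact: ccont_cst.
  by apply: rect_ccont1; lra.
have E2 x : a <= x <= b -> ccont c' (c' + h) (E x).
  move=> yc; apply: ccontB => //; apply: ccontB; last exact: ccont_cst.
  by apply: rect_ccont2; lra.
(* The affine part gives $-D\,ih\cdot w$ on the horizontal sides and $i\cdot Dw\cdot h$ on the
   vertical ones, which cancel. *)
have -> : bdry H a' (a' + w) c' (c' + h) =
   cint a' (a' + w) (fun x => E x c' - E x (c' + h)) +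
   iC * cint c' (c' + h) (fun y => E (a' + w) y - E a' y).
  rewrite /bdry.
  rewrite (@eq_cint _ a' _ (fun x => H x c' - H x (c' + h))
     (fun x => (E x c' - E x (c' + h)) + (- D) * Complex 0 h)); last first.
    move=> x _; rewrite /E.
    have -> : Complex 0 h = Complex (x - s) (c' + h - t) - Complex (x - s) (c' - t).
      by apply: complexP; rewrite ?cReD ?cImD ?cReN ?cImN /=; ring.
    ring.
  rewrite (@eq_cint _ c' _ (fun y => H (a' + w) y - H a' y)
     (fun y => (E (a' + w) y - E a' y) + D * Complex w 0)); last first.
    move=> x _; rewrite /E.
    have -> : Complex w 0 = Complex (a' + w - s) (x - t) - Complex (a' - s) (x - t).
      by apply: complexP; rewrite ?cReD ?cImD ?cReN ?cImN /=; ring.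
    ring.
  rewrite (@cintD _ a' _ (fun x => E x c' - E x (c' + h)) (fun=> (- D) * Complex 0 h));
    [|by apply: ccontB; apply: E1; lra|exact: ccont_cst].
  rewrite (@cintD _ c' _ (fun y => E (a' + w) y - E a' y) (fun=> D * Complex w 0));
    [|by apply: ccontB; apply: E2; lra|exact: ccont_cst].
  rewrite cint_cst; last lra.
  rewrite cint_cst; last lra.
  have -> : Complex 0 h = iC * Complex h 0 by apply: complexP; rewrite ?cReM ?cImM /=; ring.
  have -> : Complex (a' + w - a') 0 = Complex w 0 by congr Complex; ring.
  have -> : Complex (c' + h - c') 0 = Complex h 0 by congr Complex; ring.
  ring.
have cD a1' b1' (f : R -> C) (g : R -> C) : a1' <= b1' -> ccont a1' b1' f -> ccont a1' b1' g -> 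
   (forall x, a1' <= x <= b1' -> normc (f x) <= e / 4 * (w + h)) ->
   (forall x, a1' <= x <= b1' -> normc (g x) <= e / 4 * (w + h)) ->
   normc (cint a1' b1' (fun x => f x - g x)) <= e * (w + h) * (b1' - a1').
  move=> ab cf cg bf bg; apply: (le_trans (cint_bound (M := e / 2 * (w + h)) ab _ _)).
  - exact: ccontB.
  - move=> x xab; apply: (le_trans (normcB _ _)); have := bf x xab; have := bg x xab; lra.
  - apply: ler_wpM2r; [lra|]; have : 0 <= e * (w + h) by apply: mulr_ge0; lra.
    lra.
apply: (le_trans (normcD _ _)); rewrite normcM.
have -> : normc (iC : C) = 1 by rewrite /= expr0n /= add0r expr1n sqrtr1.
rewrite mul1r.
have := cD a' (a' + w) (E ^~ c') (E ^~ (c' + h)).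
have := cD c' (c' + h) (E (a' + w)) (E a').
move=> K1 K2.
have {}K1 : normc (cint c' (c' + h) (fun x : R => E (a' + w) x - E a' x)) <= e * (w + h) * h.
  have -> : e * (w + h) * h = e * (w + h) * (c' + h - c') by ring.
  by apply: K1; try apply: E2; try lra; move=> x xc; apply: EP => //; lra.
have {}K2 : normc (cint a' (a' + w) (fun x : R => E x c' - E x (c' + h))) <= e * (w + h) * w.
  have -> : e * (w + h) * w = e * (w + h) * (a' + w - a') by ring.
  by apply: K2; try apply: E1; try lra; move=> x xc; apply: EP => //; lra.
have -> : e * (w + h) ^+ 2 = e * (w + h) * w + e * (w + h) * h by ring.
exact: lerD.
Qed.

Lemma goursat : a <= b -> c <= d -> bdry H a b c d = 0.
Proof.
move=> ab cd; apply/eqP; rewrite -normc_eq0 eq_le normc_ge0 andbT.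
apply/ler_addgt0Pl => e e0; rewrite addr0.
(* The added 1 keeps the denominator positive for degenerate rectangles. *)
pose e' := e / (1 + (b - a + (d - c)) ^+ 2).
have s0 := sqr_ge0 (b - a + (d - c)).
have e'0 : 0 < e' by rewrite divr_gt0 //; lra.
pose beta a' c' w h := normc (bdry H a' (a' + w) c' (c' + h)).
apply: (@le_trans _ _ (e' * (b - a + (d - c)) ^+ 2)); last first.
  rewrite /e' mulrAC ler_pdivrMr; last lra.
  by apply: ler_wpM2l; lra.
have := @bisection beta a c (b - a) (d - c) e'.
rewrite /beta !subrKC; apply; try lra.
- move=> a' c' w' h' [h1 h2 h3 h4 [h5 h6]].
  rewrite (@bdry_splitx a' (a' + w' / 2)); [|lra..].
  rewrite (@bdry_splity a' (c' + h' / 2)); [|lra..].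
  rewrite (@bdry_splity (a' + w' / 2) (c' + h' / 2)); [|lra..].
  have -> : a' + w' / 2 + w' / 2 = a' + w' by field.
  have -> : c' + h' / 2 + h' / 2 = c' + h' by field.
  set N1 := bdry _ _ _ _ _; set N2 := bdry _ _ _ _ _; set N3 := bdry _ _ _ _ _; set N4 := bdry _ _ _ _ _.
  have T0 := normcD (N1 + N2) (N3 + N4).
  have T1 := normcD N1 N2; have T2 := normcD N3 N4.
  apply: (le_trans T0); lra.
- move=> s t sab tcd; have [r r0 rP] := bdry_local sab tcd e'0.
  by exists r => // a' c' w h [h1 h2 h3 h4 [h5 h6]] *; apply: rP.
Qed.

End Rect.
End Goursat.

(** * Complex differentiability and circle means *)

Section CircleMeans.
Context {R : realType}.
Local Notation C := R[i].

Lemma derivable_eps (K : numFieldType) (V : normedModType K) (f : V -> K^o) a v :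
  derivable f a v -> forall e : K, 0 < e ->
   \forall h \near (0 : K), `|f (h *: v + a) - f a - h * 'D_v f a| <= e * `|h|.
Proof.
move=> /derivable_nbhs /eqaddoP H e e0.
have := H e e0; apply: filterS => h /=; rewrite !fctE /=.
by rewrite opprD addrA.
Qed.

Lemma nbhs0R (P : set R) : (\forall h \near (0 : R), P h) ->
  exists2 r : R, 0 < r & forall h, `|h| < r -> P h.
Proof.
move=> /nbhs_ballP[r r0 rP]; exists r => // h hr; apply: rP.
by rewrite /ball /= sub0r normrN.
Qed.

Lemma nbhs0C (P : set C) : (\forall h \near (0 : C^o), P h) ->
  exists2 r : R, 0 < r & forall h, normc h < r -> P h.
Proof.
move=> /nbhs_ballP[r r0 rP]; exists (complex.Re r).
  by move: r0; rewrite /= ltcE => /andP[].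
move=> h hr; apply: rP.
rewrite /ball /= sub0r normrN normCE ltcE /= hr andbT.
by move: r0; rewrite /= ltcE => /andP[].
Qed.

Definition cdiff (g : C -> C) (z : C) := exists d : C, forall e : R, 0 < e ->
  exists2 r : R, 0 < r & forall h, normc h < r ->
     normc (g (z + h) - g z - h * d) <= e * normc h.

Lemma derivable_cdiff (V : normedModType C) (f : V -> C^o) a v : derivable f a v ->
  forall e : R, 0 < e -> exists2 r : R, 0 < r & forall h, normc h < r ->
     normc (f (h *: v + a) - f a - h * 'D_v f a) <= e * normc h.
Proof.
move=> fd e e0; have := @derivable_eps _ _ _ _ _ fd (Complex e 0).
rewrite ltcE /= eqxx e0 => /(_ erefl) /nbhs0C[r r0 rP]; exists r => // h /rP.
by rewrite !normCE lecE /= => /andP[_]; rewrite mulr0 subr0.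
Qed.

Lemma cdiffP (f : C -> C) z : derivable (f : CC R -> CC R) z 1 -> cdiff f z.
Proof.
move=> fd; exists ('D_1 (f : CC R -> CC R) z) => e e0.
have [r r0 rP] := derivable_cdiff fd e0; exists r => // h /rP.
by have -> : h *: (1 : CC R) + z = z + h by rewrite addrC -[h *: _]/(h * 1) mulr1.
Qed.

Lemma kernel_derivable (f : C -> C) c w z : derivable (f : CC R -> CC R) z 1 -> z != w ->
  derivable ((fun z => z * (f z - c) * (z - w)^-1) : CC R -> CC R) z 1.
Proof.
move=> fd zw.
have d1 : derivable (fun z : CC R => z : CC R) z 1 by exact: derivable_id.
have d2 : derivable (fun z : CC R => f z - c : CC R) z 1.
  exact: (@derivableB C (CC R) (CC R) f (fun=> c) z 1 fd (derivable_cst _ _ _)).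
have d4 : derivable (fun z : CC R => z - w : CC R) z 1.
  exact: (@derivableB C (CC R) (CC R) id (fun=> w) z 1 d1 (derivable_cst _ _ _)).
have d3 : derivable (fun z : CC R => (z - w)^-1 : CC R) z 1.
  by apply: (@derivableV C (CC R) _ z 1 _ d4); rewrite subr_eq0.
exact: (@derivableM C (CC R) _ _ z 1 (@derivableM C (CC R) _ _ z 1 d1 d2) d3).
Qed.

Lemma cdiff_cont g z : cdiff g z -> forall e : R, 0 < e -> exists2 r : R, 0 < r &
  forall u, normc (z - u) < r -> normc (g z - g u) < e.
Proof.
move=> [d dP] e e0; have [r r0 rP] := dP 1 ltr01; have nd := normc_ge0 d.
exists (Num.min r (e / (2 * (1 + normc d)))).
  by rewrite lt_min r0 divr_gt0 //; lra.
move=> u; rewrite lt_min normc_distC => /andP[u1 u2].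
have := rP (u - z) u1; rewrite subrKC mul1r => K.
have T := normcD (g u - g z - (u - z) * d) ((u - z) * d).
rewrite subrK normcM in T; rewrite normc_distC.
rewrite ltr_pdivlMr in u2; last lra.
have := mulr_ge0 nd (normc_ge0 (u - z)); nra.
Qed.

Definition cis (t : R) : C := Complex (cos t) (sin t).
Definition pol (r t : R) : C := Complex r 0 * cis t.

Lemma normc_cis t : normc (cis t) = 1.
Proof. by rewrite /= cos2Dsin2 sqrtr1. Qed.

Lemma cisD s t : cis (s + t) = cis s * cis t.
Proof. by apply: complexP; rewrite ?cReM ?cImM /= ?cosD ?sinD //; ring. Qed.

Lemma normc_pol r t : 0 <= r -> normc (pol r t) = r.
Proof. by move=> r0; rewrite normcM normc_cis mulr1 normcR ger0_norm. Qed.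

Lemma complexRM (a b : R) : Complex (a * b) 0 = Complex a 0 * Complex b 0 :> C.
Proof. by apply: complexP; rewrite ?cReM ?cImM /=; ring. Qed.

Lemma pol_expD s t x y :
  pol (expR (s + x)) (t + y) = pol (expR s) t * pol (expR x) y.
Proof. by rewrite /pol expRD complexRM cisD; ring. Qed.

Lemma real_eps (f : R -> R) (a d : R) : is_derive a 1 f d ->
  forall e : R, 0 < e -> exists2 r : R, 0 < r & forall h, `|h| < r ->
     `|f (a + h) - f a - h * d| <= e * `|h|.
Proof.
move=> fd e e0; have fd' := @ex_derive _ _ _ _ _ _ _ fd.
have [r r0 rP] := nbhs0R (@derivable_eps R R (f : R -> R^o) a 1 fd' e e0).
exists r => // h /rP; rewrite [h *: _]mulr1 addrC.
by rewrite derive_val [- _ + _]addrC [h + a]addrC.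
Qed.

(** Differentiability of $x+iy\mapsto e^{x+iy}$ at 0 with derivative 1, assembled from the real
    derivatives of [expR], [cos] and [sin] at 0. *)
Lemma pol_expR_eps (e : R) : 0 < e -> exists2 r : R, 0 < r & forall x y, `|x| < r -> `|y| < r ->
  normc (pol (expR x) y - 1 - Complex x y) <= e * (`|x| + `|y|).
Proof.
move=> e0; pose e' := Num.min 1 (e / 5).
have e'0 : 0 < e' by rewrite lt_min ltr01 divr_gt0.
have e'1 : e' <= 1 by rewrite ge_min lexx.
have e'e : e' <= e / 5 by rewrite ge_min lexx orbT.
clearbody e'.
have [r1 r10 r1P] := real_eps (is_derive_expR 0) e'0.
have [r2 r20 r2P] := real_eps (is_derive_cos 0) e'0.
have [r3 r30 r3P] := real_eps (is_derive_sin 0) e'0.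
exists (Num.min (Num.min r1 r2) (Num.min r3 e')).
  by rewrite !lt_min r10 r20 r30 e'0.
move=> x y; rewrite !lt_min => /andP[/andP[x1 x2] /andP[x3 x4]] /andP[/andP[y1 y2] /andP[y3 y4]].
have := r1P x x1; have := r2P y y2; have := r3P y y3.
rewrite !add0r expR0 cos0 sin0 !mulr1 subr0 oppr0 mulr0 subr0.
set S := sin y; set K := cos y; set E := expR x => HS HK HE.
have K1 : `|K| <= 1 by rewrite ler_norml cos_geN1 cos_le1.
apply: (le_trans (normc_ReIm _)).
rewrite /pol !cReD !cImD !cReN !cImN cReM cImM /= -/S -/K !mul0r subr0 addr0 subr0.
have -> : E * K - 1 - x = (E - 1 - x) * K + (1 + x) * (K - 1) by ring.
have -> : E * S - y = E * (S - y) + (E - 1) * y by ring.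
have x0 := normr_ge0 x; have y0 := normr_ge0 y.
have EB : `|E - 1| <= 2 * `|x|.
  have -> : E - 1 = (E - 1 - x) + x by ring.
  by apply: (le_trans (ler_normD _ _)); nra.
have EE : `|E| <= 3.
  have -> : E = (E - 1) + 1 by ring.
  by apply: (le_trans (ler_normD _ _)); rewrite normr1; lra.
have XB : `|1 + x| <= 2 by apply: (le_trans (ler_normD _ _)); rewrite normr1; lra.
have M1 : `|(E - 1 - x) * K + (1 + x) * (K - 1)| <= e' * `|x| + 2 * (e' * `|y|).
  apply: (le_trans (ler_normD _ _)); rewrite !normrM; apply: lerD.
    by rewrite -[leRHS]mulr1; apply: ler_pM.
  by apply: ler_pM.
have M2 : `|E * (S - y) + (E - 1) * y| <= 3 * (e' * `|y|) + 2 * `|x| * e'.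
  apply: (le_trans (ler_normD _ _)); rewrite !normrM; apply: lerD.
    by apply: ler_pM.
  by apply: ler_pM => //; exact: ltW.
have : e' * `|x| <= e / 5 * `|x| by apply: ler_wpM2r.
have : e' * `|y| <= e / 5 * `|y| by apply: ler_wpM2r.
nra.
Qed.

(* An annulus is the image of a vertical strip under s + i t |-> exp(s + i t), so circle
   means are compared by integrating over a rectangle. *)
Lemma cdiff_strip g s t : cdiff g (pol (expR s) t) ->
  cdiff2 (fun x y => g (pol (expR x) y)) s t.
Proof.
set z := pol _ _ => -[D DP]; exists (z * D) => e e0.
have nz := normc_ge0 z; have nD := normc_ge0 D.
have nzD := mulr_ge0 nz nD.
have e10 : 0 < e / (4 * (1 + normc z)) by rewrite divr_gt0 //; lra.
have [r1 r10 r1P] := DP _ e10.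
pose e2 := Num.min 1 (e / (4 * (1 + normc z * normc D))).
have e20 : 0 < e2 by rewrite lt_min ltr01 divr_gt0 //; lra.
have e21 : e2 <= 1 by rewrite ge_min lexx.
have e2e : e2 <= e / (4 * (1 + normc z * normc D)) by rewrite ge_min lexx orbT.
rewrite ler_pdivlMr in e2e; last lra.
clearbody e2.
have [r2 r20 r2P] := pol_expR_eps e20.
exists (Num.min r2 (r1 / (4 * (1 + normc z)))).
  by rewrite lt_min r20 divr_gt0 //; lra.
move=> x y; rewrite !lt_min => /andP[x1 x2] /andP[y1 y2].
have := r2P x y x1 y1; rewrite pol_expD -/z; set X := pol _ _ => HX.
have S0 : 0 <= `|x| + `|y| by rewrite addr_ge0.
set S := `|x| + `|y| in HX S0 *.
(* The increment from [z] to [z * X]: the differential of [g] at [z] is then composed with that of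
   the exponential at 0. *)
pose eta := z * (X - 1).
have X1 : normc (X - 1) <= 2 * S.
  have -> : X - 1 = (X - 1 - Complex x y) + Complex x y by ring.
  have N2 : normc (Complex x y) <= S by exact: normc_ReIm.
  apply: (le_trans (normcD _ _)).
  have : e2 * S <= 1 * S by apply: ler_wpM2r.
  lra.
have eta1 : normc eta <= normc z * (2 * S) by rewrite normcM ler_wpM2l.
have etar : normc eta < r1.
  apply: (le_lt_trans eta1).
  move: x2 y2; rewrite !ltr_pdivlMr; try lra.
  move=> x2 y2; have : S * (4 * (1 + normc z)) < r1 + r1 by rewrite /S; lra.
  nra.
have := r1P eta etar.
have -> : z + eta = z * X by rewrite /eta; ring.
move=> G.
have -> : g (z * X) - g z - z * D * Complex x y =
  (g (z * X) - g z - eta * D) + z * D * (X - 1 - Complex x y) by rewrite /eta; ring.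
apply: (le_trans (normcD _ _)); rewrite [normc (z * D * _)]normcM [normc (z * D)]normcM.
have A : e / (4 * (1 + normc z)) * normc eta <= e / 2 * S.
  apply: (@le_trans _ _ (e / (4 * (1 + normc z)) * (normc z * (2 * S)))).
    by apply: ler_wpM2l => //; exact: ltW.
  have -> : e / (4 * (1 + normc z)) * (normc z * (2 * S)) = (e / 2 * S) * (normc z / (1 + normc z)).
    by field; lra.
  rewrite -[leRHS]mulr1; apply: ler_wpM2l; first by apply: mulr_ge0 => //; lra.
  by rewrite ler_pdivrMr; lra.
have B : normc z * normc D * normc (X - 1 - Complex x y) <= e / 4 * S.
  apply: (@le_trans _ _ (normc z * normc D * (e2 * S))); first exact: ler_wpM2l.
  rewrite mulrA; apply: ler_wpM2r => //.
  move: e2e; set p := normc z * normc D; lra.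
apply: (le_trans (lerD (le_trans G A) B)).
have := mulr_ge0 (ltW e0) S0; lra.
Qed.

(** Integration is against $dt$ and not $dz=iz\,dt$, which is why the Cauchy kernels below carry an
    additional factor $z$. *)
Definition circ (g : C -> C) (r : R) : C := cint 0 (2 * pi) (fun t => g (pol r t)).

Lemma twopi_ge0 : 0 <= 2 * pi :> R. Proof. by rewrite mulr_ge0 // pi_ge0. Qed.

Lemma ccont_circ g r : 0 < r -> (forall z, normc z = r -> cdiff g z) ->
  ccont 0 (2 * pi) (fun t => g (pol r t)).
Proof.
move=> r0 gd; rewrite -(lnK r0).
apply: (@ccont_snd R (fun x y => g (pol (expR x) y))) => t _; apply: cdiff_strip.
by apply: gd; rewrite lnK ?posrE // normc_pol // ltW.
Qed.

(** Goursat on $[\ln r_1,\ln r_2]\times[0,2\pi]$ for $g(e^{s+it})$: the two horizontal sides cancel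
    by periodicity, and the two vertical sides are the circle means. *)
Lemma circ_const g r1 r2 : 0 < r1 -> r1 <= r2 ->
  (forall z, r1 <= normc z <= r2 -> cdiff g z) -> circ g r1 = circ g r2.
Proof.
move=> r10 r12 gd; have r20 := lt_le_trans r10 r12.
have hH x y : ln r1 <= x <= ln r2 -> 0 <= y <= 2 * pi -> 
   cdiff2 (fun x y => g (pol (expR x) y)) x y.
  move=> /andP[x1 x2] _; apply: cdiff_strip; apply: gd.
  rewrite normc_pol ?expR_ge0 //.
by rewrite -[r1](lnK r10) -[r2](lnK r20) !ler_expR x1.
have l12 : ln r1 <= ln r2 by rewrite ler_ln ?posrE.
have := goursat hH l12 twopi_ge0.
rewrite /bdry (@eq_cint _ _ _ _ (fun=> 0)); last first.
  by move=> x _; rewrite /pol /cis cos0 sin0 mulr_natl cos2pi sin2pi subrr.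
rewrite cint_cst // mul0r add0r cintB; last 2 first.
- by apply: (ccont_snd (H := fun x y => g (pol (expR x) y))) => y yc; apply: hH => //; rewrite l12 lexx.
- by apply: (ccont_snd (H := fun x y => g (pol (expR x) y))) => y yc; apply: hH => //; rewrite l12 lexx.
rewrite !lnK ?posrE // => /eqP; rewrite mulf_eq0 subr_eq0.
rewrite /circ => /orP[|/eqP->//]; rewrite eq_complex /= => /andP[_].
by rewrite oner_eq0.
Qed.

End CircleMeans.

(** * Cauchy's formula and the Taylor expansion in one variable *)

Section CauchySeries.
Context {R : realType}.
Local Notation C := R[i].
Local Notation mu := (@lebesgue_measure R).

Definition contat (g : C -> C) (z : C) := forall e : R, 0 < e -> exists2 r : R, 0 < r &
  forall u, normc (z - u) < r -> normc (g z - g u) < e.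

Lemma pol_radial (r s t : R) : normc (pol r t - pol s t) = `|r - s|.
Proof.
rewrite /pol -mulrBl normcM normc_cis mulr1 -normcR; congr normc.
by apply: complexP; rewrite ?cReD ?cImD ?cReN ?cImN /= ?subr0.
Qed.

Lemma pol_angular : exists2 d : R, 0 < d & forall r t s : R, 0 <= r -> `|t - s| < d ->
  normc (pol r t - pol r s) <= r * (2 * `|t - s|).
Proof.
have [d d0 dP] := @pol_expR_eps R 1 ltr01; exists d => // r t s r0 ts.
have -> : pol r t - pol r s = pol r s * (cis (t - s) - 1).
  have E : cis t = cis (t - s) * cis s by rewrite -cisD subrK.
  rewrite /pol E; move: (cis _) (cis _) (Complex _ _) => u v w; ring.
rewrite normcM normc_pol //; apply: ler_wpM2l => //.
have := dP 0 (t - s); rewrite normr0 => /(_ d0 ts).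
rewrite mul1r add0r expR0 {1}/pol mul1r => K.
have -> : cis (t - s) - 1 = (cis (t - s) - 1 - Complex 0 (t - s)) + Complex 0 (t - s) by ring.
apply: (le_trans (normcD _ _)).
have : normc (Complex 0 (t - s)) <= `|t - s|.
  by apply: (le_trans (normc_ReIm _)); rewrite /= normr0 add0r.
move: K; lra.
Qed.

Lemma contat_ccont g (r : R) : 0 < r -> (forall z, normc z = r -> contat g z) ->
  ccont 0 (2 * pi) (fun t => g (pol r t)).
Proof.
move=> r0 gc; apply: ccont_eps => t _ e e0.
have [|d d0 dP] := gc (pol r t) _ e e0; first by rewrite normc_pol // ltW.
have [b b0 bP] := pol_angular.
exists (Num.min b (d / (2 * r))); first by rewrite lt_min b0 divr_gt0 //; lra.
move=> s _; rewrite lt_min => /andP[s1 s2]; apply: dP.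
apply: (le_lt_trans (bP _ _ _ (ltW r0) s1)).
by move: s2; rewrite ltr_pdivlMr; lra.
Qed.

(** Continuity under the integral sign, dominated by the constant [B]. It lets the radius cross
    $|w|$, where the kernel is continuous but [circ_const] does not apply. *)
Lemma circ_cont g (rho B t : R) : (forall z, normc z < rho -> contat g z) ->
  (forall z, normc z < rho -> normc (g z) <= B) -> 0 < t -> t < rho ->
  forall e : R, 0 < e -> exists2 r : R, 0 < r & forall s, `|t - s| < r ->
    normc (circ g t - circ g s) < e.
Proof.
move=> gc gB t0 tr e e0.
have K (T : C -> R) : (forall z, `|T z| <= normc z) -> (forall z w, T (z - w) = T z - T w) ->
    (forall a b h, ccont a b h -> {within `[a, b], continuous (T \o h)}) ->
    exists2 r : R, 0 < r & forall s, `|t - s| < r ->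
     `| \int[mu]_(x in `[0, 2 * pi]) T (g (pol t x)) - 
        \int[mu]_(x in `[0, 2 * pi]) T (g (pol s x)) | < e / 2.
  move=> Tn TB Tc.
  have := @continuity_under_integral R _ _ mu (fun s x => T (g (pol s x))) `[0, 2 * pi]
    (measurable_itv _) 0 rho _ _ (fun=> B) _ _ t.
  have cl : forall x, `]0, rho[%classic x -> 
      mu.-integrable `[0, 2 * pi] (EFin \o (fun y => T (g (pol x y)))).
    move=> s; rewrite /= in_itv /= => /andP[s0 sr]; apply: within_integrable.
    by apply: Tc; apply: contat_ccont => // z zs; apply: gc; rewrite zs.
  move=> /(_ cl).
  have c2 : \forall y \ae mu, `[0, 2 * pi]%classic y -> 
      {in `]0, rho[%classic, continuous (fun s => T (g (pol s y)))}.
    apply: aeW => y _ s; rewrite inE /= in_itv /= => /andP[s0 sr].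
    apply/cvgrPdist_lt => e' e'0.
    have [|d d0 dP] := gc (pol s y) _ e' e'0; first by rewrite normc_pol // ltW.
    near=> u; rewrite -TB; apply: (le_lt_trans (Tn _)); apply: dP; rewrite pol_radial.
    by near: u; exact: (@nbhsx_ballx R R s d d0).
  move=> /(_ c2).
  have c3 : mu.-integrable `[0, 2 * pi] (EFin \o (fun=> B)).
    by apply: (@within_integrable _ _ _ (fun=> B)); apply: continuous_subspaceT => x; exact: cvg_cst.
  move=> /(_ c3).
  have c4 : forall x, `]0, rho[%classic x -> \forall y \ae mu, `[0, 2 * pi]%classic y ->
       `|T (g (pol x y))| <= B.
    move=> s; rewrite /= in_itv /= => /andP[s0 sr]; apply: aeW => y _.
    by apply: (le_trans (Tn _)); apply: gB; rewrite normc_pol // ltW.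
  move=> /(_ c4).
  rewrite inE /= in_itv /= t0 tr => /(_ isT) /cvgrPdist_lt /(_ (e / 2)) H.
  have /H /nbhs_ballP[r r0 rP] : 0 < e / 2 by lra.
  by exists r => // s sr; apply: rP.
have [r1 r10 r1P] := K _ normc_Re (fun z w => etrans (cReD _ _) (congr1 _ (cReN w))) (fun a b h h' => proj1 h').
have [r2 r20 r2P] := K _ normc_Im (fun z w => etrans (cImD _ _) (congr1 _ (cImN w))) (fun a b h h' => proj2 h').
exists (Num.min r1 r2); first by rewrite lt_min r10.
move=> s; rewrite lt_min => /andP[s1 s2].
apply: (le_lt_trans (normc_ReIm _)); rewrite cReD cImD cReN cImN.
rewrite (splitr e); apply: ltrD; [exact: r1P|exact: r2P].
Unshelve. all: by end_near.
Qed.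

Section Cauchy.
Variables (f : C -> C) (rho M : R) (w : C).
Hypotheses (fd : forall z, normc z <= rho -> derivable (f : CC R -> CC R) z 1)
  (fM : forall z, normc z <= rho -> normc (f z) <= M) (wr : normc w < rho).

Let G' z := z * (f z - f w) * (z - w)^-1.

Let rho0 : 0 < rho. Proof. exact: le_lt_trans (normc_ge0 w) wr. Qed.

Let M0 : 0 <= M.
Proof. by apply: le_trans (normc_ge0 (f 0)) (fM _); rewrite normc0 ltW. Qed.

Let cdG' z : normc z <= rho -> z != w -> cdiff G' z.
Proof. by move=> zr zw; apply: cdiffP; apply: kernel_derivable => //; exact: fd. Qed.

(** With its singularity removed the kernel is continuous. Its circle means are constant on
    $(0,|w|)$ and on $(|w|,\rho]$, tend to 0 with the radius because of the factor $z$, and are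
    continuous across $|w|$. *)
Lemma cauchy_kernel_zero : circ G' rho = 0.
Proof.
have [D DP] : cdiff f w by apply: cdiffP; apply: fd; exact: ltW.
(* The singularity at [w] is filled with the limit $w f'(w)$. *)
pose G z := if z == w then w * D else G' z.
have GG' z : z != w -> G z = G' z by rewrite /G => /negPf ->.
have contG z : normc z < rho -> contat G z.
  move=> zr; have [-> {z zr}|zw] := eqVneq z w.
    move=> e e0; have nw := normc_ge0 w; have nD := normc_ge0 D.
    have [|r r0 rP] := DP (e / (2 * (1 + normc w + 1))); first by rewrite divr_gt0 //; lra.
    exists (Num.min (Num.min 1 r) (e / (4 * (1 + normc D)))).
      by rewrite !lt_min ltr01 r0 divr_gt0 //; lra.
    move=> u; rewrite !lt_min => /andP[/andP[u1 u2] u3].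
    rewrite /G eqxx; have [_|uw] := eqVneq u w; first by rewrite subrr normc0.
    rewrite normc_distC in u1 u2 u3.
    have h0 : u - w != 0 by rewrite subr_eq0.
    have := rP (u - w) u2; rewrite subrKC => H.
    have -> : w * D - G' u = - (u * ((f u - f w - (u - w) * D) / (u - w)) + (u - w) * D).
      by rewrite /G'; field.
    rewrite normcN; apply: (le_lt_trans (normcD _ _)); rewrite !normcM normcV.
    have nh : 0 < normc (u - w) by rewrite normc_gt0.
    have A : normc (f u - f w - (u - w) * D) / normc (u - w) <= e / (2 * (1 + normc w + 1)).
      by rewrite ler_pdivrMr.
    have U : normc u <= normc w + 1.
      by rewrite -(subrK w u); apply: (le_trans (normcD _ _)); lra.
    have : normc u * (normc (f u - f w - (u - w) * D) / normc (u - w)) <= 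
        (normc w + 1) * (e / (2 * (1 + normc w + 1))).
      apply: ler_pM => //; [exact: normc_ge0|].
      by apply: mulr_ge0; rewrite ?invr_ge0 ?normc_ge0.
    have : (normc w + 1) * (e / (2 * (1 + normc w + 1))) < e / 2.
      rewrite mulrA ltr_pdivrMr; nra.
    move: u3; rewrite ltr_pdivlMr; last lra.
    have := mulr_ge0 nD (ltW nh); set p := normc D * _; rewrite [normc (u - w) * normc D]mulrC -/p.
    have -> : normc (u - w) * (4 * (1 + normc D)) = 4 * normc (u - w) + 4 * p by rewrite /p; ring.
    lra.
  move=> e e0; have [r r0 rP] := cdiff_cont (cdG' (ltW zr) zw) e0.
  exists (Num.min r (normc (z - w))); first by rewrite lt_min r0 normc_gt0 subr_eq0.
  move=> u; rewrite lt_min => /andP[u1 u2].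
  rewrite !GG' //; first exact: rP.
  by apply/eqP => uw; move: u2; rewrite uw ltxx.
(* A bound linear in $|z|$: the difference quotient is at most $|D|+1$ near [w], by
   differentiability, and at most $2M/r$ away from [w]. *)
have [B B0 BP] : exists2 B : R, 0 <= B & forall z, normc z <= rho -> normc (G z) <= B * normc z.
  have [r r0 rP] := DP 1 ltr01.
  have nD := normc_ge0 D.
  have q0 : 0 <= 2 * M / r by rewrite divr_ge0 ?mulr_ge0 // ltW.
  exists (normc D + 1 + 2 * M / r); first lra.
  move=> z zr; rewrite mulrC /G; have [->|zw] := eqVneq z w.
    by rewrite normcM; apply: ler_wpM2l; [exact: normc_ge0|lra].
  rewrite /G' -mulrA normcM normcM normcV; apply: ler_wpM2l; first exact: normc_ge0.
  have nh : 0 < normc (z - w) by rewrite normc_gt0 subr_eq0.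
  rewrite ler_pdivrMr //.
  have EB : (normc D + 1 + 2 * M / r) * normc (z - w) =
     normc D * normc (z - w) + normc (z - w) + 2 * M / r * normc (z - w) by ring.
  have [zs|zs] := ltP (normc (z - w)) r.
    have := rP _ zs; rewrite subrKC mul1r => H.
    have -> : f z - f w = (f z - f w - (z - w) * D) + (z - w) * D by ring.
    apply: (le_trans (normcD _ _)); rewrite normcM.
    have := mulr_ge0 q0 (ltW nh); rewrite EB [normc (z - w) * _]mulrC.
    move: H; lra.
  apply: (le_trans (normcB _ _)).
  have := fM zr; have := fM (ltW wr).
  have : 2 * M <= 2 * M / r * normc (z - w).
    by rewrite mulrAC ler_pdivlMr //; apply: ler_wpM2l => //; apply: mulr_ge0.
  have := mulr_ge0 nD (ltW nh); rewrite EB; lra.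
have inner r1 r2 : 0 < r1 -> r1 <= r2 -> r2 <= rho -> (r2 < normc w \/ normc w < r1) ->
    circ G' r1 = circ G' r2.
  move=> r10 r12 r2r side; apply: circ_const => // z /andP[z1 z2]; apply: cdG'; first lra.
  by apply/eqP => zw; rewrite zw in z1 z2; case: side; lra.
have GG'c r : r != normc w -> 0 < r -> circ G r = circ G' r.
  move=> rw r0; apply: eq_cint => t _; apply: GG'; apply/eqP => E.
  by move: rw; rewrite -E normc_pol ?eqxx // ltW.
have pi0 : 0 < pi :> R by exact: pi_gt0.
have bound r : 0 < r -> r < rho -> normc (circ G r) <= 2 * (B * r) * (2 * pi).
  move=> r0 rr.
  apply: (le_trans (cint_bound (M := B * r) twopi_ge0 _ _)).
  - by apply: contat_ccont => // z zr; apply: contG; rewrite zr.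
  - move=> t _; have := BP (pol r t); rewrite normc_pol; last exact: ltW.
    by apply; exact: ltW.
  - by rewrite subr0.
have small c r0 : 0 < r0 -> r0 <= rho -> (forall r, 0 < r -> r < r0 -> circ G r = c) -> c = 0.
  move=> r00 r0r H; apply/eqP; rewrite -normc_eq0 eq_le normc_ge0 andbT.
  apply/ler_addgt0Pl => e e0; rewrite addr0.
  pose r := Num.min (r0 / 2) (e / (1 + 4 * B * pi)).
  have Bp : 0 <= B * pi by rewrite mulr_ge0 // ltW.
  have rr : 0 < r by rewrite lt_min !divr_gt0 //; lra.
  have rr0 : r < r0.
    by rewrite (@le_lt_trans _ _ (r0 / 2)) ?ge_min ?lexx //; lra.
  rewrite -(H r) //; apply: (le_trans (bound _ rr _)); first lra.
  have : r <= e / (1 + 4 * B * pi) by rewrite ge_min lexx orbT.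
  rewrite ler_pdivlMr; last lra.
  nra.
(* For [w = 0] there is no circle to cross: the means on $(0,\rho]$ are all equal. *)
have [w0|w0] := eqVneq w 0.
  rewrite -(@small (circ G' rho) rho rho0 (lexx _)) // => r r0 rr.
  rewrite GG'c ?w0 ?normc0 //; last by rewrite gt_eqF.
  by apply: inner; rewrite ?w0 ?normc0; [|exact: ltW|exact: lexx|right].
have nw : 0 < normc w by rewrite normc_gt0.
apply/eqP; rewrite -normc_eq0 eq_le normc_ge0 andbT.
apply/ler_addgt0Pl => e e0; rewrite addr0.
have e20 : 0 < e / 2 by lra.
have GB z : normc z < rho -> normc (G z) <= B * rho.
  by move=> zr; apply: (le_trans (BP _ (ltW zr))); apply: ler_wpM2l => //; exact: ltW.
have [d d0 dP] := circ_cont contG GB nw wr e20.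
(* Radii on either side of $|w|$ and within [d] of it: the mean vanishes at [s1], and at [s2] it is
   already the mean at [rho]. *)
pose s1 := normc w - Num.min (d / 2) (normc w / 2).
pose s2 := normc w + Num.min (d / 2) ((rho - normc w) / 2).
have m1 : 0 < Num.min (d / 2) (normc w / 2) by rewrite lt_min; apply/andP; split; lra.
have m1d : Num.min (d / 2) (normc w / 2) <= d / 2 by rewrite ge_min lexx.
have m1w : Num.min (d / 2) (normc w / 2) <= normc w / 2 by rewrite ge_min lexx orbT.
have m2 : 0 < Num.min (d / 2) ((rho - normc w) / 2) by rewrite lt_min !divr_gt0 ?subr_gt0.
have m2d : Num.min (d / 2) ((rho - normc w) / 2) <= d / 2 by rewrite ge_min lexx.
have m2w : Num.min (d / 2) ((rho - normc w) / 2) <= (rho - normc w) / 2 by rewrite ge_min lexx orbT.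
have s1P : 0 < s1 < normc w by rewrite /s1; apply/andP; split; lra.
have s2P : normc w < s2 < rho by rewrite /s2; apply/andP; split; lra.
have S1 : circ G s1 = 0.
  apply: (@small _ s1); [by lra|by lra|] => r r0 rs.
  rewrite !GG'c; [|lra..].
  by apply: inner; [done|lra|lra|left; lra].
have S2 : circ G s2 = circ G' rho.
  rewrite GG'c; [|lra..].
  by apply: inner; [lra|lra|lra|right; lra].
have D1 := dP s1; have D2 := dP s2; rewrite S1 S2 subr0 in D1 D2.
have {}D1 : normc (circ G (normc w)) < e / 2.
  by apply: D1; rewrite /s1 opprB addrC subrK gtr0_norm //; lra.
have {}D2 : normc (circ G (normc w) - circ G' rho) < e / 2.
  by apply: D2; rewrite /s2 opprD addNKr normrN gtr0_norm //; lra.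
have -> : circ G' rho = circ G (normc w) - (circ G (normc w) - circ G' rho) by ring.
by apply: (le_trans (normcB _ _)); lra.
Qed.

(** The mean does not depend on the radius beyond $|w|$, and $z/(z-w)\to1$ as the radius grows. *)
Lemma cauchy_one : circ (fun z => z * (z - w)^-1) rho = Complex (2 * pi) 0.
Proof.
have nw := normc_ge0 w.
have cd z : normc w < normc z -> cdiff (fun z => z * (z - w)^-1) z.
  move=> zw; apply: cdiffP.
  have d1 : derivable (fun z : CC R => z : CC R) z 1 by exact: derivable_id.
  have d4 : derivable (fun z : CC R => z - w : CC R) z 1.
    exact: (@derivableB C (CC R) (CC R) id (fun=> w) z 1 d1 (derivable_cst _ _ _)).
  have d3 : derivable (fun z : CC R => (z - w)^-1 : CC R) z 1.
    apply: (@derivableV C (CC R) _ z 1 _ d4); rewrite subr_eq0.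
    by apply/eqP => E; move: zw; rewrite E ltxx.
  exact: (@derivableM C (CC R) _ _ z 1 d1 d3).
have pi0 : 0 < pi :> R by exact: pi_gt0.
apply/eqP; rewrite -subr_eq0 -normc_eq0 eq_le normc_ge0 andbT.
apply/ler_addgt0Pl => e e0; rewrite addr0.
(* Makes the final error $4\pi|w|/(r-|w|)$ at most [e]. *)
pose r := rho + 4 * pi * normc w / e.
have q0 : 0 <= 4 * pi * normc w / e by rewrite !mulr_ge0 // ?invr_ge0 ltW.
have rr : rho <= r by rewrite /r; lra.
rewrite (@circ_const _ _ rho r) //; last by move=> z /andP[z1 _]; apply: cd; exact: lt_le_trans z1.
have r0 : 0 < r by exact: lt_le_trans rr.
have wr' : normc w < rho := wr.
have cc : ccont 0 (2 * pi) (fun t => pol r t * (pol r t - w)^-1).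
  apply: (@ccont_circ R (fun z => z * (z - w)^-1)) => // z zr.
  by apply: cd; rewrite zr; lra.
have -> : Complex (2 * pi) 0 = cint 0 (2 * pi) (fun=> 1) :> C.
  by rewrite cint_cst ?twopi_ge0 // mul1r subr0.
rewrite /circ -cintB //; last exact: ccont_cst.
apply: (le_trans (cint_bound (M := normc w / (r - normc w)) twopi_ge0 _ _)).
- by apply: ccontB => //; exact: ccont_cst.
- move=> t _; have np : normc (pol r t) = r by rewrite normc_pol // ltW.
  have nz : r - normc w <= normc (pol r t - w).
    by have := normcD (pol r t - w) w; rewrite subrK np; lra.
  have nz0 : pol r t - w != 0 by rewrite -normc_gt0; lra.
  have -> : pol r t * (pol r t - w)^-1 - 1 = w / (pol r t - w) by field.
  rewrite normcM normcV; apply: ler_wpM2l => //.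
  by rewrite lef_pV2 ?posrE //; lra.
- rewrite subr0.
  have -> : 2 * (normc w / (r - normc w)) * (2 * pi) = 4 * pi * normc w / (r - normc w) by field; lra.
  rewrite ler_pdivrMr; last lra.
  have : e * (r - normc w) = e * (rho - normc w) + 4 * pi * normc w.
    by rewrite /r; field; lra.
  move=> ->; have : 0 <= e * (rho - normc w) by apply: mulr_ge0; lra.
  lra.
Qed.

(** Splits $zf(z)/(z-w)$ into the kernel of mean zero plus $f(w)\,z/(z-w)$. *)
Lemma cauchy_formula : circ (fun z => z * f z * (z - w)^-1) rho = f w * Complex (2 * pi) 0.
Proof.
have nz z : normc z = rho -> z - w != 0.
  by move=> zr; rewrite subr_eq0; apply/eqP => E; move: wr; rewrite -E zr ltxx.
have c1 : ccont 0 (2 * pi) (fun t => pol rho t / (pol rho t - w)).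
  have := @ccont_circ R (fun z => z * (1 - 0) * (z - w)^-1) rho rho0 _.
  rewrite (_ : (fun t => _) = (fun t => pol rho t * (pol rho t - w)^-1)); last first.
    by apply/funext => t; rewrite subr0 mulr1.
  apply=> z zr; apply: cdiffP; apply: (kernel_derivable (f := fun=> 1)); first exact: derivable_cst.
  by rewrite -subr_eq0 nz.
rewrite -cauchy_one /circ -cintZ //.
rewrite -[LHS]subr0 -cauchy_kernel_zero /circ.
apply/eqP; rewrite subr_eq addrC -subr_eq; apply/eqP.
rewrite -cintB.
- apply: eq_cint => t _; rewrite /G'; ring.
- rewrite (_ : (fun x => _) = (fun t => pol rho t * (f (pol rho t) - 0) * (pol rho t - w)^-1)); last first.
    by apply/funext => t; rewrite subr0.
  apply: (@ccont_circ R (fun z => z * (f z - 0) * (z - w)^-1) rho rho0) => z zr.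
  apply: cdiffP; apply: kernel_derivable; last by rewrite -subr_eq0 nz.
  by apply: fd; rewrite zr.
- exact: ccontZ.
Qed.

End Cauchy.

Lemma ccontM a b (g h : R -> C) : ccont a b g -> ccont a b h -> ccont a b (fun x => g x * h x).
Proof.
move=> [g1 g2] [h1 h2]; split.
- rewrite (_ : _ \o _ = fun x => (@complex.Re R \o g) x * (@complex.Re R \o h) x - (@complex.Im R \o g) x * (@complex.Im R \o h) x).
    by move=> x; apply: cvgB; apply: cvgM; [exact: g1|exact: h1|exact: g2|exact: h2].
  by apply/funext => x /=; rewrite cReM.
- rewrite (_ : _ \o _ = fun x => (@complex.Re R \o g) x * (@complex.Im R \o h) x + (@complex.Im R \o g) x * (@complex.Re R \o h) x).
    by move=> x; apply: cvgD; apply: cvgM; [exact: g1|exact: h2|exact: g2|exact: h1].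
  by apply/funext => x /=; rewrite cImM.
Qed.

Lemma ccontX a b (g : R -> C) k : ccont a b g -> ccont a b (fun x => g x ^+ k).
Proof.
move=> gc; elim: k => [|k IH].
  by rewrite (_ : (fun x => _) = fun=> 1); [exact: ccont_cst|apply/funext => x; rewrite expr0].
rewrite (_ : (fun x => _) = fun x => g x * g x ^+ k); first exact: ccontM.
by apply/funext => x; rewrite exprS.
Qed.

Lemma cint_sum a b N (g : nat -> R -> C) : (forall k, ccont a b (g k)) -> a <= b ->
  cint a b (fun x => \sum_(k < N) g k x) = \sum_(k < N) cint a b (g k) /\
  ccont a b (fun x => \sum_(k < N) g k x).
Proof.
move=> gc ab; elim: N => [|N [IH1 IH2]].
  rewrite (_ : (fun x => _) = fun=> 0); last by apply/funext => x; rewrite big_ord0.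
  by rewrite big_ord0 cint_cst // mul0r; split => //; exact: ccont_cst.
rewrite (_ : (fun x => _) = fun x => (\sum_(k < N) g k x) + g N x); last first.
  by apply/funext => x; rewrite big_ord_recr.
by rewrite big_ord_recr /= cintD // IH1; split => //; exact: ccontD.
Qed.

(** The finite geometric identity $z/(z-w)=\sum_{k<N}(w/z)^k+(w/z)^N z/(z-w)$ under the integral
    gives an explicit remainder, with no exchange of limit and integral. The factors 2 come from
    [cint_bound]. *)
Lemma cauchy_series (f : C -> C) (rho M : R) : 0 < rho ->
  (forall z, normc z <= rho -> derivable (f : CC R -> CC R) z 1) ->
  (forall z, normc z <= rho -> normc (f z) <= M) ->
  exists a : nat -> C, (forall k, normc (a k) * rho ^+ k <= 2 * M) /\
    forall w, normc w < rho -> forall N,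
      normc (f w - \sum_(k < N) a k * w ^+ k) <=
      2 * M * rho / (rho - normc w) * (normc w / rho) ^+ N.
Proof.
move=> rho0 fd fM.
have pi0 : 0 < pi :> R by exact: pi_gt0.
have M0 : 0 <= M by apply: le_trans (normc_ge0 (f 0)) (fM _ _); rewrite normc0 ltW.
pose P : C := Complex (2 * pi) 0.
have nP : normc P = 2 * pi by rewrite normcR ger0_norm // twopi_ge0.
have P0 : P != 0 by rewrite -normc_gt0 nP; lra.
have np t : normc (pol rho t) = rho by rewrite normc_pol // ltW.
have p0 t : pol rho t != 0 by rewrite -normc_gt0 np.
have cf : ccont 0 (2 * pi) (fun t => f (pol rho t)).
  by apply: ccont_circ => // z zr; apply: cdiffP; apply: fd; rewrite zr.
have d1 z : derivable (fun z : CC R => z : CC R) z 1 by exact: derivable_id.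
have ck w : normc w < rho -> ccont 0 (2 * pi) (fun t => (pol rho t - w)^-1).
  move=> wr; apply: (@ccont_circ R (fun z => (z - w)^-1)) => // z zr; apply: cdiffP.
  have d4 : derivable (fun z : CC R => z - w : CC R) z 1.
    exact: (@derivableB C (CC R) (CC R) id (fun=> w) z 1 (d1 z) (derivable_cst _ _ _)).
  apply: (@derivableV C (CC R) _ z 1 _ d4); rewrite subr_eq0.
  by apply/eqP => E; move: wr; rewrite -E zr ltxx.
have ci : ccont 0 (2 * pi) (fun t => (pol rho t)^-1).
  have := ck 0; rewrite normc0 => /(_ rho0).
  by rewrite (_ : (fun t => _) = fun t => (pol rho t)^-1) //; apply/funext => t; rewrite subr0.
have cfk k : ccont 0 (2 * pi) (fun t => f (pol rho t) * (pol rho t)^-1 ^+ k).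
  by apply: ccontM => //; exact: ccontX.
pose a k := P^-1 * circ (fun z => f z * z^-1 ^+ k) rho.
exists a; split=> [k|w wr N].
  rewrite /a normcM normcV nP.
  have : normc (circ (fun z => f z * z^-1 ^+ k) rho) <= 2 * (M * rho^-1 ^+ k) * (2 * pi).
    apply: (le_trans (cint_bound (M := M * rho^-1 ^+ k) twopi_ge0 _ _)) => //; last by rewrite subr0.
    move=> t _; rewrite normcM normcX normcV np; apply: ler_wpM2r.
      by rewrite exprn_ge0 // invr_ge0 ltW.
    by apply: fM; rewrite np.
  move=> H; rewrite -mulrA ler_pdivrMl; last lra.
  have rk : 0 < rho ^+ k by rewrite exprn_gt0.
  rewrite -ler_pdivlMr //; apply: (le_trans H).
  by rewrite exprVn; rewrite le_eqVlt; apply/orP; left; apply/eqP; field; rewrite gt_eqF.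
have rw : 0 < rho - normc w by rewrite subr_gt0.
have nw0 t : pol rho t - w != 0.
  by rewrite subr_eq0; apply/eqP => E; move: wr; rewrite -E np ltxx.
have K := cauchy_formula fd fM wr.
pose rest := circ (fun z => w ^+ N * (f z * z^-1 ^+ N * z * (z - w)^-1)) rho.
have crest : ccont 0 (2 * pi) (fun t => w ^+ N * (f (pol rho t) * (pol rho t)^-1 ^+ N * pol rho t * (pol rho t - w)^-1)).
  apply: ccontZ; apply: ccontM; last exact: ck.
  apply: ccontM; first exact: cfk.
  by apply: (@ccont_circ R id) => // z zr; apply: cdiffP; exact: d1.
have geo t : pol rho t * f (pol rho t) * (pol rho t - w)^-1 =
   \sum_(k < N) w ^+ k * (f (pol rho t) * (pol rho t)^-1 ^+ k) +
   w ^+ N * (f (pol rho t) * (pol rho t)^-1 ^+ N * pol rho t * (pol rho t - w)^-1).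
  set z := pol rho t; have z0 := p0 t; have zw := nw0 t; rewrite -/z in z0 zw.
  elim: (N) => [|n IH]; first by rewrite big_ord0 !expr0; ring.
  rewrite big_ord_recr /= IH -addrA; congr +%R.
  by rewrite !exprSr; field; rewrite z0 zw.
have E : circ (fun z => z * f z * (z - w)^-1) rho = \sum_(k < N) w ^+ k * (P * a k) + rest.
  rewrite /circ (@eq_cint _ _ _ _ _ (fun t _ => geo t)).
  have [S1 S2] := @cint_sum 0 (2 * pi) N (fun k t => w ^+ k * (f (pol rho t) * (pol rho t)^-1 ^+ k)) 
     (fun k => ccontZ _ (cfk k)) twopi_ge0.
  rewrite cintD // S1; congr (_ + _); apply: eq_bigr => k _.
  by rewrite cintZ // /a mulVKf.
have -> : f w - \sum_(k < N) a k * w ^+ k = P^-1 * rest.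
  have -> : rest = P * (f w - \sum_(k < N) a k * w ^+ k).
    move: E; rewrite K mulrBr mulr_sumr => E.
    rewrite [P * f w]mulrC [f w * P]E [X in _ = X - _]addrC -addrA -[LHS]addr0; congr +%R.
    apply/eqP; rewrite eq_sym subr_eq0; apply/eqP; apply: eq_bigr => k _; ring.
  by rewrite mulrA mulVf // mul1r.
rewrite normcM normcV nP ler_pdivrMl; last lra.
pose B := normc w ^+ N * (M * rho^-1 ^+ N * rho * (rho - normc w)^-1).
apply: (@le_trans _ _ (2 * B * (2 * pi - 0))).
  apply: cint_bound => //; first exact: twopi_ge0.
  move=> t _; have q1 := nw0 t; have q2 := np t; move: (pol rho t) q1 q2 => z q1 q2.
  have q3 : normc (f z) <= M by apply: fM; rewrite q2.
  rewrite !normcM !normcX !normcV q2; apply: ler_wpM2l; first by rewrite exprn_ge0 ?normc_ge0.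
  apply: ler_pM.
  - by rewrite !mulr_ge0 ?normc_ge0 ?exprn_ge0 ?invr_ge0 // ltW.
  - by rewrite invr_ge0 normc_ge0.
  - apply: ler_wpM2r; first exact: ltW.
    by apply: ler_wpM2r => //; rewrite exprn_ge0 // invr_ge0 ltW.
  - rewrite lef_pV2 ?posrE // ?normc_gt0 //.
    by have := normcD (z - w) w; rewrite subrK q2; lra.
rewrite /B subr0 expr_div_n exprVn le_eqVlt; apply/orP; left; apply/eqP; field.
by rewrite !gt_eqF ?exprn_gt0.
Qed.

End CauchySeries.

(** * Power series in several variables *)

Section BoxSums.
Context {n : nat}.
Local Notation mi := ('I_n -> nat).

(* Multi-index series are summed along the boxes [0, N)^n. *)
Definition bsum {V : nmodType} (N : nat) (t : mi -> V) : V :=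
  \sum_(p : {ffun 'I_n -> 'I_N}) t (fun j => nat_of_ord (p j)).

Definition inbox (N : nat) (p : mi) : bool := [forall j, (p j < N)%N].

Lemma inboxP (N : nat) (p : mi) : inbox N p -> exists q : {ffun 'I_n -> 'I_N}, p = fun j => nat_of_ord (q j).
Proof.
move=> /forallP pN; exists [ffun j => Ordinal (pN j)].
by apply/funext => j; rewrite ffunE.
Qed.

Lemma inbox_ffun N (q : {ffun 'I_n -> 'I_N}) : inbox N (fun j => nat_of_ord (q j)).
Proof. by apply/forallP => j; exact: ltn_ord. Qed.

Lemma inbox_leq (N M : nat) (p : mi) : (N <= M)%N -> inbox N p -> inbox M p.
Proof. by move=> NM /forallP pN; apply/forallP => j; exact: leq_trans (pN j) NM. Qed.

Lemma ffun_val_inj N (p q : {ffun 'I_n -> 'I_N}) :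
  (fun j => nat_of_ord (p j)) = (fun j => nat_of_ord (q j)) -> p = q.
Proof. by move=> pq; apply/ffunP => j; apply: val_inj; exact: (congr1 (@^~ j) pq). Qed.

Lemma bsum_split (V : nmodType) (N M : nat) (t : mi -> V) : (0 < N)%N -> (N <= M)%N ->
  bsum M t = bsum N t +
    \sum_(p : {ffun 'I_n -> 'I_M} | ~~ inbox N (fun j => nat_of_ord (p j)))
       t (fun j => nat_of_ord (p j)).
Proof.
move=> N0 NM; rewrite /bsum (bigID (fun p : {ffun 'I_n -> 'I_M} => inbox N (fun j => nat_of_ord (p j)))) /=.
congr +%R.
pose h (p : {ffun 'I_n -> 'I_N}) : {ffun 'I_n -> 'I_M} := [ffun j => widen_ord NM (p j)].
(* [Ordinal N0] is the default of [insubd], never reached for indices of the small box; it is the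
   reason for assuming [0 < N]. *)
pose g (p : {ffun 'I_n -> 'I_M}) : {ffun 'I_n -> 'I_N} := [ffun j => insubd (Ordinal N0) (nat_of_ord (p j))].
rewrite (reindex_onto h g) /=; last first.
  move=> p /forallP pN; apply/ffunP => j; rewrite !ffunE; apply: val_inj => /=.
  by rewrite val_insubd pN.
apply: eq_big => p.
  apply/andP; split; first by apply/forallP => j; rewrite ffunE /=.
  by apply/eqP/ffunP => j; rewrite !ffunE; apply: val_inj => /=; rewrite val_insubd ltn_ord.
by move=> _; congr t; apply/funext => j; rewrite ffunE.
Qed.

Lemma bsum_widen (V : nmodType) (N M : nat) (t : mi -> V) : (0 < N)%N -> (N <= M)%N ->
  (forall p, ~~ inbox N p -> t p = 0) -> bsum M t = bsum N t.
Proof. by move=> N0 NM t0; rewrite (bsum_split _ N0 NM) big1 ?addr0 // => p /t0. Qed.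

Lemma bsum_prod (A : comPzSemiRingType) N (u : 'I_n -> nat -> A) :
  bsum N (fun p => \prod_j u j (p j)) = \prod_j \sum_(k < N) u j k.
Proof. by rewrite /bsum bigA_distr_bigA. Qed.

Lemma bsum_single (V : nmodType) N (t : mi -> V) p : inbox N p ->
  (forall q, inbox N q -> q <> p -> t q = 0) -> bsum N t = t p.
Proof.
move=> /inboxP[q ->] t0; rewrite /bsum (bigD1 q) //= big1 ?addr0 // => i iq.
by apply: (t0 _ (inbox_ffun i)) => /ffun_val_inj E; rewrite E eqxx in iq.
Qed.

Lemma eq_bsum (V : nmodType) N (t u : mi -> V) : (forall p, inbox N p -> t p = u p) ->
  bsum N t = bsum N u.
Proof. by move=> tu; apply: eq_bigr => p _; apply: tu; exact: inbox_ffun. Qed.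

Lemma exists_inbox (p : mi) : exists2 N, (0 < N)%N & inbox N p.
Proof.
exists (\max_j p j).+1 => //; apply/forallP => j; rewrite ltnS.
exact: (leq_bigmax (F := p)).
Qed.

Context {R : realType}.
Local Notation C := R[i].

Lemma normc_bsum N (t : mi -> C) : normc (bsum N t) <= bsum N (fun p => normc (t p)).
Proof. exact: normc_sum. Qed.

Lemma le_bsum N (t u : mi -> R) : (forall p, inbox N p -> t p <= u p) -> bsum N t <= bsum N u.
Proof. by move=> tu; apply: ler_sum => p _; apply: tu; exact: inbox_ffun. Qed.

Lemma bsum_mono (N M : nat) (t : mi -> R) : (0 < N)%N -> (N <= M)%N -> (forall p, 0 <= t p) ->
  bsum N t <= bsum M t.
Proof. by move=> N0 NM t0; rewrite (bsum_split _ N0 NM) lerDl sumr_ge0. Qed.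

Lemma bsum_tail (N M : nat) (t : mi -> C) (u : mi -> R) : (0 < N)%N -> (N <= M)%N ->
  (forall p, normc (t p) <= u p) -> normc (bsum M t - bsum N t) <= bsum M u - bsum N u.
Proof.
move=> N0 NM tu; rewrite !(bsum_split _ N0 NM) ![bsum N _ + _]addrC !addrK.
by apply: (le_trans (normc_sum _ _ _)); apply: ler_sum.
Qed.

Lemma bsumD (V : nmodType) N (t u : mi -> V) : bsum N (fun p => t p + u p) = bsum N t + bsum N u.
Proof. exact: big_split. Qed.

Lemma bsumZ N c (t : mi -> C) : bsum N (fun p => c * t p) = c * bsum N t.
Proof. by rewrite /bsum mulr_sumr. Qed.

Lemma bsumZR N c (t : mi -> R) : bsum N (fun p => c * t p) = c * bsum N t.
Proof. by rewrite /bsum mulr_sumr. Qed.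

Lemma bsumB (V : zmodType) N (t u : mi -> V) : bsum N (fun p => t p - u p) = bsum N t - bsum N u.
Proof. exact: sumrB. Qed.

(** Convergence along boxes only; absolute convergence is carried separately, by uniform bounds on
    the box sums of moduli. *)
Definition blim (t : mi -> C) (l : C) := forall e : R, 0 < e ->
  exists N0, forall N, (N0 <= N)%N -> normc (bsum N t - l) < e.

Lemma blim_unique t l l' : blim t l -> blim t l' -> l = l'.
Proof.
move=> tl tl'; apply/eqP; rewrite -subr_eq0 -normc_eq0 eq_le normc_ge0 andbT.
apply/ler_addgt0Pl => e e0; rewrite addr0.
have e2 : 0 < e / 2 by rewrite divr_gt0.
have [N1 P1] := tl _ e2; have [N2 P2] := tl' _ e2.
have := P1 _ (leq_maxl N1 N2); have := P2 _ (leq_maxr N1 N2).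
set S := bsum _ t => A B; have -> : l - l' = (S - l') - (S - l) by ring.
apply: (le_trans (normcB _ _)); rewrite (splitr e); apply: lerD; exact: ltW.
Qed.

Lemma blimD t u l m : blim t l -> blim u m -> blim (fun p => t p + u p) (l + m).
Proof.
move=> tl tl' e e0; have e2 : 0 < e / 2 by rewrite divr_gt0.
have [N1 P1] := tl _ e2; have [N2 P2] := tl' _ e2.
exists (maxn N1 N2) => N; rewrite geq_max => /andP[n1 n2].
rewrite bsumD (_ : _ - _ = (bsum N t - l) + (bsum N u - m)); last by ring.
apply: (le_lt_trans (normcD _ _)); rewrite (splitr e); apply: ltrD; [exact: P1|exact: P2].
Qed.

Lemma blimZ c t l : blim t l -> blim (fun p => c * t p) (c * l).
Proof.
move=> tl e e0; have nc := normc_ge0 c.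
have [|N1 P1] := tl (e / (1 + normc c)); first by rewrite divr_gt0 //; lra.
exists N1 => N /P1; rewrite bsumZ -mulrBr normcM ltr_pdivlMr; last lra.
have := normc_ge0 (bsum N t - l); nra.
Qed.

Lemma blim_single t p : (forall q, q <> p -> t q = 0) -> blim t (t p).
Proof.
move=> t0 e e0; have [N0 N00 pN] := exists_inbox p; exists N0 => N NN.
by rewrite (bsum_single (inbox_leq NN pN)) ?subrr ?normc0 // => q _; exact: t0.
Qed.

Lemma eq_blim t u l : t =1 u -> blim t l -> blim u l.
Proof. by move=> tu; have -> : u = t by apply/funext => p; rewrite tu. Qed.

End BoxSums.

(** * Roots of unity and interpolation in one variable *)

Section RootsOfUnity.
Context {R : realType}.
Local Notation C := R[i].

Definition rou (N : nat) : C := cis (2 * pi / N%:R).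

Lemma cisX (t : R) k : cis t ^+ k = cis (k%:R * t).
Proof.
elim: k => [|k IH]; first by rewrite expr0 mul0r /cis cos0 sin0.
by rewrite exprS IH -cisD -natr1; congr cis; ring.
Qed.

Lemma normc_rou N : normc (rou N) = 1.
Proof. exact: normc_cis. Qed.

Lemma rou_neq0 N : rou N != 0.
Proof. by rewrite -normc_gt0 normc_rou. Qed.

Lemma rou_order N : (0 < N)%N -> rou N ^+ N = 1.
Proof.
move=> N0; rewrite cisX mulrC divfK; last by rewrite pnatr_eq0 -lt0n.
by rewrite /cis mulr_natl cos2pi sin2pi.
Qed.

(** The half angle $\pi d/N$ lies in $(0,\pi)$, where the sine is positive, while $\cos x=1$ would
    force $\sin(x/2)=0$. *)
Lemma rou_neq1 N d : (0 < d)%N -> (d < N)%N -> rou N ^+ d != 1.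
Proof.
move=> d0 dN; rewrite cisX; set x := _ * _.
have NR : 0 < N%:R :> R by rewrite ltr0n (leq_trans _ dN).
have pi0 : 0 < pi :> R by exact: pi_gt0.
have xE : x / 2 = pi * (d%:R / N%:R) by rewrite /x; field; rewrite gt_eqF.
have dR : 0 < d%:R / N%:R :> R by apply: divr_gt0 => //; rewrite ltr0n.
have dR1 : d%:R / N%:R < 1 :> R by rewrite ltr_pdivrMr // mul1r ltr_nat.
have s0 : 0 < sin (x / 2).
  by apply: sin_gt0_pi; rewrite xE; apply/andP; split; nra.
apply/eqP => /(congr1 (@complex.Re R)) /=.
have -> : x = x / 2 + x / 2 by field.
rewrite cosD -!expr2 => E.
have := cos2Dsin2 (x / 2); have := exprn_gt0 2 s0; move: E => /=; lra.
Qed.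

(** Orthogonality of the characters of $\mathbb Z/N$; [l < N] and [k < N] exclude aliasing. *)
Lemma rou_sum N l k : (l < N)%N -> (k < N)%N ->
  \sum_(s < N) (rou N ^+ l / rou N ^+ k) ^+ s = if l == k then N%:R else 0.
Proof.
move=> lN kN; have N0 : (0 < N)%N by apply: leq_trans lN.
have [->|lk] := eqVneq l k.
  under eq_bigr => s _ do rewrite divff ?expf_neq0 ?rou_neq0 // expr1n.
  by rewrite sumr_const card_ord.
set x := _ / _.
have xN : x ^+ N = 1.
  by rewrite /x expr_div_n -!exprM ![(_ * N)%N]mulnC !exprM rou_order // !expr1n divr1.
have x1 : x != 1.
  apply/eqP => xE; have : rou N ^+ l = rou N ^+ k.
    by rewrite -[LHS](divfK (expf_neq0 k (rou_neq0 N))) -/x xE mul1r.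
  move: lk; rewrite neq_ltn => /orP[h|h] E.
    have := @rou_neq1 N (k - l); rewrite subn_gt0 h => /(_ isT (leq_ltn_trans (leq_subr _ _) kN)).
    rewrite -(inj_eq (mulIf (expf_neq0 l (rou_neq0 N)))) -exprD subnK ?(ltnW h) //.
    by rewrite mul1r E eqxx.
  have := @rou_neq1 N (l - k); rewrite subn_gt0 h => /(_ isT (leq_ltn_trans (leq_subr _ _) lN)).
  rewrite -(inj_eq (mulIf (expf_neq0 k (rou_neq0 N)))) -exprD subnK ?(ltnW h) //.
  by rewrite mul1r E eqxx.
have := subrX1 x N; rewrite xN subrr => /esym/eqP.
by rewrite mulf_eq0 subr_eq0 (negPf x1) /= => /eqP.
Qed.

End RootsOfUnity.

Section Interpolation.
Context {R : realType}.
Local Notation C := R[i].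

(* The polynomial of degree < N interpolating [h] at [r] times the N-th roots of unity. *)
Definition Ein (r : R) (N : nat) (h : C -> C) (w : C) : C :=
  \sum_(k < N) (w / Complex r 0) ^+ k *
     (N%:R^-1 * \sum_(s < N) (rou N ^+ k)^-1 ^+ s * h (Complex r 0 * rou N ^+ s)).

Lemma normc_node (r : R) N s : 0 <= r -> normc (Complex r 0 * rou N ^+ s : C) = r.
Proof. by move=> r0; rewrite normcM normcR normcX normc_rou expr1n mulr1 ger0_norm. Qed.

(** Each of the [N] coefficients is an average of values of [h]. The crude factor [N] is affordable
    against geometrically small errors. *)
Lemma Ein_bound (r : R) N h w B : 0 < r -> normc w <= r -> (0 < N)%N ->
  (forall z, normc z <= r -> normc (h z) <= B) -> normc (Ein r N h w) <= N%:R * B.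
Proof.
move=> r0 wr N0 hB; apply: (le_trans (normc_sum _ _ _)).
have B0 : 0 <= B by apply: le_trans (normc_ge0 (h 0)) (hB _ _); rewrite normc0 ltW.
have NR : 0 < N%:R :> R by rewrite ltr0n.
rewrite mulr_natl -[X in _ <= _ *+ X]card_ord -sumr_const; apply: ler_sum => k _.
rewrite normcM normcX -[B]mul1r; apply: ler_pM.
- by rewrite exprn_ge0 // normc_ge0.
- exact: normc_ge0.
- by rewrite exprn_ile1 ?normc_ge0 // normcM normcV normcR gtr0_norm // ler_pdivrMr // mul1r.
rewrite normcM normcV normcR_nat ler_pdivrMl // mulr_natl.
apply: (le_trans (normc_sum _ _ _)).
rewrite -[X in _ <= _ *+ X]card_ord -sumr_const; apply: ler_sum => s _.
rewrite normcM normcX normcV normcX normc_rou expr1n invr1 expr1n mul1r.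
by apply: hB; rewrite normc_node // ltW.
Qed.

Lemma EinD (r : R) N g h w : Ein r N (fun z => g z + h z) w = Ein r N g w + Ein r N h w.
Proof.
rewrite /Ein -big_split /=; apply: eq_bigr => k _; rewrite -mulrDr -mulrDr; congr (_ * (_ * _)).
by rewrite -big_split /=; apply: eq_bigr => s _; rewrite mulrDr.
Qed.

Lemma EinB (r : R) N g h w : Ein r N (fun z => g z - h z) w = Ein r N g w - Ein r N h w.
Proof.
apply/eqP; rewrite eq_sym subr_eq -EinD; apply/eqP; congr Ein.
by apply/funext => z; rewrite subrK.
Qed.

Lemma Ein_poly (r : R) N (a : nat -> C) w : 0 < r -> (0 < N)%N ->
  Ein r N (fun z => \sum_(l < N) a l * z ^+ l) w = \sum_(l < N) a l * w ^+ l.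
Proof.
move=> r0 N0; apply: eq_bigr => k _.
have NC : N%:R != 0 :> C by rewrite pnatr_eq0 -lt0n.
have rC : Complex r 0 != 0 :> C by rewrite -normc_gt0 normcR gtr0_norm.
have -> : \sum_(s < N) (rou N ^+ k)^-1 ^+ s * \sum_(l < N) a l * (Complex r 0 * rou N ^+ s) ^+ l =
    \sum_(l < N) (a l * Complex r 0 ^+ l) * \sum_(s < N) (rou N ^+ l / rou N ^+ k) ^+ s.
  under eq_bigr => s _ do rewrite mulr_sumr.
  rewrite exchange_big /=; apply: eq_bigr => l _; rewrite mulr_sumr; apply: eq_bigr => s _.
  by rewrite exprMn [(_ / _) ^+ s]exprMn -!exprM [(s * l)%N]mulnC; ring.
rewrite (bigD1 k) //= [X in _ + X]big1 => [|l lk]; last first.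
  by rewrite rou_sum // val_eqE (negPf lk) mulr0.
rewrite rou_sum // eqxx addr0 expr_div_n.
by field; rewrite expf_neq0 // NC.
Qed.

(** Interpolation reproduces the Taylor polynomial of degree below [N] exactly, so the error is the
    Taylor remainder minus its own interpolant, hence the factor [N + 1]. *)
Lemma interp1 (h : C -> C) (rho r M : R) N w : 0 < r -> r < rho ->
  (forall z, normc z <= rho -> derivable (h : CC R -> CC R) z 1) ->
  (forall z, normc z <= rho -> normc (h z) <= M) -> (0 < N)%N -> normc w <= r ->
  normc (h w - Ein r N h w) <= (N%:R + 1) * (2 * M * rho / (rho - r) * (r / rho) ^+ N).
Proof.
move=> r0 rr hd hM N0 wr; have rho0 : 0 < rho by exact: lt_trans rr.
have M0 : 0 <= M by apply: le_trans (normc_ge0 (h 0)) (hM _ _); rewrite normc0 ltW.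
have [a [_ aP]] := cauchy_series rho0 hd hM.
pose P z := \sum_(l < N) a l * z ^+ l.
set D := 2 * M * rho / (rho - r) * (r / rho) ^+ N.
have rem z : normc z <= r -> normc (h z - P z) <= D.
  move=> zr; apply: (le_trans (aP z (le_lt_trans zr rr) N)).
  apply: ler_pM.
  - by rewrite !mulr_ge0 ?invr_ge0 ?subr_ge0 // ltW // (le_lt_trans zr).
  - by rewrite exprn_ge0 // divr_ge0 ?normc_ge0 // ltW.
  - apply: ler_wpM2l; first by rewrite !mulr_ge0 // ltW.
    rewrite lef_pV2 ?posrE ?subr_gt0 //; last exact: le_lt_trans rr.
    by rewrite lerD2l lerN2.
  - rewrite lerXn2r ?nnegrE ?divr_ge0 ?normc_ge0 //; try exact: ltW.
    by apply: ler_wpM2r => //; rewrite invr_ge0 ltW.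
have -> : h w - Ein r N h w = (h w - P w) - Ein r N (fun z => h z - P z) w.
  by rewrite EinB Ein_poly // -/(P w); ring. 
apply: (le_trans (normcB _ _)); rewrite mulrDl mul1r addrC; apply: lerD; last exact: rem.
exact: Ein_bound.
Qed.

End Interpolation.

(** Induction on [d] with [s] halfway between [q] and 1: one power of $N$ is absorbed by $(q/s)^N$,
    because $Nt^N\le\sum_{i<N}t^i\le1/(1-t)$. *)
Lemma poly_geom_bounded {R : realType} (d : nat) (q : R) : 0 <= q < 1 ->
  exists2 B, 0 <= B & forall N : nat, N%:R ^+ d * q ^+ N <= B.
Proof.
elim: d q => [|d IH] q /andP[q0 q1].
  by exists 1 => // N; rewrite expr0 mul1r exprn_ile1 // ltW.
pose s := (1 + q) / 2.
have s0 : 0 < s by rewrite /s; lra.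
have s1 : s < 1 by rewrite /s; lra.
have qs : q < s by rewrite /s; lra.
clearbody s.
have [|B B0 BP] := IH s; first by rewrite s1 ltW.
have t0 : 0 <= q / s by rewrite divr_ge0 // ltW.
have t1 : q / s < 1 by rewrite ltr_pdivrMr // mul1r.
exists (B * (1 - q / s)^-1); first by rewrite mulr_ge0 // invr_ge0 subr_ge0 ltW.
move=> N.
have -> : N%:R ^+ d.+1 * q ^+ N = (N%:R ^+ d * s ^+ N) * (N%:R * (q / s) ^+ N).
  have : s ^+ N != 0 by rewrite gt_eqF // exprn_gt0.
  rewrite exprS expr_div_n; move: (s ^+ N) (q ^+ N) (N%:R) (N%:R ^+ d) => u v x y u0.
  by field.
apply: ler_pM => //; try by rewrite mulr_ge0 ?exprn_ge0 // ltW.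
rewrite -[leRHS]mul1r ler_pdivlMr ?subr_gt0 //.
have geo : 1 - (q / s) ^+ N = (1 - q / s) * \sum_(i < N) (q / s) ^+ i.
  by rewrite -opprB subrX1 -mulNr opprB.
apply: (@le_trans _ _ (1 - (q / s) ^+ N)); last by rewrite gerBl exprn_ge0.
rewrite geo mulrC; apply: ler_wpM2l; first by rewrite subr_ge0 ltW.
rewrite mulr_natl -[X in _ *+ X <= _]card_ord -sumr_const; apply: ler_sum => i _.
by apply: ler_wiXn2l => //; [rewrite ltW | rewrite ltnW].
Qed.

(** Boundedness with exponent [d + 1] gives decay like $1/N$ with exponent [d]. *)
Lemma poly_geom_small {R : realType} (d : nat) (q c e : R) : 0 <= q < 1 -> 0 <= c -> 0 < e ->
  exists N0, forall N : nat, (N0 <= N)%N -> c * (N%:R ^+ d * q ^+ N) < e.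
Proof.
move=> q01 c0 e0; have [B B0 BP] := @poly_geom_bounded R d.+1 q q01.
have [q0 q1] := andP q01.
exists (Num.bound ((c * B) / e)).+1 => N NN.
have N0 : 0 < N%:R :> R by rewrite ltr0n (leq_trans _ NN).
rewrite -(ltr_pM2r N0) -mulrA.
have -> : N%:R ^+ d * q ^+ N * N%:R = N%:R ^+ d.+1 * q ^+ N by rewrite exprS; ring.
apply: (@le_lt_trans _ _ (c * B)); first exact: ler_wpM2l.
rewrite [ltRHS]mulrC -ltr_pdivrMr //.
have cB : 0 <= c * B / e by rewrite !mulr_ge0 // invr_ge0 ltW.
apply: (lt_trans (archi_boundP cB)); by rewrite ltr_nat.
Qed.

(** * Polynomial approximation on polydiscs *)

Section Update.
Context {R : realType} {n : nat}.
Local Notation C := R[i].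
Implicit Types w : Cn R n.

Definition upd (w : Cn R n) (j : 'I_n) (u : C) : Cn R n := \row_i (if i == j then u else w 0 i).

Lemma updE w j u i : upd w j u 0 i = if i == j then u else w 0 i.
Proof. by rewrite mxE. Qed.

Lemma upd_id w j : upd w j (w 0 j) = w.
Proof. by apply/rowP => i; rewrite updE; case: eqP => [->|]. Qed.

Lemma upd_upd w j u v : upd (upd w j u) j v = upd w j v.
Proof. by apply/rowP => i; rewrite !updE; case: eqP. Qed.

Definition PD (r : 'I_n -> R) (w : Cn R n) := forall j, normc (w 0 j) <= r j.

Lemma PD_upd r w j u : PD r w -> normc u <= r j -> PD r (upd w j u).
Proof. by move=> wr ur i; rewrite updE; case: eqP => [->|]. Qed.

Lemma PD_le r r' w : (forall j, r j <= r' j) -> PD r w -> PD r' w.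
Proof. by move=> rr wr j; exact: le_trans (wr j) (rr j). Qed.

Lemma monoE (p : 'I_n -> nat) w : mono p w = \prod_j (w 0 j) ^+ p j.
Proof. by []. Qed.

Definition rpow (r : 'I_n -> R) (p : 'I_n -> nat) : R := \prod_j r j ^+ p j.

Lemma rpow_gt0 r p : (forall j, 0 < r j) -> 0 < rpow r p.
Proof. by move=> r0; apply: prodr_gt0 => j _; rewrite exprn_gt0. Qed.

Lemma rpow_ge0 r p : (forall j, 0 <= r j) -> 0 <= rpow r p.
Proof. by move=> r0; apply: prodr_ge0 => j _; rewrite exprn_ge0. Qed.

Lemma normc_mono p w : normc (mono p w) = rpow (fun j => normc (w 0 j)) p.
Proof. by rewrite normc_prod; apply: eq_bigr => j _; rewrite normcX. Qed.

End Update.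

Section PolyApprox.
Context {R : realType} {n : nat}.
Local Notation C := R[i].
Variables (f : Cn R n -> C) (rho r : 'I_n -> R) (M : R).
Hypotheses (r0 : forall j, 0 < r j) (rr : forall j, r j < rho j).
Hypothesis fd : forall w, PD rho w -> forall j,
  derivable (fun u : CC R => f (upd w j u) : CC R) (w 0 j : CC R) 1.
Hypothesis fM : forall w, PD rho w -> normc (f w) <= M.

Let rho0 j : 0 < rho j. Proof. exact: lt_trans (r0 j) (rr j). Qed.

Let M0 : 0 <= M.
Proof.
apply: le_trans (normc_ge0 (f 0)) (fM _) => j.
by rewrite mxE normc0 ltW.
Qed.

Definition Eop (j : 'I_n) (N : nat) (g : Cn R n -> C) (w : Cn R n) : C :=
  Ein (r j) N (fun u => g (upd w j u)) (w 0 j).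

(** The sum over the coordinates of the one-variable bounds of [interp1], so that one quantity
    serves every coordinate. *)
Definition errE (N : nat) : R :=
  \sum_j (N%:R + 1) * (2 * M * rho j / (rho j - r j) * (r j / rho j) ^+ N).

Lemma errE_term_ge0 N j : 0 <= (N%:R + 1) * (2 * M * rho j / (rho j - r j) * (r j / rho j) ^+ N).
Proof.
have := r0 j; have := rr j; have := rho0 j => h1 h2 h3.
rewrite !mulr_ge0 ?exprn_ge0 ?divr_ge0 ?invr_ge0 ?subr_ge0 ?addr_ge0 //; exact: ltW.
Qed.

Lemma errE_ge0 N : 0 <= errE N.
Proof. by apply: sumr_ge0 => j _; exact: errE_term_ge0. Qed.

Lemma Eop_err j N w : (0 < N)%N -> PD r w -> normc (f w - Eop j N f w) <= errE N.
Proof.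
move=> N0 wr; have wrho : PD rho w by apply: PD_le wr => i; exact: ltW.
apply: (@le_trans _ _ ((N%:R + 1) * (2 * M * rho j / (rho j - r j) * (r j / rho j) ^+ N))).
  rewrite -[in f w](upd_id w j).
  apply: (@interp1 R (fun u => f (upd w j u))) => // z zr.
    have := fd (PD_upd wrho zr) (j := j); rewrite updE eqxx.
    by rewrite (_ : (fun u => f (upd (upd w j z) j u)) = fun u => f (upd w j u)) //; 
      apply/funext => u; rewrite upd_upd.
  by apply: fM; exact: PD_upd.
by rewrite /errE (bigD1 j) //= lerDl; apply: sumr_ge0 => i _; exact: errE_term_ge0.
Qed.

Lemma Eop_bound j N g w B : (0 < N)%N -> (forall w, PD r w -> normc (g w) <= B) -> PD r w ->
  normc (Eop j N g w) <= N%:R * B.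
Proof. by move=> N0 gB wr; apply: Ein_bound => // z zr; apply: gB; exact: PD_upd. Qed.

Definition Aop (N : nat) (s : seq 'I_n) : Cn R n -> C := foldr (fun j g => Eop j N g) f s.

(** Telescoping: $f-E_jA_sf=(f-E_jf)+E_j(f-A_sf)$, and each $E_j$ multiplies the previous error by
    at most [N]. *)
Lemma Aop_err N s w : (0 < N)%N -> PD r w ->
  normc (f w - Aop N s w) <= (size s)%:R * N%:R ^+ size s * errE N.
Proof.
move=> N0; elim: s w => [|j s IH] w wr /=; first by rewrite subrr normc0 !mul0r.
have -> : f w - Eop j N (Aop N s) w = (f w - Eop j N f w) + Eop j N (fun z => f z - Aop N s z) w.
  by rewrite /Eop EinB; ring.
apply: (le_trans (normcD _ _)).
have h1 := Eop_err j N0 wr; have h2 := Eop_bound j N0 IH wr.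
have N1 : 1 <= N%:R ^+ (size s).+1 :> R by rewrite exprn_ege1 // ler1n.
have e0 := errE_ge0 N.
apply: (le_trans (lerD h1 h2)).
have -> : N%:R * ((size s)%:R * N%:R ^+ size s * errE N) = (size s)%:R * N%:R ^+ (size s).+1 * errE N.
  by rewrite exprS; ring.
have : errE N <= N%:R ^+ (size s).+1 * errE N by rewrite -[leLHS]mul1r; apply: ler_wpM2r.
by rewrite -[in X in _ -> _ <= X]natr1 -[X in _ -> _ <= X]mulrA mulrDl mul1r mulrA addrC; move=> ?; rewrite lerD2l.
Qed.

Definition indep (s : seq 'I_n) (c : Cn R n -> C) := forall w j u, j \in s -> c (upd w j u) = c w.

(** A polynomial in the variables of [s] whose coefficients may depend on the other variables. Terms
    are indexed by an arbitrary finite type and left uncollected, so a further interpolation merely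
    enlarges the index by an exponent and a node. *)
Definition polyin (N : nat) (s : seq 'I_n) (g : Cn R n -> C) := exists (T : finType)
   (c : T -> Cn R n -> C) (k : T -> {ffun 'I_n -> 'I_N}), (forall t, indep s (c t)) /\
   forall w, g w = \sum_t c t w * \prod_(j <- s) (w 0 j) ^+ (k t j).

Lemma Aop_poly N s : (0 < N)%N -> uniq s -> polyin N s (Aop N s).
Proof.
move=> N0; elim: s => [_|j s IH /= /andP[js us]].
  exists unit, (fun=> f), (fun=> [ffun=> Ordinal N0]); split; first by [].
  by move=> w; rewrite (big_pred1 tt) ?big_nil ?mulr1 // => -[].
have [T [c [k [ci gE]]]] := IH us.
pose c' (t : T * 'I_N * 'I_N) (w : Cn R n) := (Complex (r j) 0)^-1 ^+ t.1.2 * 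
   (N%:R^-1 * ((rou N ^+ t.1.2)^-1 ^+ t.2 * c t.1.1 (upd w j (Complex (r j) 0 * rou N ^+ t.2)))).
pose k' (t : T * 'I_N * 'I_N) := [ffun i => if i == j then t.1.2 else k t.1.1 i].
exists _, c', k'; split.
  move=> t w i u; rewrite inE => /orP[/eqP->|is_]; rewrite /c'.
    by rewrite upd_upd.
  have ij : i != j by apply: contraNneq js => <-.
  congr (_ * (_ * (_ * _))).
  have -> : upd (upd w i u) j (Complex (r j) 0 * rou N ^+ t.2) = upd (upd w j (Complex (r j) 0 * rou N ^+ t.2)) i u.
    apply/rowP => l; rewrite !updE; case: (eqVneq l j) => [->|//].
    by rewrite eq_sym (negPf ij).
  exact: ci.
move=> w; set G := (X in _ = \sum_t X t).
have -> : \sum_x G x = \sum_t \sum_l \sum_(s' < N) G (t, l, s').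
  rewrite (pair_bigA _ (fun t l => \sum_(s' < N) G (t, l, s'))) /=.
  rewrite (pair_bigA _ (fun tl s' => G (tl.1, tl.2, s'))) /=.
  by apply: eq_bigr => -[[a b] d].
rewrite /Eop /Ein exchange_big /=; apply: eq_bigr => l _.
under eq_bigr => s' _ do rewrite gE mulr_sumr.
rewrite exchange_big /= mulr_sumr mulr_sumr; apply: eq_bigr => t _.
rewrite mulr_sumr mulr_sumr; apply: eq_bigr => s' _.
rewrite /G /c' /= big_cons /k' ffunE eqxx expr_div_n exprVn.
have -> : \prod_(j0 <- s) upd w j (Complex (r j) 0 * rou N ^+ s') 0 j0 ^+ k t j0 =
    \prod_(i <- s) w 0 i ^+ [ffun i => if i == j then l else k t i] i.
  apply: eq_big_seq => i is_; have ij : i != j by apply: contraNneq js => <-.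
  by rewrite ffunE updE (negPf ij).
by rewrite !exprVn /=; ring.
Qed.

(** Any point is reached from the origin by updating one coordinate at a time. *)
Lemma indep_const c : indep (enum 'I_n) c -> forall w, c w = c 0.
Proof.
move=> ci w; have -> : w = foldr (fun j v => upd v j (w 0 j)) 0 (enum 'I_n).
  apply/rowP => i; have : i \in enum 'I_n by rewrite mem_enum.
  elim: (enum 'I_n) => [//|j s IH]; rewrite inE /= updE; case: (eqVneq i j) => [->//|_] /=.
  exact: IH.
have : {subset enum 'I_n <= enum 'I_n} by [].
elim: {1 3}(enum 'I_n) => [//|j s IH] sub /=.
rewrite ci; last by apply: sub; rewrite inE eqxx.
by apply: IH => i is_; apply: sub; rewrite inE is_ orbT.
Qed.

(** Once all variables are interpolated the coefficients are constants, and terms with the same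
    exponent can be collected. *)
Lemma poly_approx N : (0 < N)%N -> exists c : ('I_n -> nat) -> C,
  (forall p, ~~ inbox N p -> c p = 0) /\
  forall w, PD r w -> normc (f w - bsum N (fun p => c p * mono p w)) <= n%:R * N%:R ^+ n * errE N.
Proof.
move=> N0; have [T [c [k [ci gE]]]] := Aop_poly N0 (enum_uniq 'I_n).
exists (fun p => \sum_(t | [forall j, nat_of_ord (k t j) == p j]) c t 0); split.
  move=> p pN; rewrite big_pred0 // => t; apply/negP => /forallP kt; move: pN => /negP; apply.
  by apply/forallP => j; rewrite -(eqP (kt j)).
move=> w wr; have := Aop_err (enum 'I_n) N0 wr; rewrite size_enum_ord gE.
suff -> : \sum_t c t w * \prod_(j <- enum 'I_n) w 0 j ^+ k t j =
  bsum N (fun p => (\sum_(t | [forall j, nat_of_ord (k t j) == p j]) c t 0) * mono p w) by [].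
rewrite (partition_big k xpredT) //=; apply: eq_bigr => q _.
rewrite mulr_suml; apply: eq_big => t.
  apply/eqP/forallP => [-> j //|kt]; apply/ffunP => j; apply: val_inj; exact: (eqP (kt j)).
move=> /eqP <-; rewrite (indep_const (ci t)); congr (_ * _).
by rewrite monoE big_enum.
Qed.

End PolyApprox.

(** * Existence of the power series expansion *)

Section PowerSeries.
Context {R : realType} {n : nat}.
Local Notation C := R[i].
Local Notation mi := ('I_n -> nat).

(** Discrete Fourier inversion on the torus: for degrees below [N] in each variable, [N ^ n] sample
    points recover a coefficient exactly. *)
Lemma rou_box_average (N : nat) (r : 'I_n -> C) (c : mi -> C) (p : mi) : (0 < N)%N -> inbox N p ->
  bsum N (fun k : mi => (\prod_j (rou N ^+ p j)^-1 ^+ k j) *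
     bsum N (fun q => c q * \prod_j (r j * rou N ^+ k j) ^+ q j)) =
  N%:R ^+ n * (c p * \prod_j r j ^+ p j).
Proof.
move=> N0 pN.
have -> : bsum N (fun k : mi => (\prod_j (rou N ^+ p j)^-1 ^+ k j) *
     bsum N (fun q => c q * \prod_j (r j * rou N ^+ k j) ^+ q j)) =
   bsum N (fun q => c q * \prod_j (r j ^+ q j * \sum_(s < N) (rou N ^+ q j / rou N ^+ p j) ^+ s)).
  rewrite /bsum; under eq_bigr => k _ do rewrite mulr_sumr.
  rewrite exchange_big /=; apply: eq_bigr => q _.
  under [in RHS]eq_bigr => j _ do rewrite mulr_sumr.
  rewrite bigA_distr_bigA /= mulr_sumr; apply: eq_bigr => k _.
  rewrite mulrCA -big_split /=; congr (_ * _); apply: eq_bigr => j _.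
  by rewrite !exprMn -!exprM [(q j * _)%N]mulnC; ring.
rewrite (bsum_single pN).
  under eq_bigr => j _ do rewrite rou_sum ?(forallP pN) // eqxx.
  by rewrite big_split /= prodr_const card_ord; ring.
move=> q /forallP qN qp.
have /existsP[j qpj] : [exists j, q j != p j].
  apply: contra_notT qp; rewrite negb_exists => /forallP qp; apply/funext => j.
  by apply/eqP; move: (qp j); rewrite negbK.
rewrite (bigD1 j) //= rou_sum ?(forallP pN) // (negPf qpj).
by rewrite mulr0 mul0r mulr0.
Qed.

(** A discrete Cauchy estimate, the average over sample points replacing the torus integral. *)
Lemma coef_bound (N : nat) (r : 'I_n -> R) (c : mi -> C) (B : R) p : (0 < N)%N ->
  (forall j, 0 < r j) ->
  (forall w : Cn R n, PD r w -> normc (bsum N (fun q => c q * mono q w)) <= B) -> inbox N p ->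
  normc (c p) * rpow r p <= B.
Proof.
move=> N0 r0 cB pN.
have NR : 0 < N%:R ^+ n :> R by rewrite exprn_gt0 // ltr0n.
have := rou_box_average (fun j => Complex (r j) 0) c N0 pN => /(congr1 (@normc R)).
rewrite normcM normcX normcR_nat normcM normc_prod.
have -> : \prod_j normc (Complex (r j) 0 ^+ p j) = rpow r p.
  by apply: eq_bigr => j _; rewrite normcX normcR gtr0_norm.
move=> E; rewrite -(ler_pM2l NR) -E.
apply: (le_trans (normc_bsum _ _)).
have -> : N%:R ^+ n * B = @bsum n R N (fun=> B).
  by rewrite -natrX mulr_natl /bsum sumr_const card_ffun !card_ord.
apply: le_bsum => k kN; rewrite normcM normc_prod big1 ?mul1r; last first.
  by move=> j _; rewrite normcX normcV normcX normc_rou expr1n invr1 expr1n.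
have := cB (\row_j (Complex (r j) 0 * rou N ^+ k j)).
rewrite (_ : (fun q => c q * mono q _) = fun q => c q * \prod_j (Complex (r j) 0 * rou N ^+ k j) ^+ q j).
  by apply=> j; rewrite mxE normc_node // ltW.
by apply/funext => q; rewrite monoE; congr (_ * _); apply: eq_bigr => j _; rewrite mxE.
Qed.

Lemma Rcomplete (u : nat -> R) :
  (forall e : R, 0 < e -> exists N0, forall N M, (N0 <= N)%N -> (N0 <= M)%N -> `|u N - u M| <= e) ->
  exists l, forall e : R, 0 < e -> exists N0, forall N, (N0 <= N)%N -> `|u N - l| <= e.
Proof.
move=> uC; have /cvg_ex[/= l ul] : cvg (u @ \oo).
  apply/cauchy_cvgP; apply: cauchy_exP => e e0; have e2 : 0 < e / 2 by rewrite divr_gt0.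
  have [N0 NP] := uC _ e2; exists (u N0).
  exists N0 => // N /= NN; rewrite /ball /=; apply: (le_lt_trans (NP _ _ (leqnn _) NN)).
  by rewrite ltr_pdivrMr // mulr_natr mulr2n ltrDl.
exists l => e e0; move/cvgrPdist_le : ul => /(_ e e0)[N0 _ NP].
by exists N0 => N /NP /=; rewrite distrC.
Qed.

Lemma Ccomplete (u : nat -> C) :
  (forall e : R, 0 < e -> exists N0, forall N M, (N0 <= N)%N -> (N0 <= M)%N -> normc (u N - u M) <= e) ->
  exists l, forall e : R, 0 < e -> exists N0, forall N, (N0 <= N)%N -> normc (u N - l) <= e.
Proof.
move=> uC.
have [|a aP] := @Rcomplete (fun N => complex.Re (u N)).
  move=> e /uC[N0 NP]; exists N0 => N M h1 h2.
  by rewrite -cReN -cReD; apply: (le_trans (normc_Re _)); exact: NP.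
have [|b bP] := @Rcomplete (fun N => complex.Im (u N)).
  move=> e /uC[N0 NP]; exists N0 => N M h1 h2.
  by rewrite -cImN -cImD; apply: (le_trans (normc_Im _)); exact: NP.
exists (Complex a b) => e e0; have e2 : 0 < e / 2 by rewrite divr_gt0.
have [N1 P1] := aP _ e2; have [N2 P2] := bP _ e2.
exists (maxn N1 N2) => N; rewrite geq_max => /andP[h1 h2].
apply: (le_trans (normc_ReIm _)); rewrite cReD cImD cReN cImN /= (splitr e).
by apply: lerD; [exact: P1|exact: P2].
Qed.

Lemma geometric_box_bound (N : nat) (x r : 'I_n -> R) : (forall j, 0 <= x j) -> (forall j, x j < r j) ->
  bsum N (fun p => rpow x p / rpow r p) <= \prod_j (1 - x j / r j)^-1.
Proof.
move=> x0 xr; have r0 j : 0 < r j by apply: le_lt_trans (xr j).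
have -> : (fun p => rpow x p / rpow r p) = fun p => \prod_j (x j / r j) ^+ p j.
  by apply/funext => p; rewrite /rpow -prodf_div; apply: eq_bigr => j _; rewrite expr_div_n.
rewrite (bsum_prod N (fun j k => (x j / r j) ^+ k)); apply: ler_prod => j _.
have t0 : 0 <= x j / r j by rewrite divr_ge0 // ltW.
have t1 : x j / r j < 1 by rewrite ltr_pdivrMr // mul1r.
rewrite sumr_ge0 /=; last by move=> i _; rewrite exprn_ge0.
rewrite -[leRHS]mul1r ler_pdivlMr ?subr_gt0 //.
have := subrX1 (x j / r j) N.
set S := \sum_(_ < _) _ => E; have := exprn_ge0 N t0.
have -> : S * (1 - x j / r j) = - ((x j / r j - 1) * S) by ring.
rewrite -E; lra.
Qed.

Section Existence.
Variables (f : Cn R n -> C) (rho r : 'I_n -> R) (M : R).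
Hypotheses (r0 : forall j, 0 < r j) (rr : forall j, r j < rho j).
Hypothesis fd : forall w, PD rho w -> forall j,
  derivable (fun u : CC R => f (upd w j u) : CC R) (w 0 j : CC R) 1.
Hypothesis fM : forall w, PD rho w -> normc (f w) <= M.

Lemma errE_small (e : R) : 0 < e -> exists2 N0, (0 < N0)%N & forall N, (N0 <= N)%N ->
  n%:R * N%:R ^+ n * errE rho r M N <= e.
Proof.
move=> e0.
have rho0 j : 0 < rho j by exact: lt_trans (r0 j) (rr j).
have M0 : 0 <= M.
  by apply: le_trans (normc_ge0 (f 0)) (fM _) => j; rewrite mxE normc0 ltW.
(* The inner factor 2 comes from $N+1\le2N$; the resulting extra power of $N$ explains the exponent
   [n.+1] below. *)
pose c j := n%:R * (2 * (2 * M * rho j / (rho j - r j))).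
have c0 j : 0 <= c j.
  rewrite !mulr_ge0 ?invr_ge0 ?subr_ge0 //; exact: ltW.
have e1 : 0 < e / (1 + n%:R) by rewrite divr_gt0 // ltr_pwDl.
have q01 j : 0 <= r j / rho j < 1.
  by rewrite divr_ge0 ?(ltW (r0 j)) ?(ltW (rho0 j)) //= ltr_pdivrMr // mul1r.
have [K KP] := choice (fun j => @poly_geom_small R n.+1 _ _ _ (q01 j) (c0 j) e1).
exists (\max_j K j).+1 => // N NK; have N1 : 1 <= N%:R :> R by rewrite ler1n (leq_trans _ NK).
rewrite /errE mulr_sumr; apply: (@le_trans _ _ (\sum_(j < n) e / (1 + n%:R))); last first.
  rewrite sumr_const card_ord -(mulr_natr (e / _)) mulrAC ler_pdivrMr; last by rewrite ltr_pwDl.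
  by apply: ler_wpM2l; [exact: ltW|rewrite lerDr].
apply: ler_sum => j _; have := KP j N (leq_trans (leq_bigmax j) (ltnW NK)) => /ltW.
apply: le_trans.
have q0 : 0 <= (r j / rho j) ^+ N by rewrite exprn_ge0 //; case/andP: (q01 j).
set q := (r j / rho j) ^+ N in q0 *; set D := 2 * M * rho j / (rho j - r j).
have D0 : 0 <= D by rewrite !mulr_ge0 ?invr_ge0 ?subr_ge0 // ltW.
have -> : c j * (N%:R ^+ n.+1 * q) = n%:R * N%:R ^+ n * ((N%:R + N%:R) * (D * q)).
  by rewrite /c -/D exprS; ring.
apply: ler_wpM2l; first by rewrite mulr_ge0 // exprn_ge0.
by apply: ler_wpM2r; [rewrite mulr_ge0|rewrite lerD2l].
Qed.

(** The approximating polynomials are uniformly Cauchy on the closed polydisc, so by [coef_bound]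
    their coefficients are Cauchy with weight $r^p$. Strictly inside the polydisc these weighted
    errors are summed against a geometric series. *)
Theorem power_series_exists : exists (a : mi -> C) (A : R),
  (forall p, normc (a p) * rpow r p <= A) /\
  forall w : Cn R n, (forall j, normc (w 0 j) < r j) -> blim (fun p => a p * mono p w) (f w).
Proof.
have : forall N, exists c : mi -> C, (0 < N)%N -> (forall p, ~~ inbox N p -> c p = 0) /\
  forall w, PD r w -> normc (f w - bsum N (fun p => c p * mono p w)) <= n%:R * N%:R ^+ n * errE rho r M N.
  case=> [|N]; first by exists (fun=> 0).
  by have [c cP] := poly_approx r0 rr fd fM (ltn0Sn N); exists c.
move=> /choice[c cP].
(* Both polynomials are regarded as polynomials of the larger box [N'], where [coef_bound] applies
   to their difference. *)
have cc N N' (e : R) p : (0 < N)%N -> (N <= N')%N ->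
   n%:R * N%:R ^+ n * errE rho r M N <= e -> n%:R * N'%:R ^+ n * errE rho r M N' <= e ->
   normc (c N p - c N' p) * rpow r p <= e + e.
  move=> N0 NN h h'; have [z cN] := cP N N0; have [z' cN'] := cP N' (leq_trans N0 NN).
  have e0 : 0 <= e by apply: le_trans h'; rewrite !mulr_ge0 ?exprn_ge0 // (errE_ge0 r0 rr fM).
  have [pN|pN] := boolP (inbox N' p); last first.
    rewrite z' // z ?subrr ?normc0 ?mul0r ?addr_ge0 //.
    by apply: contra pN; exact: inbox_leq.
  apply: (@coef_bound N' r (fun p => c N p - c N' p)) => //; first exact: leq_trans NN.
  move=> w wr.
  have -> : bsum N' (fun q => (c N q - c N' q) * mono q w) =
     (f w - bsum N' (fun q => c N' q * mono q w)) - (f w - bsum N (fun q => c N q * mono q w)).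
    rewrite -(@bsum_widen _ _ N N' (fun q => c N q * mono q w)) //; last by move=> q /z ->; rewrite mul0r.
    under eq_bsum => q _ do rewrite mulrBl.
    by rewrite bsumB; ring.
  by apply: (le_trans (normcB _ _)); apply: lerD; [exact: le_trans (cN' w wr) h'|exact: le_trans (cN w wr) h].
have cauchy p (e : R) : 0 < e -> exists N0, forall N N', (N0 <= N)%N -> (N0 <= N')%N -> normc (c N p - c N' p) <= e.
  move=> e0; have rp : 0 < rpow r p by exact: rpow_gt0.
  have e2 : 0 < e * rpow r p / 2 by rewrite divr_gt0 // mulr_gt0.
  have [N0 N00 NP] := errE_small e2; exists N0 => N N' h1 h2.
  rewrite -(ler_pM2r rp) [leRHS]splitr; wlog NN : N N' h1 h2 / (N <= N')%N => [W|].
    have [/W|/ltnW/W] := leqP N N'; first by apply.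
    by rewrite normc_distC; apply.
  by apply: cc => //; [exact: leq_trans h1|exact: NP|exact: NP].
have [a aP] := choice (fun p => Ccomplete (cauchy p)).
have ca (e : R) N : 0 < e -> (0 < N)%N -> (forall N', (N <= N')%N -> n%:R * N'%:R ^+ n * errE rho r M N' <= e) ->
   forall p, normc (c N p - a p) * rpow r p <= e + e.
  move=> e0 N0 NP p; have rp : 0 < rpow r p by exact: rpow_gt0.
  apply/ler_addgt0Pl => d d0; have [N1 N1P] := aP p (d / rpow r p) (divr_gt0 d0 rp).
  have := N1P _ (leq_maxr N N1); rewrite ler_pdivlMr // => h1.
  have h2 := cc N (maxn N N1) e p N0 (leq_maxl _ _) (NP _ (leqnn _)) (NP _ (leq_maxl _ _)).
  have -> : c N p - a p = (c N p - c (maxn N N1) p) + (c (maxn N N1) p - a p) by ring.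
  apply: (@le_trans _ _ ((normc (c N p - c (maxn N N1) p) + normc (c (maxn N N1) p - a p)) * rpow r p)).
    by apply: ler_wpM2r; [exact: ltW|exact: normcD].
  by rewrite mulrDl addrC; apply: lerD.
have rho0 j : 0 < rho j by exact: lt_trans (r0 j) (rr j).
have [N0 N00 NP] := errE_small (@ltr01 R).
(* [M + 1] bounds the coefficients of the polynomial of index [N0], whose error is at most 1;
   [1 + 1] bounds their distance to the limit. *)
exists a, (M + 1 + (1 + 1)); split=> [p|w wr].
  have rp : 0 < rpow r p by exact: rpow_gt0.
  have h1 := @ca 1 N0 ltr01 N00 NP p.
  have h2 : normc (c N0 p) * rpow r p <= M + 1.
    have [z cN] := cP N0 N00.
    have [pN|pN] := boolP (inbox N0 p); last first.
      rewrite z // normc0 mul0r addr_ge0 //.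
      by apply: le_trans (normc_ge0 (f 0)) (fM _) => j; rewrite mxE normc0 ltW.
    apply: (@coef_bound N0 r) => // w wr.
    have -> : bsum N0 (fun q => c N0 q * mono q w) = f w - (f w - bsum N0 (fun q => c N0 q * mono q w)) by ring.
    apply: (le_trans (normcB _ _)); apply: lerD.
      by apply: fM => j; apply: (le_trans (wr j)); exact: ltW.
    by apply: (le_trans (cN w wr)); exact: NP.
  have -> : a p = c N0 p - (c N0 p - a p) by ring.
  apply: (@le_trans _ _ ((normc (c N0 p) + normc (c N0 p - a p)) * rpow r p)).
    by apply: ler_wpM2r; [exact: ltW|exact: normcB].
  by rewrite mulrDl; apply: lerD.
move=> e e0.
pose G := \prod_j (1 - normc (w 0 j) / r j)^-1.
have G0 : 0 <= G.
  apply: prodr_ge0 => j _; rewrite invr_ge0 subr_ge0 ler_pdivrMr // mul1r; exact: ltW.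
(* The two errors, [d] and [(d + d) * G], then add up to [e / 2]. *)
pose d := e / (2 + 4 * G).
have d0 : 0 < d by rewrite divr_gt0 //; lra.
have [N1 N10 N1P] := errE_small d0; exists N1 => N NN.
have N0' : (0 < N)%N by exact: leq_trans NN.
have [_ cN] := cP N N0'.
have h1 : normc (f w - bsum N (fun p => c N p * mono p w)) <= d.
  by apply: (le_trans (cN w _)); [move=> j; exact: ltW|exact: N1P].
have h2 : normc (bsum N (fun p => (c N p - a p) * mono p w)) <= (d + d) * G.
  apply: (le_trans (normc_bsum _ _)).
  apply: (@le_trans _ _ ((d + d) * bsum N (fun p => rpow (fun j => normc (w 0 j)) p / rpow r p))).
    rewrite -bsumZR; apply: le_bsum => p _; rewrite normcM normc_mono.
    have rp : 0 < rpow r p by exact: rpow_gt0.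
    have := ca d N d0 N0' (fun N' h => N1P N' (leq_trans NN h)) p.
    rewrite -ler_pdivlMr // => h.
    rewrite mulrA mulrAC; apply: ler_wpM2r => //; apply: rpow_ge0 => j; exact: normc_ge0.
  apply: ler_wpM2l; first lra.
  by apply: geometric_box_bound => // j; exact: normc_ge0.
have -> : bsum N (fun p => a p * mono p w) - f w =
  - (f w - bsum N (fun p => c N p * mono p w)) - bsum N (fun p => (c N p - a p) * mono p w).
  under [X in _ = _ - X]eq_bsum => q _ do rewrite mulrBl.
  by rewrite bsumB; ring.
apply: (le_lt_trans (normcB _ _)); rewrite normcN.
have E : d * (2 + 4 * G) = e by rewrite /d divfK // gt_eqF //; lra.
move: h1 h2; lra.
Qed.

End Existence.
End PowerSeries.

(** * Termwise differentiation *)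

Section TermwiseDerivative.
Context {R : realType} {n : nat}.
Local Notation C := R[i].
Local Notation mi := ('I_n -> nat).

(** [T] is the same remainder with $|x|$ and [eta] in place of $x$ and $h$. Both satisfy one
    recursion with nonnegative coefficients, and the remainder starts at order two, so replacing $h$
    by [eta] gains $(|h|/\eta)^2$. *)
Lemma taylor2_bound (x h : C) (eta : R) m : 0 < eta -> normc h <= eta ->
  normc ((x + h) ^+ m - x ^+ m - h * (m%:R * x ^+ m.-1)) <=
  (normc h / eta) ^+ 2 * (normc x + eta) ^+ m.
Proof.
move=> eta0 heta; set X := normc x; set s := X + eta.
have X0 : 0 <= X by exact: normc_ge0.
pose T (k : nat) := s ^+ k - X ^+ k - eta * (k%:R * X ^+ k.-1).
have TS k : T k.+1 = s * T k + eta ^+ 2 * (k%:R * X ^+ k.-1).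
  by rewrite /T; case: k => [|k] /=; rewrite /s ?exprS ?expr0 ?mulr0n -?natr1; ring.
suff [K1 K2] : normc ((x + h) ^+ m - x ^+ m - h * (m%:R * x ^+ m.-1)) <= (normc h / eta) ^+ 2 * T m /\ 0 <= T m.
  apply: (le_trans K1); apply: ler_wpM2l; first by rewrite sqr_ge0.
  have h1 : 0 <= eta * (m%:R * X ^+ m.-1) by rewrite !mulr_ge0 ?exprn_ge0 // ltW.
  have h2 : 0 <= X ^+ m by rewrite exprn_ge0.
  by rewrite /T; lra.
elim: m => [|k [IH T0]].
  by rewrite /T !expr0 /= !mul0r !mulr0 !subrr normc0 !mulr0.
have q0 : 0 <= k%:R * X ^+ k.-1 by rewrite mulr_ge0 // exprn_ge0.
split; last first.
  by rewrite TS addr_ge0 // mulr_ge0 // ?addr_ge0 ?sqr_ge0 // ltW.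
have -> : (x + h) ^+ k.+1 - x ^+ k.+1 - h * (k.+1%:R * x ^+ k.+1.-1) =
   (x + h) * ((x + h) ^+ k - x ^+ k - h * (k%:R * x ^+ k.-1)) + h ^+ 2 * (k%:R * x ^+ k.-1).
  by case: k {IH T0 q0} => [|k] /=; rewrite ?exprS ?expr0 ?mulr0n -?natr1; ring.
apply: (le_trans (normcD _ _)); rewrite TS [leRHS]mulrDr; apply: lerD.
  rewrite normcM [leRHS]mulrCA; apply: ler_pM => //; try exact: normc_ge0.
  by apply: (le_trans (normcD _ _)); rewrite /s lerD2l.
by rewrite !normcM !normcX normcR_nat [leRHS]mulrA -exprMn divfK ?lexx // gt_eqF.
Qed.

(** A single term of the binomial expansion of $s^k=(x+(s-x))^k$. *)
Lemma ffact_pow_bound (k l : nat) (x s : R) : 0 <= x -> x < s ->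
  (k ^_ l)%:R * x ^+ (k - l) <= (l`!)%:R / (s - x) ^+ l * s ^+ k.
Proof.
move=> x0 xs; have s0 : 0 < s by exact: le_lt_trans xs.
have d0 : 0 < s - x by rewrite subr_gt0.
have [lk|kl] := leqP l k; last first.
  by rewrite ffact_small // mul0r !mulr_ge0 ?invr_ge0 ?exprn_ge0 // ltW.
have -> : (k ^_ l)%:R * x ^+ (k - l) = (l`!)%:R * ('C(k, l)%:R * x ^+ (k - l)).
  by rewrite -bin_ffact natrM; ring.
rewrite -mulrA; apply: ler_wpM2l => //.
rewrite [leRHS]mulrC ler_pdivlMr ?exprn_gt0 //.
have -> : s ^+ k = (x + (s - x)) ^+ k by congr (_ ^+ _); ring.
rewrite (exprDn x (s - x) k) (bigD1 (Ordinal (lk : (l < k.+1)%N))) //= -mulr_natl.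
have : 0 <= \sum_(i < k.+1 | i != Ordinal (lk : (l < k.+1)%N)) x ^+ (k - i) * (s - x) ^+ i *+ 'C(k, i).
  by apply: sumr_ge0 => i _; rewrite mulrn_wge0 // mulr_ge0 ?exprn_ge0 // ltW.
lra.
Qed.

Definition oPD (r : 'I_n -> R) (w : Cn R n) := forall j, normc (w 0 j) < r j.

Definition efac (l k : nat) (x : C) : C := (k ^_ l)%:R * x ^+ (k - l).

(* The [l]-th derivative of [a p * z ^ p], indexed by [p] rather than by [p - l]: the falling
   factorial in [efac] kills the terms where [k - l] is truncated. *)
Definition tterm (a : mi -> C) (l p : mi) (z : Cn R n) : C := a p * \prod_j efac (l j) (p j) (z 0 j).

Lemma tterm0 a p z : tterm a (fun=> 0%N) p z = a p * mono p z.
Proof.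
rewrite /tterm monoE; congr (_ * _); apply: eq_bigr => j _.
by rewrite /efac ffactn0 mul1r subn0.
Qed.

Definition ladd (l : mi) (j : 'I_n) : mi := fun i => if i == j then (l i).+1 else l i.

Section Bounds.
Variables (a : mi -> C) (rho : 'I_n -> R) (A : R).
Hypotheses (rho0 : forall j, 0 < rho j) (aA : forall p, normc (a p) * rpow rho p <= A).

Let A0 : 0 <= A.
Proof.
apply: le_trans (aA (fun=> 0%N)); rewrite mulr_ge0 ?normc_ge0 //.
by apply: rpow_ge0 => j; exact: ltW.
Qed.

Lemma efac_bound l k x (y s : R) : normc x <= y -> y < s ->
  normc (efac l k x) <= (l`!)%:R / (s - y) ^+ l * s ^+ k.
Proof.
move=> xy ys; have y0 : 0 <= y by exact: le_trans (normc_ge0 x) xy.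
rewrite normcM normcR_nat normcX; apply: le_trans (ffact_pow_bound k l y0 ys).
by apply: ler_wpM2l => //; rewrite lerXn2r // nnegrE // normc_ge0.
Qed.

(** One summable family bounds both the terms and their second-order increments: the remainder at
    [z] is controlled by the undifferentiated term at radius $|z_j|+\eta\le x_j$. *)
Lemma tterm_majorant l (x : 'I_n -> R) : (forall j, 0 <= x j < rho j) ->
  exists u : mi -> R, [/\ forall p, 0 <= u p, exists U, forall N, bsum N u <= U,
    forall p (z : Cn R n), (forall j, normc (z 0 j) <= x j) -> normc (tterm a l p z) <= u p &
    forall p (z : Cn R n) j (h : C) (eta : R), 0 < eta -> normc h <= eta ->
      (forall i, normc (z 0 i) + (if i == j then eta else 0) <= x i) ->
      normc (tterm a l p (upd z j (z 0 j + h)) - tterm a l p z - h * tterm a (ladd l j) p z)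
       <= (normc h / eta) ^+ 2 * u p].
Proof.
(* A radius midway: the gap from [x] to [s] pays for the derivatives, the gap from [s] to [rho] for
   geometric convergence. *)
move=> xr; pose s j := (x j + rho j) / 2.
have xs j : x j < s j by have := xr j; rewrite /s; lra.
have sr j : s j < rho j by have := xr j; rewrite /s; lra.
have x0 j : 0 <= x j by case/andP: (xr j).
have s0 j : 0 < s j by exact: le_lt_trans (xs j).
pose c j := ((l j)`!)%:R / (s j - x j) ^+ l j.
have c0 j : 0 <= c j by rewrite divr_ge0 // exprn_ge0 // subr_ge0 ltW.
pose u p := A / rpow rho p * \prod_j (c j * s j ^+ p j).
have rp p : 0 < rpow rho p by exact: rpow_gt0.
have ap p : normc (a p) <= A / rpow rho p by rewrite ler_pdivlMr.
have cs0 p j : 0 <= c j * s j ^+ p j by rewrite mulr_ge0 // exprn_ge0 // ltW.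
exists u; split.
- move=> p; rewrite /u !mulr_ge0 ?invr_ge0 //; first exact: ltW.
  by apply: prodr_ge0 => j _; exact: cs0.
- exists (A * \prod_j c j * \prod_j (1 - s j / rho j)^-1) => N.
  have -> : u = fun p => A * \prod_j c j * (rpow s p / rpow rho p).
    apply/funext => p; rewrite /u big_split /= /rpow; ring.
  rewrite bsumZR; apply: ler_wpM2l.
    by rewrite mulr_ge0 //; apply: prodr_ge0 => j _.
  by apply: geometric_box_bound => // j; exact: ltW.
- move=> p z zx; rewrite /tterm normcM normc_prod /u; apply: ler_pM => //.
  + exact: normc_ge0.
  + by apply: prodr_ge0 => j _; exact: normc_ge0.
  + by apply: ler_prod => j _; rewrite normc_ge0 /=; apply: efac_bound.
- move=> p z j h eta eta0 heta zx.
  have zi i : normc (z 0 i) <= x i.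
    by apply: le_trans (zx i); rewrite lerDl; case: eqP => // _; exact: ltW.
  have zj : normc (z 0 j) + eta <= x j by have := zx j; rewrite eqxx.
  pose Q := \prod_(i | i != j) efac (l i) (p i) (z 0 i).
  have -> : tterm a l p (upd z j (z 0 j + h)) - tterm a l p z - h * tterm a (ladd l j) p z =
    a p * ((efac (l j) (p j) (z 0 j + h) - efac (l j) (p j) (z 0 j) - h * efac (l j).+1 (p j) (z 0 j)) * Q).
    have E (F : 'I_n -> C) : \prod_i F i = F j * \prod_(i | i != j) F i by rewrite (bigD1 j).
    rewrite /tterm (E (fun i => efac (l i) (p i) (upd z j (z 0 j + h) 0 i))).
    rewrite (E (fun i => efac (l i) (p i) (z 0 i))) (E (fun i => efac (ladd l j i) (p i) (z 0 i))).
    rewrite /ladd eqxx updE eqxx.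
    rewrite (eq_bigr (fun i => efac (l i) (p i) (z 0 i))); last first.
      by move=> i ij; rewrite updE (negPf ij).
    rewrite [X in _ - h * (_ * (_ * X))](eq_bigr (fun i => efac (l i) (p i) (z 0 i))); last first.
      by move=> i ij; rewrite (negPf ij).
    by rewrite -/Q; ring.
  rewrite normcM /u [leRHS]mulrCA; apply: ler_pM => //; try exact: normc_ge0.
  rewrite normcM [X in _ <= _ * X](bigD1 j) //= [leRHS]mulrA; apply: ler_pM; try exact: normc_ge0; last first.
    by rewrite normc_prod; apply: ler_prod => i _; rewrite normc_ge0 /=; apply: efac_bound.
  set k := p j; set L := l j; set X := z 0 j.
  have -> : efac L k (X + h) - efac L k X - h * efac L.+1 k X =
     (k ^_ L)%:R * ((X + h) ^+ (k - L) - X ^+ (k - L) - h * ((k - L)%:R * X ^+ (k - L).-1)).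
    by rewrite /efac ffactnSr natrM subnS; ring.
  rewrite normcM normcR_nat.
  apply: (@le_trans _ _ ((k ^_ L)%:R * ((normc h / eta) ^+ 2 * (normc X + eta) ^+ (k - L)))).
    by apply: ler_wpM2l => //; exact: taylor2_bound.
  rewrite mulrCA; apply: ler_wpM2l; first exact: sqr_ge0.
  apply: le_trans (ffact_pow_bound k L (x0 j) (xs j)).
  apply: ler_wpM2l => //; rewrite lerXn2r // nnegrE ?addr_ge0 ?normc_ge0 //; exact: ltW.
Qed.

Lemma tterm_summable l z : oPD rho z -> exists U, forall N, bsum N (fun p => normc (tterm a l p z)) <= U.
Proof.
move=> zr; have [|u [u0 [U UP] tu _]] := @tterm_majorant l (fun j => normc (z 0 j)).
  by move=> j; rewrite normc_ge0 zr.
by exists U => N; apply: le_trans (UP N); apply: le_bsum => p _; exact: tu.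
Qed.

End Bounds.

Lemma summable_blim (t : mi -> C) U : (forall N, bsum N (fun p => normc (t p)) <= U) ->
  exists l, blim t l.
Proof.
(* The shift to [N.+1] avoids the empty box, which [bsum_mono] excludes. *)
move=> tU; pose v N := bsum N.+1 (fun p => normc (t p)).
have t0 p : 0 <= normc (t p) by exact: normc_ge0.
have vm N M : (N <= M)%N -> v N <= v M by move=> NM; apply: bsum_mono.
have hs : has_sup (range v).
  by split; [exists (v 0); exists 0 | exists U => _ [N _ <-]; exact: tU].
have [|l lP] := @Ccomplete R (fun N => bsum N.+1 t).
  move=> e e0; have [_ [N0 _ <-] h0] := sup_adherent e0 hs.
  have hi N : (N0 <= N)%N -> v N - v N0 <= e.
    by move=> NN; have : v N <= sup (range v) by [apply: ub_le_sup; [case: hs|exists N]]; lra.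
  exists N0 => N M; wlog NM : N M / (N <= M)%N => [W NN MM|NN MM].
    have [/W|/ltnW/W] := leqP N M; first by apply.
    by rewrite normc_distC; apply.
  rewrite normc_distC; apply: (le_trans (bsum_tail (u := fun p => normc (t p)) _ _ _)) => //.
  rewrite -/(v M) -/(v N); have := vm _ _ NN; have := hi M MM; lra.
exists l => e e0; have e2 : 0 < e / 2 by rewrite divr_gt0.
have [N0 NP] := lP _ e2; exists N0.+1 => -[//|N] NN.
by apply: (le_lt_trans (NP N NN)); rewrite ltr_pdivrMr // mulr_natr mulr2n ltrDl.
Qed.

Lemma blim_norm_le (t : mi -> C) l B : blim t l -> (forall N, normc (bsum N t) <= B) -> normc l <= B.
Proof.
move=> tl tB; apply/ler_addgt0Pl => e e0; have [N0 NP] := tl e e0.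
have -> : l = bsum N0 t - (bsum N0 t - l) by ring.
apply: (le_trans (normcB _ _)); rewrite [leLHS]addrC; apply: lerD => //.
by apply: ltW; exact: (NP N0 (leqnn _)).
Qed.

(** The error of the difference quotient is at most $K|h|$, which identifies the limit defining
    ['D_v]. *)
Lemma derive_of_quadratic (F : Cn R n -> C) z (v : Cn R n) (D : C) (eta K : R) : 0 < eta ->
  (forall h : C, normc h <= eta -> normc (F (h *: v + z) - F z - h * D) <= K * normc h ^+ 2) ->
  'D_v (toCo F) z = D.
Proof.
move=> eta0 H; rewrite /derive; apply: cvg_lim => //.
have K0 : 0 <= K.
  have := H (Complex eta 0); rewrite normcR gtr0_norm // => /(_ (lexx _)) h.
  have := le_trans (normc_ge0 _) h; rewrite pmulr_lge0 // exprn_gt0 //.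
apply/cvgrPdist_le => e e0.
have e0' : 0 < complex.Re e by move: e0; rewrite ltcE => /andP[].
have eE : e = Complex (complex.Re e) 0.
  by move: e0; rewrite ltcE /= => /andP[/eqP ie _]; case: e ie {e0'} => x y /= ->.
pose d := Num.min eta (complex.Re e / (1 + K)).
have d0 : 0 < d by rewrite lt_min eta0 divr_gt0 //; lra.
near=> h.
have hd : normc h < d.
  have : `|h| < Complex d 0 by near: h; apply: dnbhs0_lt; rewrite ltcE /= eqxx.
  by rewrite normCE ltcE /= => /andP[].
have h0 : h != 0 by near: h; exact: nbhs_dnbhs_neq.
have nh : 0 < normc h by rewrite normc_gt0.
rewrite eE normCE lecE /= eqxx /=.
have -> : D - h^-1 *: ((toCo F \o shift z) (h *: v) - toCo F z) =
   - (h^-1 * (F (h *: v + z) - F z - h * D)).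
  by rewrite -[h^-1 *: _]/(h^-1 * (F (h *: v + z) - F z)); field.
rewrite normcN normcM normcV ler_pdivrMl //.
move: hd; rewrite lt_min => /andP[/ltW/H hd1 hd2]; apply: (le_trans hd1).
rewrite expr2 mulrCA; apply: ler_wpM2l; first exact: ltW.
move: hd2; rewrite ltr_pdivlMr; nra.
Unshelve. all: by end_near. Qed.

Lemma upd_shift (z : Cn R n) j (h : C) : h *: (delta_mx 0 j : Cn R n) + z = upd z j (z 0 j + h).
Proof.
apply/rowP => i; rewrite updE !mxE eqxx /=; case: eqP => [->|_].
  by rewrite mulr1 addrC.
by rewrite mulr0 add0r.
Qed.

Section Termwise.
Variables (a : mi -> C) (rho : 'I_n -> R) (A : R).
Hypotheses (rho0 : forall j, 0 < rho j) (aA : forall p, normc (a p) * rpow rho p <= A).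

(** The increments of the terms are dominated by $(|h|/\eta)^2u_p$ with $u$ summable, so the sum has
    a quadratic remainder and [derive_of_quadratic] applies. *)
Lemma pderiv_series l F j : (forall z, oPD rho z -> blim (fun p => tterm a l p z) (F z)) ->
  forall z, oPD rho z -> blim (fun p => tterm a (ladd l j) p z) (pderiv j F z).
Proof.
move=> Fl z zr.
have [U UP] := tterm_summable rho0 aA (ladd l j) zr.
have [D DP] := summable_blim UP.
suff -> : pderiv j F z = D by [].
pose eta := (rho j - normc (z 0 j)) / 2.
have eta0 : 0 < eta by rewrite divr_gt0 // subr_gt0 zr.
pose x i := normc (z 0 i) + (if i == j then eta else 0).
have xr i : 0 <= x i < rho i.
  rewrite /x; have := zr i; have := normc_ge0 (z 0 i).
  case: eqP => [->|_] h1 h2; apply/andP; split; rewrite /eta; lra.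
have [u [u0 [V VP] _ tu]] := tterm_majorant rho0 aA l xr.
apply: (@derive_of_quadratic F z (delta_mx 0 j) D eta (V / eta ^+ 2)) => // h heta.
rewrite upd_shift.
have zh : oPD rho (upd z j (z 0 j + h)).
  move=> i; rewrite updE; case: eqP => [->|//].
  apply: (le_lt_trans (normcD _ _)); have := zr j; move: heta; rewrite /eta; lra.
have L : blim (fun p => tterm a l p (upd z j (z 0 j + h)) + (-1) * tterm a l p z + (- h) * tterm a (ladd l j) p z)
    (F (upd z j (z 0 j + h)) + (-1) * F z + (- h) * D).
  apply: blimD; last exact: blimZ.
  by apply: blimD; [exact: Fl|apply: blimZ; exact: Fl].
rewrite mulN1r mulNr in L; apply: (blim_norm_le L) => N.
apply: (le_trans (normc_bsum _ _)).
apply: (@le_trans _ _ ((normc h / eta) ^+ 2 * bsum N u)).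
  rewrite -bsumZR; apply: le_bsum => p _; rewrite mulN1r mulNr.
  exact: tu.
apply: (@le_trans _ _ ((normc h / eta) ^+ 2 * V)); first by apply: ler_wpM2l; [exact: sqr_ge0|].
by rewrite expr_div_n le_eqVlt; apply/orP; left; apply/eqP; ring.
Qed.

Lemma Dmulti_series f l : (forall z, oPD rho z -> blim (fun p => a p * mono p z) (f z)) ->
  forall z, oPD rho z -> blim (fun p => tterm a l p z) (Dmulti l f z).
Proof.
move=> fl; rewrite /Dmulti.
have it k j l' F : (forall z, oPD rho z -> blim (fun p => tterm a l' p z) (F z)) ->
   forall z, oPD rho z -> blim (fun p => tterm a (fun i => if i == j then (l' i + k)%N else l' i) p z) 
      (iter k (pderiv j) F z).
  move=> Fl; elim: k => [|k IH] z zr /=.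
    have -> : (fun i => if i == j then (l' i + 0)%N else l' i) = l'.
      by apply/funext => i; rewrite addn0 if_same.
    exact: Fl.
  have := @pderiv_series _ _ j IH z zr.
  have -> // : ladd (fun i => if i == j then (l' i + k)%N else l' i) j = (fun i => if i == j then (l' i + k.+1)%N else l' i).
  by apply/funext => i; rewrite /ladd; case: eqP => // _; rewrite addnS.
(* Coordinates are differentiated one at a time; uniqueness of [s] ensures that the exponent at [j]
   is still 0 when [j] is reached. *)
have K (s : seq 'I_n) : uniq s -> forall z, oPD rho z ->
   blim (fun p => tterm a (fun i => if i \in s then l i else 0%N) p z)
     (foldr (fun j g => iter (l j) (pderiv j) g) f s z).
  elim: s => [_|j s IH /= /andP[js us]] z zr /=.
    apply: eq_blim (fl z zr) => p; exact/esym/tterm0.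
  have := it (l j) j _ _ (IH us) z zr.
  have -> // : (fun i => if i == j then ((if i \in s then l i else 0) + l j)%N else if i \in s then l i else 0%N) =
     (fun i => if i \in j :: s then l i else 0%N).
  by apply/funext => i; rewrite inE; case: eqVneq => [->|//]; rewrite (negPf js).
move=> z zr; have := K _ (enum_uniq 'I_n) z zr.
by have -> : (fun i => if i \in enum 'I_n then l i else 0%N) = l by apply/funext => i; rewrite mem_enum.
Qed.

Lemma tterm_at0 l : blim (fun p => tterm a l p 0) (a l * (mfact l)%:R).
Proof.
have -> : a l * (mfact l)%:R = tterm a l l 0.
  rewrite /tterm /mfact natr_prod; congr (_ * _); apply: eq_bigr => j _.
  by rewrite /efac ffactnn subnn expr0 mulr1.
apply: (@blim_single n R (fun p => tterm a l p 0)) => q ql.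
have /existsP[j qlj] : [exists j, q j != l j].
  apply: contra_notT ql; rewrite negb_exists => /forallP qp; apply/funext => j.
  by apply/eqP; move: (qp j); rewrite negbK.
rewrite /tterm (bigD1 j) //= /efac mxE; have [h|h|/eqP] := ltngtP (q j) (l j); last by rewrite (negPf qlj).
  by rewrite ffact_small // !mul0r mulr0.
by rewrite expr0n subn_eq0 leqNgt h mulr0 mul0r mulr0.
Qed.

(** At the origin only the term [p = l] of the differentiated series survives. Hence the
    coefficients do not depend on the polydisc used to construct them. *)
Lemma coef_taylor f : (forall z, oPD rho z -> blim (fun p => a p * mono p z) (f z)) ->
  forall l, Dmulti l f 0 / (mfact l)%:R = a l.
Proof.
move=> fl l; have z0 : oPD rho 0 by move=> j; rewrite mxE normc0.
rewrite (blim_unique (Dmulti_series l fl z0) (tterm_at0 l)) mulfK //.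
by rewrite pnatr_eq0 -lt0n /mfact prodn_gt0 // => j; exact: fact_gt0.
Qed.

End Termwise.
End TermwiseDerivative.

(** * Taylor series of holomorphic functions on balls *)

Section HolomorphicSeries.
Context {R : realType} {n : nat}.
Local Notation C := R[i].
Local Notation mi := ('I_n -> nat).

Lemma ltCR (a b : R) : (Complex a 0 < Complex b 0 :> C) = (a < b).
Proof. by rewrite ltcE /= eqxx. Qed.

Lemma nbhsC_intro (z : CC R) (P : set (CC R)) (r : R) : 0 < r ->
  (forall u : C, normc (z - u) < r -> P u) -> nbhs z P.
Proof.
move=> r0 H; apply/nbhs_ballP; exists (Complex r 0); first by rewrite /= ltcE /= eqxx.
by move=> u; rewrite /ball /= normCE ltcE /= => /andP[_]; exact: H.
Qed.

Lemma continuous_normc : continuous (fun z : CC R => normc z : R).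
Proof.
move=> z; have FF : Filter (nbhs (z : CC R)) by exact: nbhs_filter.
apply/(@cvgrPdist_lt _ _ _ (nbhs (z : CC R)) FF) => e e0; apply: (@nbhsC_intro z _ e e0) => u zu.
apply: le_lt_trans zu; rewrite ler_norml; apply/andP; split.
  have := normcD (u - z) z; rewrite subrK normc_distC; lra.
by have := normcD (z - u) u; rewrite subrK; lra.
Qed.

Lemma continuous_Complex : continuous (fun p : R * R => Complex p.1 p.2 : CC R).
Proof.
move=> [x y]; apply/cvgrPdist_lt => e e0.
have e0' : 0 < complex.Re e by move: e0; rewrite ltcE => /andP[].
have eE : e = Complex (complex.Re e) 0.
  by move: e0; rewrite ltcE /= => /andP[/eqP ie _]; case: e ie {e0'} => a b /= ->.
near=> p; rewrite eE normCE ltCR.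
apply: (le_lt_trans (normc_ReIm _)); rewrite cReD cImD cReN cImN /= (splitr (complex.Re e)).
have h : ball (x, y) (complex.Re e / 2) p.
  near: p; exact: (@nbhsx_ballx R (R * R)%type (x, y) _ (divr_gt0 e0' (@ltr0Sn R 1))).
case: h => /= h1 h2; exact: ltrD.
Unshelve. all: by end_near. Qed.

(** The continuous image of a closed subset of a compact square of $\mathbb R^2$. *)
Lemma compact_disc (r : R) : compact ([set z | normc z <= r] : set (CC R)).
Proof.
have -> : ([set z | normc z <= r] : set (CC R)) = (fun p : R * R => Complex p.1 p.2 : CC R) @`
    ((`[- r, r]%classic `*` `[- r, r]%classic) `&` ((fun p : R * R => normc (Complex p.1 p.2)) @^-1` `]-oo, r]%classic)).
  apply/seteqP; split => [[x y] h|z [[x y] [_ h] <-]] /=; last by move: h; rewrite /= in_itv.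
  exists (x, y) => //; split; last by rewrite /= in_itv.
  have h1 := le_trans (normc_Re _) h; have h2 := le_trans (normc_Im _) h.
  by split; rewrite /= in_itv /= -ler_norml.
apply: continuous_compact.
  by apply: continuous_subspaceT; exact: continuous_Complex.
apply: compact_closedI; first by apply: compact_setX; exact: segment_compact.
apply: closed_comp; last exact: interval_closed.
move=> p _; apply: (@continuous_comp _ _ _ (fun p : R * R => Complex p.1 p.2 : CC R) (fun z : CC R => normc z : R)).
  exact: continuous_Complex.
exact: continuous_normc.
Qed.

Lemma compact_PD (r : 'I_n -> R) : compact (PD r : set (Cn R n)).
Proof.
have := @rV_compact (CC R) n (fun j => [set z | normc z <= r j]) (fun j => @compact_disc (r j)).
by congr compact.
Qed.

Lemma bounded_on_PD (f : Cn R n -> C) (r : 'I_n -> R) :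
  (forall z, PD r z -> differentiable (toCo f) z) -> exists M, forall z, PD r z -> normc (f z) <= M.
Proof.
move=> fd.
have : compact ((fun z => normc (toCo f z) : R) @` (PD r : set (Cn R n))).
  apply: continuous_compact; last exact: compact_PD.
  apply: continuous_in_subspaceT => z; rewrite inE => zr.
  apply: (@continuous_comp _ _ _ (toCo f) (fun z : CC R => normc z : R)).
    exact: differentiable_continuous (fd z zr).
  exact: continuous_normc.
move=> /compact_bounded[B [_ BP]]; exists (B + 1) => z zr.
have := BP (B + 1) _ (normc (f z)); rewrite ltrDl => /(_ ltr01).
rewrite /= ger0_norm ?normc_ge0 //; apply; by exists z.
Qed.

Lemma slice_derivable (f : Cn R n -> C) w j : differentiable (toCo f) w ->
  derivable (fun u : CC R => f (upd w j u) : CC R) (w 0 j : CC R) 1.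
Proof.
pose g (u : CC R) : CC R := f (upd w j u).
have E : (fun h : C => h^-1 *: ((toCo f \o shift w) (h *: (delta_mx 0 j : Cn R n)) - toCo f w)) =
         (fun h : C => h^-1 *: ((g \o shift (w 0 j : CC R)) (h *: (1 : CC R)) - g (w 0 j))).
  apply/funext => h /=; congr (_ *: (_ - _)).
    by rewrite /toCo upd_shift /g; congr f; congr upd; rewrite -[h *: 1]/(h * 1) mulr1 addrC.
  by rewrite /toCo /g upd_id.
move=> /(@diff_derivable _ _ _ _ _ (delta_mx 0 j : Cn R n)); rewrite /derivable E.
exact.
Qed.

Definition tcoef (f : Cn R n -> C) (p : mi) : C := Dmulti p f 0 / (mfact p)%:R.

Lemma cnorm2E (z : Cn R n) : cnorm2 z = \sum_j normc (z 0 j) ^+ 2.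
Proof. by apply: eq_bigr => j _; rewrite cabs2E. Qed.

(** The slack is divided into [1 + n] equal shares and one share is added to each square, leaving
    one to spare. *)
Lemma enlarge_radii (x : 'I_n -> R) (r : R) : (forall j, 0 <= x j) -> \sum_j x j ^+ 2 < r ^+ 2 ->
  exists y : 'I_n -> R, (forall j, x j < y j) /\ \sum_j y j ^+ 2 < r ^+ 2.
Proof.
move=> x0 xr; pose e := (r ^+ 2 - \sum_j x j ^+ 2) / (1 + n%:R).
have n0 : 0 <= n%:R :> R by [].
have e0 : 0 < e by rewrite divr_gt0 ?subr_gt0 // ltr_pwDl.
have s0 j : 0 <= x j ^+ 2 + e by rewrite addr_ge0 ?sqr_ge0 // ltW.
exists (fun j => Num.sqrt (x j ^+ 2 + e)); split=> [j|].
  rewrite -[ltLHS]ger0_norm // -sqrtr_sqr ltr_sqrt ?ltrDl //.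
  by rewrite ltr_wpDl // sqr_ge0.
under eq_bigr => j _ do rewrite sqr_sqrtr //.
rewrite big_split /= sumr_const card_ord -(mulr_natr e).
have E : e * (1 + n%:R) = r ^+ 2 - \sum_j x j ^+ 2 by rewrite divfK // gt_eqF // ltr_pwDl.
move: E; rewrite mulrDr mulr1; lra.
Qed.

(** The ball is exhausted by polydiscs with $\sum_j\rho_j^2<r^2$, and a single coefficient family
    must serve them all. *)
Definition PSon (r : R) (f : Cn R n -> C) (a : mi -> C) : Prop :=
  forall rho : 'I_n -> R, (forall j, 0 < rho j) -> \sum_j rho j ^+ 2 < r ^+ 2 ->
    (exists A, forall p, normc (a p) * rpow rho p <= A) /\
    forall w, oPD rho w -> blim (fun p => a p * mono p w) (f w).

Lemma in_polydisc (r : R) (z : Cn R n) : cnorm2 z < r ^+ 2 ->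
  exists rho : 'I_n -> R, [/\ forall j, 0 < rho j, \sum_j rho j ^+ 2 < r ^+ 2 & oPD rho z].
Proof.
rewrite cnorm2E => zr.
have [y [zy yr]] := enlarge_radii (fun j => normc_ge0 (z 0 j)) zr.
by exists y; split => // j; exact: le_lt_trans (normc_ge0 _) (zy j).
Qed.

(** A slightly larger closed polydisc still lies in the ball, and [f] is bounded there by
    compactness; the coefficients found on each polydisc are the Taylor coefficients. *)
Lemma holomorphic_PSon (r : R) f : holomorphic_on (cball n r) f -> PSon r f (tcoef f).
Proof.
move=> fh rho rho0 rr.
have [rho1 [h1 r1]] := enlarge_radii (fun j => ltW (rho0 j)) rr.
have PDb z : PD rho1 z -> differentiable (toCo f) z.
  move=> zr; apply: fh; rewrite /cball /= cnorm2E; apply: le_lt_trans r1.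
  apply: ler_sum => j _; rewrite lerXn2r ?nnegrE ?normc_ge0 //.
  exact: le_trans (normc_ge0 _) (zr j).
have [M MP] := bounded_on_PD PDb.
have [a [A [aA af]]] := @power_series_exists R n f rho1 rho M rho0 h1
  (fun w wr j => @slice_derivable f w j (PDb w wr)) MP.
have E : tcoef f = a by apply/funext => l; exact: (coef_taylor rho0 aA af).
by rewrite E; split; [exists A|].
Qed.

Lemma PSon_tcoef (r : R) f a : 0 < r -> PSon r f a -> tcoef f = a.
Proof.
move=> r0 fa; have [|rho [rho0 rr _]] := @in_polydisc r 0.
  by rewrite cnorm2E big1 ?exprn_gt0 // => j _; rewrite mxE normc0 expr0n.
have [[A aA] af] := fa rho rho0 rr.
by apply/funext => l; exact: (coef_taylor rho0 aA af).
Qed.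

Lemma PSon_Dmulti (r : R) f a l z : PSon r f a -> cnorm2 z < r ^+ 2 ->
  blim (fun p => tterm a l p z) (Dmulti l f z).
Proof.
move=> fa zr; have [rho [rho0 rr zrho]] := in_polydisc zr.
by have [[A aA] af] := fa rho rho0 rr; exact: (Dmulti_series rho0 aA l af zrho).
Qed.

Lemma PSon_summable (r : R) f a l z : PSon r f a -> cnorm2 z < r ^+ 2 ->
  exists U, forall N, bsum N (fun p => normc (tterm a l p z)) <= U.
Proof.
move=> fa zr; have [rho [rho0 rr zrho]] := in_polydisc zr.
by have [[A aA] af] := fa rho rho0 rr; exact: (tterm_summable rho0 aA l zrho).
Qed.

Lemma PSonD (r : R) f g a b c d : PSon r f a -> PSon r g b ->
  PSon r (fun z => c * f z + d * g z) (fun p => c * a p + d * b p).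
Proof.
move=> fa gb rho rho0 rr; have [[A aA] af] := fa rho rho0 rr; have [[B bB] bg] := gb rho rho0 rr.
split.
  exists (normc c * A + normc d * B) => p.
  have rp := rpow_gt0 p rho0.
  apply: (@le_trans _ _ ((normc c * normc (a p) + normc d * normc (b p)) * rpow rho p)).
    by apply: ler_wpM2r; [exact: ltW|rewrite -!normcM; exact: normcD].
  by rewrite mulrDl -!mulrA; apply: lerD; apply: ler_wpM2l; rewrite ?normc_ge0.
move=> w wr; have := blimD (blimZ c (af w wr)) (blimZ d (bg w wr)).
by apply: eq_blim => p; ring.
Qed.

Lemma PSon_mono (r : R) q c : PSon r (fun z => c * mono q z) (fun p => if `[< p = q >] then c else 0).
Proof.
move=> rho rho0 rr; split.
  exists (normc c * rpow rho q) => p; case: asboolP => [->//|_].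
  by rewrite normc0 mul0r mulr_ge0 ?normc_ge0 //; apply: rpow_ge0 => j; exact: ltW.
move=> w wr; have := @blim_single n R (fun p => (if `[< p = q >] then c else 0) * mono p w) q.
by rewrite asboolT //; apply=> p pq; rewrite asboolF // mul0r.
Qed.

End HolomorphicSeries.

(** * Iterated integrals and their invariance under rotations *)

Section IteratedIntegral.
Local Open Scope ereal_scope.
Context {R : realType}.
Local Notation mu := (@lebesgue_measure R).
Implicit Types (g h : (nat -> R) -> \bar R) (x : nat -> R).

(* Borel measurability of a function of countably many real coordinates, in a form
   which is visibly stable under integration of one coordinate. *)
Definition borel g := forall (d : measure_display) (T : measurableType d) (u : nat -> T -> R),
  (forall i, measurable_fun setT (u i)) -> measurable_fun setT (fun t => g (fun i => u i t)).

Definition subst x (k : nat) (t : R) : nat -> R := fun i => if i == k then t else x i.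

Lemma iter_intS k g x : iter_int k.+1 g x = \int[mu]_(t in [set: R]) iter_int k g (subst x k t).
Proof. by []. Qed.

Lemma borel_subst g x k : borel g -> measurable_fun setT (fun t : R => g (subst x k t)).
Proof.
move=> bg; apply: (bg _ _ (fun i t => subst x k t i)) => i; rewrite /subst.
by case: eqP => _; [exact: measurable_id|exact: measurable_cst].
Qed.

Lemma iter_int_ge0 k g x : (forall y, 0 <= g y) -> 0 <= iter_int k g x.
Proof. by move=> g0; elim: k x => [//|k IH] x; rewrite iter_intS; apply: integral_ge0. Qed.

Lemma borel_iter_int k g : (forall y, 0 <= g y) -> borel g -> borel (iter_int k g).
Proof.
move=> g0 bg; elim: k => [//|k IH] d T u mu_.
apply: (@measurable_fun_fubini_tonelli_F _ _ T _ R mu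
  (fun p : T * R => iter_int k g (subst (fun i => u i p.1) k p.2))).
  apply: (IH _ _ (fun i (p : T * R) => subst (fun i => u i p.1) k p.2 i)) => i; rewrite /subst.
  case: eqP => _; first exact: measurable_snd.
  by apply: (@measurableT_comp _ _ _ _ _ _ (u i)) => //; exact: measurable_fst.
by move=> p; exact: iter_int_ge0.
Qed.

Lemma le_iter_int k g h x : (forall y, 0 <= g y) -> borel g -> borel h -> (forall y, g y <= h y) ->
  iter_int k g x <= iter_int k h x.
Proof.
move=> g0 bg bh gh; have h0 y : 0 <= h y by exact: le_trans (gh y).
elim: k x => [//|k IH] x; rewrite !iter_intS; apply: ge0_le_integral => //.
- by move=> t _; exact: iter_int_ge0.
- by apply: borel_subst; exact: borel_iter_int.
- by apply: borel_subst; exact: borel_iter_int.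
Qed.

Lemma iter_intD k g h x : (forall y, 0 <= g y) -> (forall y, 0 <= h y) -> borel g -> borel h ->
  iter_int k (fun y => g y + h y) x = iter_int k g x + iter_int k h x.
Proof.
move=> g0 h0 bg bh; elim: k x => [//|k IH] x; rewrite !iter_intS.
rewrite -ge0_integralD //.
- by apply: eq_integral => t _; exact: IH.
- by move=> t _; exact: iter_int_ge0.
- by apply: borel_subst; exact: borel_iter_int.
- by move=> t _; exact: iter_int_ge0.
- by apply: borel_subst; exact: borel_iter_int.
Qed.

Lemma iter_intZ k (c : R) g x : (0 <= c)%R -> (forall y, 0 <= g y) -> borel g ->
  iter_int k (fun y => c%:E * g y) x = c%:E * iter_int k g x.
Proof.
move=> c0 g0 bg; elim: k x => [//|k IH] x; rewrite !iter_intS.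
rewrite -ge0_integralZl_EFin //.
- by apply: eq_integral => t _; exact: IH.
- by move=> t _; exact: iter_int_ge0.
- by apply: borel_subst; exact: borel_iter_int.
Qed.

Lemma borelD g h : borel g -> borel h -> borel (fun y => g y + h y).
Proof. by move=> bg bh d T u mu_; apply: emeasurable_funD; [exact: bg|exact: bh]. Qed.

Lemma borel0 : borel (fun=> 0).
Proof. by move=> d T u _; exact: measurable_cst. Qed.

Lemma iter_int0 k x : iter_int k (fun=> 0) x = 0.
Proof.
elim: k x => [//|k IH] x; rewrite iter_intS (eq_integral (fun=> 0)) ?integral0 //.
Qed.

Lemma iter_int_sum (I : Type) (s : seq I) k (g : I -> (nat -> R) -> \bar R) x :
  (forall i y, 0 <= g i y) -> (forall i, borel (g i)) ->
  iter_int k (fun y => \sum_(i <- s) g i y) x = \sum_(i <- s) iter_int k (g i) x /\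
  borel (fun y => \sum_(i <- s) g i y).
Proof.
move=> g0 bg; elim: s => [|i s [IH1 IH2]].
  rewrite (_ : (fun y => _) = fun=> 0); last by apply/funext => y; rewrite big_nil.
  by rewrite big_nil iter_int0; split => //; exact: borel0.
rewrite (_ : (fun y => _) = fun y => g i y + \sum_(j <- s) g j y); last by apply/funext => y; rewrite big_cons.
rewrite big_cons iter_intD // ?IH1; last by move=> y; exact: sume_ge0.
by split => //; exact: borelD.
Qed.

Lemma borel_limn_einf (g : nat -> (nat -> R) -> \bar R) : (forall m, borel (g m)) ->
  borel (fun y => limn_einf (fun m => g m y)).
Proof.
move=> bg d T u mu_.
have -> : (fun t : T => limn_einf (fun m => g m (fun i => u i t))) =
  (fun t => - limn_esup (fun m => - g m (fun i => u i t))).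
  apply/funext => t; rewrite -limn_einfN; congr limn_einf; apply/funext => m /=.
  by rewrite oppeK.
apply: measurableT_comp => //; apply: measurable_fun_limn_esup => m.
by apply: measurableT_comp => //; exact: bg.
Qed.

Lemma limn_einf_ge0 (v : nat -> \bar R) : (forall m, 0 <= v m) -> 0 <= limn_einf v.
Proof.
move=> v0; rewrite limn_einf_lim; apply: lime_ge; first exact: is_cvg_einfs.
apply: nearW => m; rewrite /einfs; apply: le_ereal_inf_tmp => _ [j _ <-]; exact: v0.
Qed.

Lemma le_limn_einf (v w : nat -> \bar R) : (forall m, v m <= w m) -> limn_einf v <= limn_einf w.
Proof.
move=> vw; rewrite !limn_einf_lim; apply: lee_lim; [exact: is_cvg_einfs|exact: is_cvg_einfs|].
apply: nearW => m; rewrite /einfs; apply: le_ereal_inf_tmp => _ [j jm <-].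
by apply: le_trans (vw j); apply: ereal_inf_lbound; exists j.
Qed.

(** One-dimensional Fatou, applied to one coordinate at a time. *)
Lemma fatou_iter_int k (g : nat -> (nat -> R) -> \bar R) x : (forall m y, 0 <= g m y) ->
  (forall m, borel (g m)) ->
  iter_int k (fun y => limn_einf (fun m => g m y)) x <= limn_einf (fun m => iter_int k (g m) x).
Proof.
move=> g0 bg; elim: k x => [//|k IH] x; rewrite iter_intS.
apply: (@le_trans _ _ (\int[mu]_(t in [set: R]) limn_einf (fun m => iter_int k (g m) (subst x k t)))).
  apply: ge0_le_integral => //.
  - by move=> t _; apply: iter_int_ge0 => y; exact: limn_einf_ge0.
  - apply: borel_subst; apply: borel_iter_int; last exact: borel_limn_einf.
    by move=> y; exact: limn_einf_ge0.
  - apply: (@borel_subst (fun y => limn_einf (fun m => iter_int k (g m) y))).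
    by apply: borel_limn_einf => m; exact: borel_iter_int.
apply: (fatou mu (D := setT) _ (f := fun m t => iter_int k (g m) (subst x k t))) => //.
- by move=> m; apply: borel_subst; exact: borel_iter_int.
- by move=> m t _; exact: iter_int_ge0.
Qed.

End IteratedIntegral.

(** * Rotation invariance of the iterated integral *)

Section RotationInvariance.
Local Open Scope ereal_scope.
Context {R : realType}.
Local Notation mu := (@lebesgue_measure R).

(** The pushforward of Lebesgue measure by a translation agrees with it on half-open intervals, so
    uniqueness applies. *)
Lemma integral_translate (G : R -> \bar R) (a : R) : measurable_fun setT G -> (forall t, 0 <= G t) ->
  \int[mu]_(t in [set: R]) G (t + a)%R = \int[mu]_(t in [set: R]) G t.
Proof.
move=> mG G0; pose f (t : R) : R := (t + a)%R.
have mf : measurable_fun [set: R] f by apply: measurable_funD => //; exact: measurable_cst.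
pose m : {measure set (measurableTypeR R) -> \bar R} := @lebesgue_measure R.
have mf' : measurable_fun [set: measurableTypeR R] (f : measurableTypeR R -> measurableTypeR R) by [].
have := @ge0_integral_pushforward _ _ _ _ R _ mf' m setT G measurableT mG (fun y _ => G0 y).
rewrite preimage_setT => <-.
pose nu : {measure set (measurableTypeR R) -> \bar R} :=
  measure_function_pushforward__canonical__measure_function_Measure m mf'.
apply: (@eq_measure_integral _ _ _ setT m nu) => A mA _; apply/esym.
apply: lebesgue_measure_unique => // X [[x y] _ <-] /=.
have -> : nu `]x, y]%classic = mu `](x - a)%R, (y - a)%R]%classic.
  rewrite /nu /= /pushforward; congr (mu _); apply/seteqP; split => t /=;
    by rewrite !in_itv /= /f ltrBlDr lerBrDr.
by rewrite !lebesgue_measure_itv /= !lte_fin ltrD2r -!EFinD; case: ifP => // _; congr EFin; ring.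
Qed.


Implicit Types H : R -> R -> \bar R.

Definition dint H : \bar R := \int[mu]_(t in [set: R]) \int[mu]_(s in [set: R]) H s t.

Definition measurable2 H := measurable_fun [set: R * R] (fun p : R * R => H p.1 p.2).

Lemma measurable2_comp H (a b c d : R) : measurable2 H ->
  measurable2 (fun s t => H (a * s + b * t)%R (c * s + d * t)%R).
Proof.
move=> mH; apply: (@measurableT_comp _ _ _ _ _ _ (fun p : R * R => H p.1 p.2) _
   (fun p : R * R => ((a * p.1 + b * p.2)%R, (c * p.1 + d * p.2)%R))) => //.
have l (x y : R) : measurable_fun [set: R * R] (fun p : R * R => (x * p.1 + y * p.2)%R).
  apply: measurable_funD; apply: measurable_funM; try exact: measurable_cst.
    exact: measurable_fst.
  exact: measurable_snd.
by apply: measurable_fun_pair; exact: l.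
Qed.

Lemma measurable2_l H t : measurable2 H -> measurable_fun [set: R] (H ^~ t).
Proof.
move=> mH; apply: (@measurableT_comp _ _ _ _ _ _ (fun p : R * R => H p.1 p.2) _ (fun s : R => (s, t))) => //.
Qed.

Lemma measurable2_r H s : measurable2 H -> measurable_fun [set: R] (H s).
Proof.
move=> mH; apply: (@measurableT_comp _ _ _ _ _ _ (fun p : R * R => H p.1 p.2) _ (fun t : R => (s, t))) => //.
by apply: measurable_fun_pair; [exact: measurable_cst|exact: measurable_id].
Qed.

Lemma dint_swap H : measurable2 H -> (forall s t, 0 <= H s t) ->
  dint H = \int[mu]_(s in [set: R]) \int[mu]_(t in [set: R]) H s t.
Proof.
move=> mH H0; have := @fubini_tonelli _ _ _ _ R mu mu (fun p : R * R => H p.1 p.2) mH (fun p => H0 _ _).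
by move=> /= ->.
Qed.

Lemma dint_shear1 H a : measurable2 H -> (forall s t, 0 <= H s t) ->
  dint (fun s t => H (s + a * t)%R t) = dint H.
Proof.
move=> mH H0; apply: eq_integral => t _.
by apply: (@integral_translate (H ^~ t) (a * t)%R) => //; exact: measurable2_l.
Qed.

Lemma dint_shear2 H a : measurable2 H -> (forall s t, 0 <= H s t) ->
  dint (fun s t => H s (t + a * s)%R) = dint H.
Proof.
move=> mH H0; rewrite !dint_swap //.
  apply: eq_integral => s _.
  by apply: (@integral_translate (H s) (a * s)%R) => //; exact: measurable2_r.
have := measurable2_comp 1 0 a 1 mH; congr measurable_fun; apply/funext => p /=.
by congr H; ring.
Qed.

(* A rotation is a product of three shears, and shears preserve iterated integrals
   by translation invariance of the one-dimensional Lebesgue measure. *)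
Lemma dint_rot_generic H (c d : R) : measurable2 H -> (forall s t, 0 <= H s t) ->
  (c ^+ 2 + d ^+ 2 = 1)%R -> (1 + c != 0)%R ->
  dint (fun s t => H (c * s - d * t)%R (d * s + c * t)%R) = dint H.
Proof.
(* With $c=\cos\theta$ and $d=\sin\theta$ this is $-\tan(\theta/2)$, undefined only for the half
   turn. *)
move=> mH H0 cd c1; pose tau := (- (d / (1 + c)))%R.
have dtau : (d * tau = c - 1)%R.
  apply: (mulIf c1); rewrite /tau mulrN mulNr -!mulrA mulVf // mulr1.
  by transitivity (c ^+ 2 - (c ^+ 2 + d ^+ 2))%R; [ring|rewrite cd; ring].
have tauc : (tau * (1 + c) = - d)%R by rewrite /tau mulNr divfK.
pose H1 s t := H (s + tau * t)%R t.
pose H2 s t := H1 s (t + d * s)%R.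
have m1 : measurable2 H1.
  by have := measurable2_comp 1 tau 0 1 mH; congr measurable_fun; apply/funext => p /=; congr H; ring.
have m2 : measurable2 H2.
  by have := measurable2_comp 1 0 d 1 m1; congr measurable_fun; apply/funext => p /=; congr H1; ring.
have h1 s t : 0 <= H1 s t by exact: H0.
have h2 s t : 0 <= H2 s t by exact: H0.
rewrite -(dint_shear1 tau mH H0) -/H1 -(dint_shear2 d m1 h1) -/H2 -(dint_shear1 tau m2 h2).
congr dint; apply/funext => s; apply/funext => t; rewrite /H2 /H1.
have E : (d * s + c * t = t + d * (s + tau * t))%R.
  by rewrite mulrDr mulrA dtau; ring.
congr H => //; rewrite -E mulrDr mulrA (mulrC tau d) dtau.
by rewrite -[in LHS](opprK d) -tauc; ring.
Qed.

(** The half turn, excluded above, is the square of a quarter turn. *)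
Lemma dint_rot H (c d : R) : measurable2 H -> (forall s t, 0 <= H s t) ->
  (c ^+ 2 + d ^+ 2 = 1)%R -> dint (fun s t => H (c * s - d * t)%R (d * s + c * t)%R) = dint H.
Proof.
move=> mH H0 cd; have [c1|] := eqVneq (1 + c)%R 0%R; last exact: dint_rot_generic.
have cE : c = (-1)%R by apply/eqP; rewrite -subr_eq0 opprK addrC c1.
have dE : d = 0%R.
  by apply/eqP; rewrite -sqrf_eq0; apply/eqP; move: cd; rewrite cE; lra.
pose H1 s t := H (0 * s - 1 * t)%R (1 * s + 0 * t)%R.
have q : (0 ^+ 2 + 1 ^+ 2 = 1 :> R)%R by ring.
have q1 : (1 + 0 != 0 :> R)%R by rewrite addr0 oner_eq0.
have m1 : measurable2 H1.
  by have := measurable2_comp 0 (-1) 1 0 mH; congr measurable_fun; apply/funext => p /=; congr H; ring.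
rewrite -(dint_rot_generic mH H0 q q1) -/H1.
rewrite -(dint_rot_generic m1 _ q q1); last by move=> s t; exact: H0.
congr dint; apply/funext => s; apply/funext => t; rewrite /H1 cE dE.
by congr H; ring.
Qed.

(** The real form of multiplying $z_j=x_{2j}+ix_{2j+1}$ by $c_j+id_j$; parity of the index selects
    the component. *)
Definition rotx (c d : nat -> R) (x : nat -> R) : nat -> R := fun i =>
  (if odd i then d i./2 * x i.-1 + c i./2 * x i else c i./2 * x i - d i./2 * x i.+1)%R.

(** Induction on pairs of coordinates. The parameters [x] are rotated on the right-hand side as
    well, since the outer integrations substitute into them. *)
Lemma iter_int_rot k c d (g : (nat -> R) -> \bar R) x : borel g -> (forall y, 0 <= g y) ->
  (forall j, c j ^+ 2 + d j ^+ 2 = 1)%R ->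
  iter_int k.*2 (fun y => g (rotx c d y)) x = iter_int k.*2 g (rotx c d x).
Proof.
move=> bg g0 cd; elim: k x => [//|k IH] x.
rewrite doubleS !iter_intS.
pose H (s t : R) := iter_int k.*2 g (subst (subst (rotx c d x) k.*2.+1 t) k.*2 s).
have := @dint_rot H (c k) (d k) _ _ (cd k); rewrite /dint => <-.
- apply: eq_integral => t _; rewrite iter_intS; apply: eq_integral => s _.
  rewrite IH /H; congr iter_int; apply/funext => i; rewrite /rotx /subst.
  have n1 : (k.*2.+1 == k.*2) = false by rewrite eqn_leq ltnn.
  have [->|i1] := eqVneq i k.*2.
    by rewrite odd_double doubleK eqxx n1.
  have [->|i2] := eqVneq i k.*2.+1.
    by rewrite /= odd_double /= uphalf_double eqxx.
  case: ifPn => oi.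
    have h : (i.-1 == k.*2) = false.
      by apply/negbTE/eqP => h; move: i2; rewrite -h prednK ?eqxx //; case: i oi {i1 h}.
    have h' : (i.-1 == k.*2.+1) = false.
      apply/negbTE/eqP => h'; move: oi; have : i = i.-1.+1 by case: i {i1 i2 h} h'.
      by move=> ->; rewrite h' /= negbK odd_double.
    by rewrite h h'.
  have h : (i.+1 == k.*2) = false.
    by apply/negbTE/eqP => h; move: (congr1 odd h); rewrite /= odd_double oi.
  by rewrite h eqSS (negPf i1).
- have bH := @borel_iter_int R k.*2 g g0 bg.
  apply: (bH _ _ (fun i (p : R * R) => subst (subst (rotx c d x) k.*2.+1 p.2) k.*2 p.1 i)) => i.
  rewrite /subst; case: eqP => _; first exact: measurable_fst.
  by case: eqP => _; [exact: measurable_snd|exact: measurable_cst].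
- by move=> s t; exact: iter_int_ge0.
Qed.

End RotationInvariance.

(** * Weighted norms and orthogonality of monomials *)

Section WeightedNorm.
Context {R : realType} {n : nat}.
Local Notation C := R[i].
Local Notation mi := ('I_n -> nat).

Definition toz (x : nat -> R) : Cn R n := \row_(j < n) Complex (x (j : nat).*2) (x (j : nat).*2.+1).

Lemma intCnE (G : Cn R n -> \bar R) : intCn G = iter_int n.*2 (fun x => G (toz x)) (fun=> 0).
Proof. by []. Qed.

Definition borelR (F : Cn R n -> R) := forall (d : measure_display) (T : measurableType d) (u : nat -> T -> R),
  (forall i, measurable_fun setT (u i)) -> measurable_fun setT (fun t => F (toz (fun i => u i t))).

Lemma borelR_EFin F : borelR F -> borel (fun x => (F (toz x))%:E).
Proof. by move=> bF d T u mu_; apply/measurable_EFinP; exact: bF. Qed.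

Lemma borelR_cst c : borelR (fun=> c).
Proof. by move=> d T u _; exact: measurable_cst. Qed.

Lemma borelRD F G : borelR F -> borelR G -> borelR (fun z => F z + G z).
Proof. by move=> bF bG d T u mu_; apply: measurable_funD; [exact: bF|exact: bG]. Qed.

Lemma borelRM F G : borelR F -> borelR G -> borelR (fun z => F z * G z).
Proof. by move=> bF bG d T u mu_; apply: measurable_funM; [exact: bF|exact: bG]. Qed.

Lemma borelRB F G : borelR F -> borelR G -> borelR (fun z => F z - G z).
Proof. by move=> bF bG d T u mu_; apply: measurable_funB; [exact: bF|exact: bG]. Qed.

Lemma borelR_Re (j : 'I_n) : borelR (fun z => complex.Re (z 0 j)).
Proof.
move=> d T u mu_; rewrite (_ : (fun t => _) = u (j : nat).*2) //.
by apply/funext => t; rewrite mxE.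
Qed.

Lemma borelR_Im (j : 'I_n) : borelR (fun z => complex.Im (z 0 j)).
Proof.
move=> d T u mu_; rewrite (_ : (fun t => _) = u (j : nat).*2.+1) //.
by apply/funext => t; rewrite mxE.
Qed.

Definition borelC (F : Cn R n -> C) := borelR (fun z => complex.Re (F z)) /\ borelR (fun z => complex.Im (F z)).

Lemma borelC_cst c : borelC (fun=> c). Proof. by split; exact: borelR_cst. Qed.

Lemma borelCD F G : borelC F -> borelC G -> borelC (fun z => F z + G z).
Proof.
move=> [f1 f2] [g1 g2]; split.
  by rewrite (_ : (fun z => _) = fun z => complex.Re (F z) + complex.Re (G z)); [exact: borelRD|apply/funext => z; rewrite cReD].
by rewrite (_ : (fun z => _) = fun z => complex.Im (F z) + complex.Im (G z)); [exact: borelRD|apply/funext => z; rewrite cImD].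
Qed.

Lemma borelCM F G : borelC F -> borelC G -> borelC (fun z => F z * G z).
Proof.
move=> [f1 f2] [g1 g2]; split.
  rewrite (_ : (fun z => _) = fun z => complex.Re (F z) * complex.Re (G z) - complex.Im (F z) * complex.Im (G z)).
    by apply: borelRB; exact: borelRM.
  by apply/funext => z; rewrite cReM.
rewrite (_ : (fun z => _) = fun z => complex.Re (F z) * complex.Im (G z) + complex.Im (F z) * complex.Re (G z)).
  by apply: borelRD; exact: borelRM.
by apply/funext => z; rewrite cImM.
Qed.

Lemma borelC_sum (I : Type) (s : seq I) (F : I -> Cn R n -> C) : (forall i, borelC (F i)) ->
  borelC (fun z => \sum_(i <- s) F i z).
Proof.
move=> bF; elim: s => [|i s IH].
  by rewrite (_ : (fun z => _) = fun=> 0); [exact: borelC_cst|apply/funext => z; rewrite big_nil].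
rewrite (_ : (fun z => _) = fun z => F i z + \sum_(j <- s) F j z); first exact: borelCD.
by apply/funext => z; rewrite big_cons.
Qed.

Lemma borelC_prod (I : Type) (s : seq I) (F : I -> Cn R n -> C) : (forall i, borelC (F i)) ->
  borelC (fun z => \prod_(i <- s) F i z).
Proof.
move=> bF; elim: s => [|i s IH].
  by rewrite (_ : (fun z => _) = fun=> 1); [exact: borelC_cst|apply/funext => z; rewrite big_nil].
rewrite (_ : (fun z => _) = fun z => F i z * \prod_(j <- s) F j z); first exact: borelCM.
by apply/funext => z; rewrite big_cons.
Qed.

Lemma borelC_coordX j k : borelC (fun z => (z 0 j) ^+ k).
Proof.
elim: k => [|k IH]; first exact: borelC_cst.
rewrite (_ : (fun z => _) = fun z : Cn R n => z 0 j * (z 0 j) ^+ k); last by apply/funext => z; rewrite exprS.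
by apply: borelCM => //; split; [exact: borelR_Re|exact: borelR_Im].
Qed.

Lemma borelC_tterm a l p : borelC (tterm a l p).
Proof.
apply: borelCM; first exact: borelC_cst.
apply: borelC_prod => j; apply: borelCM; [exact: borelC_cst|exact: borelC_coordX].
Qed.

Lemma borelC_bsum N (t : mi -> Cn R n -> C) : (forall p, borelC (t p)) -> borelC (fun z => bsum N (fun p => t p z)).
Proof. by move=> bt; apply: borelC_sum => p; exact: bt. Qed.

Lemma borelR_cabs2 F : borelC F -> borelR (fun z => cabs2 (F z)).
Proof.
move=> [f1 f2]; apply: borelRD.
  by rewrite (_ : (fun z => _) = fun z => complex.Re (F z) * complex.Re (F z)); [exact: borelRM|apply/funext => z; rewrite expr2].
by rewrite (_ : (fun z => _) = fun z => complex.Im (F z) * complex.Im (F z)); [exact: borelRM|apply/funext => z; rewrite expr2].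
Qed.

Lemma borelR_cnorm2 : borelR (@cnorm2 R n).
Proof.
rewrite /cnorm2; move: (index_enum _) => s; elim: s => [|i s IH].
  by rewrite (_ : (fun z => _) = fun=> 0); [exact: borelR_cst|apply/funext => z; rewrite big_nil].
rewrite (_ : (fun z => _) = fun z : Cn R n => cabs2 (z 0 i) + \sum_(j <- s) cabs2 (z 0 j)).
  by apply: borelRD => //; apply: borelR_cabs2; split; [exact: borelR_Re|exact: borelR_Im].
by apply/funext => z; rewrite big_cons.
Qed.

Definition rotz (u : 'I_n -> C) (z : Cn R n) : Cn R n := \row_j (u j * z 0 j).

Lemma rotzE u z j : rotz u z 0 j = u j * z 0 j. Proof. by rewrite mxE. Qed.

(** Beyond the [n] coordinates the defaults 1 and 0 make the rotation the identity. *)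
Definition cosu (u : 'I_n -> C) (k : nat) : R := oapp (fun j => complex.Re (u j)) 1 (insub k).
Definition sinu (u : 'I_n -> C) (k : nat) : R := oapp (fun j => complex.Im (u j)) 0 (insub k).

Lemma toz_rotx u x : toz (rotx (cosu u) (sinu u) x) = rotz u (toz x).
Proof.
apply/rowP => j; rewrite !mxE /rotx odd_double /= odd_double /= doubleK uphalf_double /cosu /sinu valK /=.
by apply: complexP; rewrite ?cReM ?cImM /=; ring.
Qed.

Lemma cos2sin2u u k : (forall j, normc (u j) = 1) -> cosu u k ^+ 2 + sinu u k ^+ 2 = 1.
Proof.
move=> u1; rewrite /cosu /sinu; case: insubP => [j _ _|_] /=; last by rewrite expr1n expr0n addr0.
by have := cabs2E (u j); rewrite u1 expr1n.
Qed.

Lemma borelR_rotz u F : borelR F -> borelR (fun z => F (rotz u z)).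
Proof.
move=> bF d T v mv.
rewrite (_ : (fun t => _) = fun t => F (toz (fun i => rotx (cosu u) (sinu u) (v^~ t) i))); last first.
  by apply/funext => t; rewrite -toz_rotx.
apply: (bF _ _ (fun i t => rotx (cosu u) (sinu u) (v^~ t) i)) => i; rewrite /rotx; case: (odd i).
  by apply: measurable_funD; apply: measurable_funM => //; exact: measurable_cst.
by apply: measurable_funB; apply: measurable_funM => //; exact: measurable_cst.
Qed.

Lemma intCn_rotz u (F : Cn R n -> R) : borelR F -> (forall z, 0 <= F z) -> (forall j, normc (u j) = 1) ->
  intCn (fun z => (F (rotz u z))%:E) = intCn (fun z => (F z)%:E).
Proof.
move=> bF F0 u1; rewrite !intCnE.
have := @iter_int_rot R n (cosu u) (sinu u) (fun x => (F (toz x))%:E) (fun=> 0) (borelR_EFin bF) _ _.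
rewrite (_ : rotx _ _ (fun=> 0) = fun=> 0); last first.
  by apply/funext => i; rewrite /rotx !mulr0 subr0 addr0 if_same.
move=> <-.
- by congr iter_int; apply/funext => x; rewrite toz_rotx.
- by move=> y; rewrite lee_fin.
- by move=> j; exact: cos2sin2u.
Qed.

(* [sigma] is the square root of the weight; it vanishes outside the domain, so that functions
   only matter where [sigma] does not. *)
Variable sigma : Cn R n -> R.
Hypothesis bsigma : borelR sigma.
Hypothesis sigma_rot : forall u z, (forall j, normc (u j) = 1) -> sigma (rotz u z) = sigma z.

Definition wnorm2 (g : Cn R n -> C) : \bar R := intCn (fun z => (cabs2 (g z) * sigma z ^+ 2)%:E).

(** Measurability is required only after multiplication by [sigma], because functions on the ball
    are uncontrolled outside it. *)
Definition wmeas (g : Cn R n -> C) := borelC (fun z => g z * Complex (sigma z) 0).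

Lemma borelC_sigma : borelC (fun z => Complex (sigma z) 0).
Proof. by split => //; exact: borelR_cst. Qed.

Lemma borelC_wmeas g : borelC g -> wmeas g.
Proof. by move=> bg; apply: borelCM => //; exact: borelC_sigma. Qed.

Lemma cabs2M (a b : C) : cabs2 (a * b) = cabs2 a * cabs2 b.
Proof. by rewrite !cabs2E normcM exprMn. Qed.

Lemma cabs2R (x : R) : cabs2 (Complex x 0) = x ^+ 2.
Proof. by rewrite /cabs2 /= expr0n addr0. Qed.

Lemma cabs2_ge0 (a : C) : 0 <= cabs2 a.
Proof. by rewrite cabs2E sqr_ge0. Qed.

Lemma weighted_ge0 g z : 0 <= cabs2 (g z) * sigma z ^+ 2.
Proof. by rewrite mulr_ge0 ?cabs2_ge0 ?sqr_ge0. Qed.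

Lemma wmeas_borelR g : wmeas g -> borelR (fun z => cabs2 (g z) * sigma z ^+ 2).
Proof.
by move=> /borelR_cabs2; rewrite (_ : (fun z => _) = fun z => cabs2 (g z) * sigma z ^+ 2) //; apply/funext => z; rewrite cabs2M cabs2R.
Qed.

Lemma wnorm2_ge0 g : (0 <= wnorm2 g)%E.
Proof. by rewrite /wnorm2 intCnE; apply: iter_int_ge0 => y; rewrite lee_fin weighted_ge0. Qed.

Lemma wmeas_lin g h c d : wmeas g -> wmeas h -> wmeas (fun z => c * g z + d * h z).
Proof.
move=> bg bh; have := borelCD (borelCM (borelC_cst c) bg) (borelCM (borelC_cst d) bh).
by congr borelC; apply/funext => z; ring.
Qed.

Lemma wmeas_rotz u g : (forall j, normc (u j) = 1) -> wmeas g -> wmeas (fun z => g (rotz u z)).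
Proof.
move=> u1 [g1 g2]; have := conj (borelR_rotz u g1) (borelR_rotz u g2).
rewrite -/(borelC (fun z => g (rotz u z) * Complex (sigma (rotz u z)) 0)).
by congr borelC; apply/funext => z; rewrite sigma_rot.
Qed.

Lemma wnorm2_eq g h : (forall z, sigma z != 0 -> g z = h z) -> wnorm2 g = wnorm2 h.
Proof.
move=> gh; congr intCn; apply/funext => z.
by have [->|/gh ->] := eqVneq (sigma z) 0; rewrite ?expr0n ?mulr0.
Qed.

Lemma wnorm2Z c g : wmeas g -> wnorm2 (fun z => c * g z) = ((cabs2 c)%:E * wnorm2 g)%E.
Proof.
move=> bg; rewrite /wnorm2 !intCnE -iter_intZ ?cabs2_ge0 //.
- by congr (iter_int _ _ _); apply/funext => x; rewrite cabs2M -mulrA EFinM.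
- by move=> y; rewrite lee_fin weighted_ge0.
- exact: borelR_EFin (wmeas_borelR bg).
Qed.

(** A pointwise identity integrated with nonnegative terms; as an identity in the extended reals it
    also serves to deduce finiteness. *)
Lemma wnorm2_parallelogram g h : wmeas g -> wmeas h ->
  (wnorm2 (fun z => (g z + h z)%R) + wnorm2 (fun z => (g z - h z)%R) = 2%:E * wnorm2 g + 2%:E * wnorm2 h)%E.
Proof.
move=> bg bh.
have bD : wmeas (fun z => g z + h z).
  by have := wmeas_lin 1 1 bg bh; congr wmeas; apply/funext => z; rewrite !mul1r.
have bB : wmeas (fun z => g z - h z).
  by have := wmeas_lin 1 (-1) bg bh; congr wmeas; apply/funext => z; rewrite mul1r mulN1r.
have ge (k : Cn R n -> C) y : (0 <= (cabs2 (k (toz y)) * sigma (toz y) ^+ 2)%:E)%E.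
  by rewrite lee_fin weighted_ge0.
have bo k : wmeas k -> borel (fun y => (cabs2 (k (toz y)) * sigma (toz y) ^+ 2)%:E).
  by move=> bk; exact: borelR_EFin (wmeas_borelR bk).
rewrite /wnorm2 !intCnE -iter_intD; last 4 first.
- by move=> y; exact: ge (fun z => g z + h z) y.
- by move=> y; exact: ge (fun z => g z - h z) y.
- exact: bo bD.
- exact: bo bB.
rewrite -!iter_intZ; try by [exact: ler0n|exact: bo bg|exact: bo bh|move=> y; exact: ge].
rewrite -iter_intD.
- congr iter_int; apply/funext => x; rewrite -!EFinM -!EFinD; congr EFin.
  by rewrite /cabs2 !cReD !cImD !cReN !cImN; ring.
- by move=> y; apply: mule_ge0 => //; exact: ge.
- by move=> y; apply: mule_ge0 => //; exact: ge.
- by move=> d T u mu_; apply: measurable_funeM; exact: bo.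
- by move=> d T u mu_; apply: measurable_funeM; exact: bo.
Qed.

Lemma wnorm2_rotz u g : (forall j, normc (u j) = 1) -> wmeas g -> wnorm2 (fun z => g (rotz u z)) = wnorm2 g.
Proof.
move=> u1 bg; rewrite /wnorm2 -(@intCn_rotz u (fun z => cabs2 (g z) * sigma z ^+ 2)) //.
- by congr intCn; apply/funext => z; rewrite sigma_rot.
- exact: wmeas_borelR.
- by move=> z; exact: weighted_ge0.
Qed.

End WeightedNorm.

(** * Averaging over rotations and projection onto monomials *)

Section TailBounds.
Context {R : realType} {n : nat}.
Local Notation C := R[i].
Local Notation mi := ('I_n -> nat).

Lemma bounded_bsum_tail (u : mi -> R) U : (forall p, 0 <= u p) -> (forall N, bsum N u <= U) ->
  forall e : R, 0 < e -> exists2 N0, (0 < N0)%N &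
    forall N M, (N0 <= N)%N -> (N <= M)%N -> bsum M u - bsum N u <= e.
Proof.
move=> u0 uU e e0; pose v N := bsum N.+1 u.
have hs : has_sup (range v).
  by split; [exists (v 0); exists 0 | exists U => _ [N _ <-]; exact: uU].
have [_ [N0 _ <-] h0] := sup_adherent e0 hs.
exists N0.+1 => // -[//|N] [//|M] NN NM.
have h1 : v M <= sup (range v) by apply: ub_le_sup; [case: hs|exists M].
have h2 : v N0 <= v N by apply: bsum_mono.
rewrite -/(v M) -/(v N); lra.
Qed.

Lemma blim_tail (t : mi -> C) (u : mi -> R) l N (e : R) : (0 < N)%N -> blim t l ->
  (forall p, normc (t p) <= u p) -> (forall M, (N <= M)%N -> bsum M u - bsum N u <= e) ->
  normc (l - bsum N t) <= e.
Proof.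
move=> N0 tl tu ue; apply/ler_addgt0Pl => d d0; have [N1 NP] := tl d d0.
pose M := maxn N N1.
have h1 := NP M (leq_maxr _ _).
have h2 := le_trans (bsum_tail N0 (leq_maxl N N1) tu) (ue M (leq_maxl _ _)).
rewrite (_ : l - bsum N t = (l - bsum M t) + (bsum M t - bsum N t)); last by ring.
by apply: (le_trans (normcD _ _)); apply: lerD => //; rewrite normc_distC ltW.
Qed.

End TailBounds.

Section Averages.
Context {R : realType} {n : nat}.
Local Notation C := R[i].
Local Notation mi := ('I_n -> nat).

(** Cauchy-Schwarz against the constant 1, from $\sum_i(ka_i-A)^2\ge0$ with $k$ the cardinality. *)
Lemma sqr_sum_le (I : finType) (a : I -> R) : (\sum_i a i) ^+ 2 <= #|I|%:R * \sum_i a i ^+ 2.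
Proof.
have [I0|I0] := posnP #|I|.
  by rewrite big1 ?expr0n ?I0 ?mul0r // => i _; have := fintype0 i I0.
set A := \sum_i a i; set B := \sum_i a i ^+ 2; set k : R := #|I|%:R.
have k0 : 0 < k by rewrite ltr0n.
have : 0 <= \sum_i (k * a i - A) ^+ 2 by apply: sumr_ge0 => i _; exact: sqr_ge0.
rewrite (eq_bigr (fun i => k ^+ 2 * a i ^+ 2 + (- (2 * k * A)) * a i + A ^+ 2)); last first.
  by move=> i _; ring.
rewrite !big_split /= -!mulr_sumr -/A -/B sumr_const (_ : A *+ _ = k * A) ?mulr_natl // => h.
rewrite -subr_ge0 -(pmulr_rge0 _ k0); move: h; congr (0 <= _); ring.
Qed.

Lemma cabs2_sum_le (I : finType) (a : I -> C) : cabs2 (\sum_i a i) <= #|I|%:R * \sum_i cabs2 (a i).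
Proof.
rewrite cabs2E; apply: (@le_trans _ _ ((\sum_i normc (a i)) ^+ 2)).
  by rewrite ler_sqr ?nnegrE ?normc_ge0 ?sumr_ge0 //; [exact: normc_sum|move=> i _; exact: normc_ge0].
apply: (le_trans (sqr_sum_le _)); rewrite le_eqVlt; apply/orP; left; apply/eqP; congr (_ * _).
by apply: eq_bigr => i _; rewrite cabs2E.
Qed.

Lemma efac_rot (u x : C) l k : efac l k (u * x) * u ^+ l = efac l k x * u ^+ k.
Proof.
rewrite /efac; have [lk|kl] := leqP l k.
  by rewrite exprMn (_ : u ^+ k = u ^+ (k - l) * u ^+ l); [ring|rewrite -exprD subnK].
by rewrite ffact_small // !mul0r.
Qed.

(** The [l]-th derivative of $z^p$ has weight $u^{p-l}$ under rotation; multiplying by $u^l$ avoids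
    the truncated subtraction of exponents. *)
Lemma tterm_rot (a : mi -> C) l p (u : 'I_n -> C) z :
  (\prod_j u j ^+ l j) * tterm a l p (rotz u z) = tterm a l p z * \prod_j u j ^+ p j.
Proof.
rewrite /tterm mulrCA -!mulrA; congr (_ * _); rewrite -!big_split /=.
by apply: eq_bigr => j _; rewrite rotzE mulrC efac_rot.
Qed.

End Averages.

Section MonomialProjection.
Context {R : realType} {n : nat}.
Local Notation C := R[i].
Local Notation mi := ('I_n -> nat).
Variable sigma : Cn R n -> R.
Hypothesis bsigma : borelR sigma.
Hypothesis sigma_rot : forall u z, (forall j, normc (u j) = 1) -> sigma (rotz u z) = sigma z.
Local Notation NS := (wnorm2 sigma).
Local Notation wmeas := (wmeas sigma).

Lemma normc_cvgR (f : nat -> C) (l : C) : (forall e : R, 0 < e -> exists N0, forall N, (N0 <= N)%N -> normc (f N - l) <= e) ->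
  ((fun N => complex.Re (f N)) @ \oo --> complex.Re l) /\ ((fun N => complex.Im (f N)) @ \oo --> complex.Im l).
Proof.
move=> fl; split; apply/cvgrPdist_le => e e0; have [N0 NP] := fl e e0; exists N0 => // N NN.
  rewrite -cReN -cReD; apply: (le_trans (normc_Re _)); rewrite normc_distC; exact: NP.
rewrite -cImN -cImD; apply: (le_trans (normc_Im _)); rewrite normc_distC; exact: NP.
Qed.

Lemma wmeas_blim (t : mi -> Cn R n -> C) g : (forall p, borelC (t p)) ->
  (forall z, sigma z != 0 -> blim (t ^~ z) (g z)) -> wmeas g.
Proof.
move=> bt tg.
have cv z : forall e : R, 0 < e -> exists N0, forall N, (N0 <= N)%N ->
    normc (bsum N (t ^~ z) * Complex (sigma z) 0 - g z * Complex (sigma z) 0) <= e.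
  move=> e e0; have [s0|s0] := eqVneq (sigma z) 0.
    exists 0 => N _; rewrite s0 (_ : Complex 0 0 = 0) // !mulr0 subrr normc0; exact: ltW.
  have s1 : 0 < normc (Complex (sigma z) 0) by rewrite normcR normr_gt0.
  have [N0 NP] := tg z s0 _ (divr_gt0 e0 s1); exists N0 => N NN.
  by rewrite -mulrBl normcM -ler_pdivlMr // ltW // NP.
have bb N : borelC (fun z => bsum N (t ^~ z) * Complex (sigma z) 0).
  by apply: borelCM; [exact: borelC_bsum|exact: borelC_sigma].
split => d T u mu_.
  apply: (@measurable_fun_cvg _ _ _ setT (fun N s => complex.Re (bsum N (t ^~ (toz (u^~ s))) * Complex (sigma (toz (u^~ s))) 0))).
    by move=> N; have [b _] := bb N; exact: b.
  by move=> s _; have [] := normc_cvgR (cv (toz (u^~ s))).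
apply: (@measurable_fun_cvg _ _ _ setT (fun N s => complex.Im (bsum N (t ^~ (toz (u^~ s))) * Complex (sigma (toz (u^~ s))) 0))).
  by move=> N; have [_ b] := bb N; exact: b.
by move=> s _; have [] := normc_cvgR (cv (toz (u^~ s))).
Qed.

Section Projection.
Variables (a : mi -> C) (l p : mi) (g : Cn R n -> C).
Hypothesis gl : forall z, sigma z != 0 -> blim (fun q => tterm a l q z) (g z).
Hypothesis gs : forall z, sigma z != 0 -> exists U, forall N, bsum N (fun q => normc (tterm a l q z)) <= U.

Definition rouv N (k : mi) (j : 'I_n) : C := rou N ^+ k j.

Lemma normc_rouv N k j : normc (rouv N k j) = 1.
Proof. by rewrite normcX normc_rou expr1n. Qed.

(** The first product is the conjugate character of [p]; the second turns the weight $u^{q-l}$ of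
    the differentiated terms back into $u^q$. *)
Definition chi N (k : mi) : C := (\prod_j (rou N ^+ p j)^-1 ^+ k j) * \prod_j rouv N k j ^+ l j.

Lemma normc_chi N k : normc (chi N k) = 1.
Proof.
rewrite normcM !normc_prod !big1 ?mulr1 // => j _; first by rewrite normcX normc_rouv expr1n.
by rewrite normcX -exprVn normcX normcV normc_rou invr1 !expr1n.
Qed.

(* Averaging [g] over the rotations by N-th roots of unity against the character of [p] extracts,
   up to aliasing, the [p]-th term of the series. *)
Definition gavg N z : C := (N%:R ^+ n)^-1 * bsum N (fun k => chi N k * g (rotz (rouv N k) z)).

Lemma wmeas_g : wmeas g.
Proof. by apply: (wmeas_blim _ gl) => q; exact: borelC_tterm. Qed.

(** On the truncation to the box the average is exact. Rotations preserve the moduli of the terms,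
    so one tail bound at [z] serves all rotated points. *)
Lemma gavg_lim z : sigma z != 0 -> forall e : R, 0 < e -> exists N0, forall N, (N0 <= N)%N ->
  normc (gavg N z - tterm a l p z) <= e.
Proof.
move=> sz e e0; have [U UP] := gs sz.
have [N1 N10 N1P] := bounded_bsum_tail (fun q => normc_ge0 (tterm a l q z)) UP e0.
have [N2 N20 N2P] := exists_inbox p.
exists (maxn N1 N2) => N; rewrite geq_max => /andP[NN1 NN2].
have N0 : (0 < N)%N by exact: leq_trans N10 NN1.
have NC : (N%:R : C) ^+ n != 0 by rewrite expf_neq0 // pnatr_eq0 -lt0n.
have NR : 0 < (N%:R : R) ^+ n by rewrite exprn_gt0 // ltr0n.
have cN : normc ((N%:R : C) ^+ n) = N%:R ^+ n by rewrite normcX normcR_nat.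
have := @rou_box_average R n N (fun=> 1) (fun q => tterm a l q z) p N0 (inbox_leq NN2 N2P).
rewrite [X in _ * (_ * X)]big1 ?mulr1; last by move=> j _; rewrite expr1n.
move=> hE.
have -> : tterm a l p z = (N%:R ^+ n)^-1 * bsum N (fun k => (\prod_j (rou N ^+ p j)^-1 ^+ k j) *
   bsum N (fun q => tterm a l q z * \prod_j (1 * rou N ^+ k j) ^+ q j)).
  by rewrite hE mulKf.
rewrite /gavg -mulrBr -bsumB normcM normcV cN mulrC ler_pdivrMr //.
apply: (le_trans (normc_bsum _ _)).
apply: (@le_trans _ _ (bsum N (fun _ : mi => e))); last first.
  by rewrite /bsum sumr_const card_ffun !card_ord -(mulr_natr e) natrX.
apply: le_bsum => k _; rewrite -mulrA -mulrBr normcM.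
rewrite (_ : normc (\prod_j _) = 1) ?mul1r; last first.
  by rewrite normc_prod big1 // => j _; rewrite normcX -exprVn normcX normcV normc_rou invr1 !expr1n.
pose t q := tterm a l q z * \prod_j rouv N k j ^+ q j.
rewrite (_ : bsum N _ = bsum N t); last first.
  by apply: eq_bsum => q _; congr (_ * _); apply: eq_bigr => j _; rewrite mul1r.
have tl : blim t ((\prod_j rouv N k j ^+ l j) * g (rotz (rouv N k) z)).
  have sz' : sigma (rotz (rouv N k) z) != 0 by rewrite sigma_rot // => j; exact: normc_rouv.
  by apply: (eq_blim _ (blimZ _ (gl sz'))) => q; rewrite tterm_rot.
have tn q : normc (t q) <= normc (tterm a l q z).
  rewrite normcM (_ : normc (\prod_j _) = 1) ?mulr1 // normc_prod big1 // => j _.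
  by rewrite normcX normc_rouv expr1n.
by apply: (blim_tail N0 tl tn) => M NM; exact: N1P.
Qed.

Lemma wmeas_gavg N : wmeas (gavg N).
Proof.
have wz v w : wmeas v -> wmeas (fun z => w * v z).
  by move=> bv; have := wmeas_lin w 0 bv bv; congr wmeas; apply/funext => z; rewrite mul0r addr0.
apply: wz; rewrite /bsum; move: (index_enum _) => s; elim: s => [|k s IH].
  rewrite (_ : (fun z => _) = fun=> 0); last by apply/funext => z; rewrite big_nil.
  by apply: borelC_wmeas => //; exact: borelC_cst.
have bh : wmeas (fun z => g (rotz (rouv N (fun j => nat_of_ord (k j))) z)).
  by apply: wmeas_rotz => //; [move=> j; exact: normc_rouv|exact: wmeas_g].
have := wmeas_lin (chi N (fun j => nat_of_ord (k j))) 1 bh IH; congr wmeas; apply/funext => z.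
by rewrite big_cons mul1r.
Qed.

(** Convexity bounds the squared average by the average of squares, and rotation invariance makes
    each of the averaged integrals equal to [NS g]. *)
Lemma wnorm2_gavg N : (0 < N)%N -> (NS (gavg N) <= NS g)%E.
Proof.
move=> N_gt0; pose I := {ffun 'I_n -> 'I_N}; pose ev (k : I) : mi := fun j => nat_of_ord (k j).
pose c : R := (N%:R ^+ n)^-1; have c0 : 0 <= c by rewrite invr_ge0 exprn_ge0.
have cI : #|I|%:R * c = 1 by rewrite card_ffun !card_ord natrX divff // expf_neq0 // pnatr_eq0 -lt0n.
pose h k := fun z => g (rotz (rouv N (ev k)) z).
have bh k : wmeas (h k) by apply: wmeas_rotz => //; [move=> j; exact: normc_rouv|exact: wmeas_g].
pose G k (x : nat -> R) := (cabs2 (h k (toz x)) * sigma (toz x) ^+ 2)%:E.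
have G0 k x : (0 <= G k x)%E by rewrite lee_fin weighted_ge0.
have bG k : borel (G k) by exact: borelR_EFin (wmeas_borelR (bh k)).
have [sE sB] := iter_int_sum (index_enum I) n.*2 (fun=> 0) G0 bG.
have wg : wmeas (gavg N) by exact: wmeas_gavg.
have hle : (NS (gavg N) <= iter_int n.*2 (fun x => c%:E * \sum_(k : I) G k x) (fun=> 0%R))%E.
  rewrite /wnorm2 intCnE; apply: le_iter_int.
  - by move=> y; rewrite lee_fin weighted_ge0.
  - exact: borelR_EFin (wmeas_borelR wg).
  - by move=> d T u mu_; apply: measurable_funeM; exact: sB.
  - move=> x; rewrite sumEFin -EFinM lee_fin -mulr_suml mulrA; apply: ler_wpM2r; first exact: sqr_ge0.
    rewrite /gavg cabs2M (_ : cabs2 (N%:R ^+ n)^-1 = c * c); last first.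
      by rewrite cabs2E normcV normcX normcR_nat expr2.
    rewrite -mulrA; apply: ler_wpM2l => //.
    rewrite -[leRHS]mul1r -cI (mulrC _ c) -mulrA; apply: ler_wpM2l => //.
    apply: (le_trans (cabs2_sum_le _)); rewrite le_eqVlt; apply/orP; left; apply/eqP; congr (_ * _).
    by apply: eq_bigr => k _; rewrite cabs2M cabs2E normc_chi expr1n mul1r.
apply: (le_trans hle); rewrite iter_intZ //; last first.
  by move=> y; apply: sume_ge0 => k _; exact: G0.
rewrite sE (eq_bigr (fun=> NS g)); last first.
  move=> k _; rewrite -[RHS](@wnorm2_rotz _ _ sigma sigma_rot (rouv N (ev k)) g) //; last exact: wmeas_g.
  by move=> j; exact: normc_rouv.
have [->|/eqP fin] := eqVneq (NS g) +oo%E; first exact: leey.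
have gfin : NS g \is a fin_num by rewrite ge0_fin_numE ?wnorm2_ge0 // ltey; exact/eqP.
rewrite -(fineK gfin) sumEFin -EFinM lee_fin sumr_const -(mulr_natr (fine _)) mulrCA (mulrC c).
by rewrite (_ : _%:R * c = 1) ?mulr1.
Qed.

Lemma wnorm2_tterm_le : (NS (tterm a l p) <= NS g)%E.
Proof.
(* Indexed by [N.+1] because the average over an empty set of rotations is not controlled. *)
pose F N x := (cabs2 (gavg N.+1 (toz x)) * sigma (toz x) ^+ 2)%:E.
have wg N : wmeas (gavg N) by exact: wmeas_gavg.
have -> : NS (tterm a l p) = iter_int n.*2 (fun y => limn_einf (fun N => F N y)) (fun=> 0).
  rewrite /wnorm2 intCnE; congr (iter_int _ _ _); apply/funext => x.
  apply/esym; apply: (cvg_limn_einf_sup _).1.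
  apply: cvg_EFin; first exact: nearW.
  have [s0|s0] := eqVneq (sigma (toz x)) 0.
    rewrite s0 expr0n mulr0 (_ : _ \o _ = fun=> 0); first exact: cvg_cst.
    by apply/funext => N; rewrite /= s0 expr0n mulr0.
  have [N|c1 c2] := @normc_cvgR (fun N => gavg N.+1 (toz x)) (tterm a l p (toz x)).
    by move=> e0; have [N0 NP] := gavg_lim s0 e0; exists N0 => M NM; apply: NP; exact: leqW.
  apply: cvgMl; apply: cvgD; rewrite expr2.
    exact: cvgM.
  exact: cvgM.
apply: (le_trans (fatou_iter_int _ _ _ _)).
- by move=> N y; rewrite lee_fin weighted_ge0.
- by move=> N; exact: borelR_EFin (wmeas_borelR (wg _)).
rewrite -(cvg_limn_einf_sup (cvg_cst (NS g))).1; apply: le_limn_einf => N.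
exact: wnorm2_gavg.
Qed.

End Projection.

End MonomialProjection.

(** * The Dirichlet norm and inner products with monomials *)

Section DirichletNorm.
Context {R : realType} {n : nat}.
Local Notation C := R[i].
Local Notation mi := ('I_n -> nat).
Variables (sigma : Cn R n -> R) (D : set R) (m : nat).
Hypothesis bsigma : borelR sigma.
Hypothesis sigma_rot : forall u z, (forall j, normc (u j) = 1) -> sigma (rotz u z) = sigma z.
Hypothesis D_gt0 : forall r, D r -> 0 < r.
Hypothesis D_neq0 : exists r, D r.
Hypothesis sigma_supp : forall z, sigma z != 0 -> exists2 r, D r & cnorm2 z < r ^+ 2.
Local Notation NS := (wnorm2 sigma).
Local Notation Nd := (dir_norm2 m NS).

(** [D] is the set of admissible radii: a single radius for a ball, all positive ones for $\mathbb
    C^n$. This treats both spaces at once. *)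
Definition PS f (a : mi -> C) := forall r, D r -> PSon r f a.

(** [g] is the termwise [l]-th derivative of the series [a] where the weight lives. Every summand of
    the Dirichlet norm has this form, the truncated part with [l = 0]. *)
Definition rep (g : Cn R n -> C) (a : mi -> C) (l : mi) := forall z, sigma z != 0 ->
  blim (fun p => tterm a l p z) (g z) /\ exists U, forall N, bsum N (fun p => normc (tterm a l p z)) <= U.

Lemma rep_wmeas g a l : rep g a l -> wmeas sigma g.
Proof.
move=> ga; apply: (wmeas_blim bsigma (t := tterm a l)) => [q|z /ga[]//]; exact: borelC_tterm.
Qed.

Lemma rep_eq g h a l : rep g a l -> rep h a l -> NS g = NS h.
Proof.
by move=> ga ha; apply: wnorm2_eq => z sz; have [g1 _] := ga z sz; have [h1 _] := ha z sz; apply: blim_unique h1.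
Qed.

Definition single (p : mi) (c : C) : mi -> C := fun q => if `[< q = p >] then c else 0.

Lemma tterm_single a l p q z : q <> p -> tterm (single p (a p)) l q z = 0.
Proof. by move=> qp; rewrite /tterm /single; case: asboolP => // _; rewrite mul0r. Qed.

Lemma tterm_single_eq a l p z : tterm (single p (a p)) l p z = tterm a l p z.
Proof. by rewrite /tterm /single; case: asboolP. Qed.

Lemma rep_le g h a l p : rep g a l -> rep h (single p (a p)) l -> (NS h <= NS g)%E.
Proof.
move=> ga ha.
have -> : NS h = NS (tterm a l p).
  apply: wnorm2_eq => z sz; have [h1 _] := ha z sz; apply: blim_unique h1 _.
  by have := blim_single (fun q => @tterm_single a l p q z); rewrite tterm_single_eq.
by apply: wnorm2_tterm_le => // z /ga[].
Qed.

Lemma PS_Dmulti f a l : PS f a -> rep (Dmulti l f) a l.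
Proof.
move=> fa z sz; have [r Dr zr] := sigma_supp sz.
by split; [exact: PSon_Dmulti (fa r Dr) zr|exact: PSon_summable (fa r Dr) zr].
Qed.

Lemma PS_tcoef f a : PS f a -> tcoef f = a.
Proof. by have [r Dr] := D_neq0; move=> fa; apply: PSon_tcoef (fa r Dr); exact: D_gt0. Qed.

Definition low (a : mi -> C) : mi -> C := fun p => if (mabs p < m)%N then a p else 0.

Lemma mabs_inbox (p : mi) : (mabs p < m)%N -> inbox m p.
Proof.
move=> pm; apply/forallP => j; apply: leq_ltn_trans pm.
by rewrite /mabs (bigD1 j) //= leq_addr.
Qed.

Lemma trunc_bsum f a z : PS f a -> trunc m f z = bsum m (fun p => low a p * mono p z).
Proof.
move=> fa; rewrite /trunc /bsum big_mkcond /=; apply: eq_bigr => q _; rewrite /low.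
by case: ifP => _; rewrite ?mul0r // -(PS_tcoef fa).
Qed.

Lemma PS_trunc f a : PS f a -> PS (trunc m f) (low a).
Proof.
move=> fa r Dr rho rho0 rhor; have [[A AP] _] := fa r Dr rho rho0 rhor; split.
  exists A => p; rewrite /low; case: ifP => // _.
  by rewrite normc0 mul0r; apply: le_trans (AP p); rewrite mulr_ge0 ?normc_ge0 // rpow_ge0 // => j; exact: ltW.
(* Boxes of side at least [m] contain all indices with $|p|<m$; the 1 keeps the box nonempty when
   [m = 0]. *)
move=> w _ e e0; exists (maxn m 1) => N; rewrite geq_max => /andP[mN N0].
rewrite (trunc_bsum w fa).
suff -> : bsum N (fun p => low a p * mono p w) = bsum m (fun p => low a p * mono p w) by rewrite subrr normc0.
have [m0|m0] := posnP m.
  by rewrite /bsum [LHS]big1 ?[RHS]big1 // => q _; rewrite /low [X in (_ < X)%N]m0 ltn0 mul0r.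
apply: bsum_widen => // p pm; rewrite /low; case: ifP => [/mabs_inbox pm'|_]; last by rewrite mul0r.
by rewrite pm' in pm.
Qed.

Lemma Dmulti0 (f : Cn R n -> C) : Dmulti (fun=> 0%N) f = f.
Proof. by rewrite /Dmulti; elim: (enum _) => //= j s ->. Qed.

Lemma rep_trunc f a : PS f a -> rep (trunc m f) (low a) (fun=> 0%N).
Proof. by move=> fa; rewrite -[trunc m f]Dmulti0; exact: PS_Dmulti (PS_trunc fa). Qed.

Lemma PS_lin f g a b c d : PS f a -> PS g b ->
  PS (fun z => c * f z + d * g z) (fun p => c * a p + d * b p).
Proof. by move=> fa gb r Dr; apply: PSonD; [exact: fa|exact: gb]. Qed.

Lemma rep_lin g h a b l c d : rep g a l -> rep h b l ->
  rep (fun z => c * g z + d * h z) (fun p => c * a p + d * b p) l.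
Proof.
move=> ga hb z sz; have [g1 [U UP]] := ga z sz; have [h1 [V VP]] := hb z sz.
have tE p : c * tterm a l p z + d * tterm b l p z = tterm (fun p => c * a p + d * b p) l p z.
  by rewrite /tterm; ring.
split; first by apply: (eq_blim tE); apply: blimD; exact: blimZ.
exists (normc c * U + normc d * V) => N.
apply: (@le_trans _ _ (normc c * bsum N (fun p => normc (tterm a l p z)) + normc d * bsum N (fun p => normc (tterm b l p z)))).
  rewrite -!bsumZR -bsumD; apply: le_bsum => p _.
  by rewrite -tE; apply: (le_trans (normcD _ _)); rewrite !normcM.
by apply: lerD; apply: ler_wpM2l; rewrite ?normc_ge0.
Qed.

Lemma low_lin a b c d : low (fun p => c * a p + d * b p) = fun p => c * low a p + d * low b p.
Proof. by apply/funext => p; rewrite /low; case: ifP => _ //; rewrite !mulr0 addr0. Qed.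

Lemma low_single a p : low (single p (a p)) = single p (low a p).
Proof.
by apply/funext => q; rewrite /low /single; case: asboolP => [->|_] //; rewrite if_same.
Qed.

Lemma PS_single p c : PS (fun z => c * mono p z) (single p c).
Proof. by move=> r _; exact: PSon_mono. Qed.

Local Notation coefw l := ((m`!)%:R / (mfact l)%:R : R).

Lemma coefw_ge0 (l : mi) : 0 <= coefw l.
Proof. by rewrite divr_ge0 ?ler0n. Qed.

Lemma Nd_ge0 f : (0 <= Nd f)%E.
Proof.
apply: adde_ge0; first exact: wnorm2_ge0.
by apply: sume_ge0 => l _; apply: mule_ge0; [rewrite lee_fin coefw_ge0|exact: wnorm2_ge0].
Qed.

(** Selecting one monomial commutes with truncation and differentiation, so the comparison holds for
    each summand of the norm separately. *)
Lemma Nd_single_le f a p : PS f a -> (Nd (fun z => (a p * mono p z)%R) <= Nd f)%E.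
Proof.
move=> fa; apply: leeD.
  apply: (rep_le (p := p) (rep_trunc fa)).
  by rewrite -low_single; apply: rep_trunc; exact: PS_single.
apply: lee_sum => l _; apply: lee_wpmul2l; first by rewrite lee_fin coefw_ge0.
by apply: (rep_le (p := p) (PS_Dmulti _ fa)); apply: PS_Dmulti; exact: PS_single.
Qed.

Lemma NdZ f a c : PS f a -> Nd (fun z => (c * f z)%R) = ((cabs2 c)%:E * Nd f)%E.
Proof.
move=> fa.
have key g h b l : rep g b l -> rep h (fun p => c * b p) l -> NS h = ((cabs2 c)%:E * NS g)%E.
  move=> gb hb; rewrite -(wnorm2Z c (rep_wmeas gb)); apply: rep_eq hb _.
  have := rep_lin c 0 gb gb; congr rep.
    by apply/funext => z; rewrite mul0r addr0.
  by apply/funext => z; rewrite mul0r addr0.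
have cf : PS (fun z => c * f z) (fun p => c * a p).
  have := PS_lin c 0 fa fa; congr PS.
    by apply/funext => z; rewrite mul0r addr0.
  by apply/funext => z; rewrite mul0r addr0.
have lowZ : low (fun p => c * a p) = fun p => c * low a p.
  by apply/funext => p; rewrite /low; case: ifP => _ //; rewrite mulr0.
have tcf := rep_trunc cf; rewrite lowZ in tcf.
rewrite /dir_norm2 ge0_muleDr ?wnorm2_ge0 //; last first.
  by apply: sume_ge0 => l _; apply: mule_ge0; [rewrite lee_fin coefw_ge0|exact: wnorm2_ge0].
rewrite (key _ _ _ _ (rep_trunc fa) tcf); congr (_ + _)%E.
rewrite ge0_sume_distrr; last first.
  by move=> l _; apply: mule_ge0; [rewrite lee_fin coefw_ge0|exact: wnorm2_ge0].
apply: eq_bigr => l _; rewrite muleCA; congr (_ * _)%E.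
by apply: key (PS_Dmulti _ fa) _; exact: PS_Dmulti.
Qed.

Lemma Nd_parallelogram f g a b : PS f a -> PS g b ->
  (Nd (fun z => (f z + g z)%R) + Nd (fun z => (f z - g z)%R) = 2%:E * Nd f + 2%:E * Nd g)%E.
Proof.
move=> fa gb.
have key u v s t c d l : rep u c l -> rep v d l -> rep s (fun p => 1 * c p + 1 * d p) l ->
    rep t (fun p => 1 * c p + (-1) * d p) l -> (NS s + NS t = 2%:E * NS u + 2%:E * NS v)%E.
  move=> uc vd scd tcd; rewrite -(wnorm2_parallelogram (rep_wmeas uc) (rep_wmeas vd)).
  congr (_ + _)%E.
    apply: rep_eq scd _; have := rep_lin 1 1 uc vd; congr rep.
    by apply/funext => z; rewrite !mul1r.
  apply: rep_eq tcd _; have := rep_lin 1 (-1) uc vd; congr rep.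
  by apply/funext => z; rewrite mul1r mulN1r.
have fg : PS (fun z => f z + g z) (fun p => 1 * a p + 1 * b p).
  by have := PS_lin 1 1 fa gb; congr PS; apply/funext => z; rewrite !mul1r.
have fg' : PS (fun z => f z - g z) (fun p => 1 * a p + (-1) * b p).
  by have := PS_lin 1 (-1) fa gb; congr PS; apply/funext => z; rewrite mul1r mulN1r.
have t1 := rep_trunc fg; have t2 := rep_trunc fg'; rewrite !low_lin in t1 t2.
have ge0 h : (0 <= \sum_(l : {ffun 'I_n -> 'I_m.+1} | mabs (fun j => nat_of_ord (l j)) == m)
     ((m`!)%:R / (mfact (fun j => nat_of_ord (l j)))%:R)%:E * NS (Dmulti (fun j => nat_of_ord (l j)) h))%E.
  by apply: sume_ge0 => l _; apply: mule_ge0; [rewrite lee_fin coefw_ge0|exact: wnorm2_ge0].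
rewrite /dir_norm2 addeACA (key _ _ _ _ _ _ _ (rep_trunc fa) (rep_trunc gb) t1 t2).
rewrite !ge0_muleDr ?wnorm2_ge0 ?ge0 // [RHS]addeACA; congr (_ + _)%E.
rewrite !ge0_sume_distrr; try by [move=> l _; apply: mule_ge0; [rewrite lee_fin coefw_ge0|exact: wnorm2_ge0]].
rewrite -!big_split /=; apply: eq_bigr => l _.
rewrite -ge0_muleDr ?wnorm2_ge0 // !(muleCA 2%:E) -ge0_muleDr ?mule_ge0 ?wnorm2_ge0 ?lee_fin //.
congr (_ * _)%E; exact: key (PS_Dmulti _ fa) (PS_Dmulti _ gb) (PS_Dmulti _ fg) (PS_Dmulti _ fg').
Qed.

Hypothesis fin_mono : forall p, (Nd (mono p) < +oo)%E.

Definition mono_norm2 p : R := fine (Nd (mono p)).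

(** A nonzero value would be doubled indefinitely along $2^kx$. *)
Lemma doubling_bounded (d : C -> R) (B : R) : (forall x, d (2 * x) = 2 * d x) -> (forall x, `|d x| <= B) ->
  forall x, d x = 0.
Proof.
move=> d2 dB x; apply/eqP; apply: contraT; rewrite -normr_gt0 => dx.
have dk k : d (2 ^+ k * x) = 2 ^+ k * d x.
  by elim: k => [|k IH]; rewrite ?expr0 ?mul1r // !exprS -!mulrA d2 IH.
have B0 : 0 <= B by apply: le_trans (dB 0); exact: normr_ge0.
have := archi_boundP (divr_ge0 B0 (ltW dx)); set k := Num.bound _ => kB.
have k2 : (k%:R : R) <= 2 ^+ k by rewrite -natrX ler_nat ltnW // ltn_expl.
have := dB (2 ^+ k * x); rewrite dk normrM ger0_norm ?exprn_ge0 // => h.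
by move: kB; rewrite ltr_pdivrMr // ltNge (le_trans _ h) // ler_wpM2r // ltW.
Qed.

Lemma Nd_single c p : Nd (fun z => (c * mono p z)%R) = (cabs2 c * mono_norm2 p)%:E.
Proof.
have PSm : PS (mono p) (single p 1).
  by have := PS_single p 1; congr PS; apply/funext => z; rewrite mul1r.
rewrite (NdZ c PSm) EFinM /mono_norm2 fineK // ge0_fin_numE ?Nd_ge0 //.
Qed.

(* With u = c z^p, the parallelogram law makes the cross term |u + h|^2 - |u - h|^2 additive under
   doubling of c, while [Nd_single_le] bounds it independently of c; hence it vanishes. *)
Lemma Nd_add_single h b p c : PS h b -> b p = 0 -> (Nd h < +oo)%E ->
  Nd (fun z => (c * mono p z + h z)%R) = (cabs2 c * mono_norm2 p + fine (Nd h))%:E.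
Proof.
move=> hb bp hfin.
have hF : Nd h = (fine (Nd h))%:E by rewrite fineK // ge0_fin_numE ?Nd_ge0.
set eta := fine (Nd h); rewrite -/eta in hF.
pose u c z : C := c * mono p z; pose P c := Nd (fun z => u c z + h z); pose M c := Nd (fun z => u c z - h z).
have PMs x : (P x + M x = (2 * (cabs2 x * mono_norm2 p) + 2 * eta)%:E)%E.
  by rewrite (Nd_parallelogram (PS_single p x) hb) Nd_single hF -!EFinM -EFinD.
have PMfin x : P x \is a fin_num /\ M x \is a fin_num.
  have : (P x + M x < +oo)%E by rewrite PMs ltry.
  by move=> h0; split; rewrite ge0_fin_numE ?Nd_ge0 //; apply: le_lt_trans h0;
    [rewrite leeDl|rewrite leeDr] => //; exact: Nd_ge0.
pose Pr x := fine (P x); pose Mr x := fine (M x).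
have PE x : P x = (Pr x)%:E by have [f1 _] := PMfin x; rewrite fineK.
have ME x : M x = (Mr x)%:E by have [_ f1] := PMfin x; rewrite fineK.
have sumr x : Pr x + Mr x = 2 * (cabs2 x * mono_norm2 p) + 2 * eta.
  by have := PMs x; rewrite PE ME -EFinD => -[].
have geP x : cabs2 x * mono_norm2 p <= Pr x.
  rewrite -lee_fin -PE -Nd_single.
  have PSu : PS (fun z => u x z + h z) (fun q => 1 * single p x q + 1 * b q).
    by have := PS_lin 1 1 (PS_single p x) hb; congr PS; apply/funext => z; rewrite !mul1r.
  have := Nd_single_le p PSu; rewrite {1}/single.
  by case: asboolP => // _; rewrite bp mulr0 addr0 mul1r.
have geM x : cabs2 x * mono_norm2 p <= Mr x.
  rewrite -lee_fin -ME -Nd_single.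
  have PSu : PS (fun z => u x z - h z) (fun q => 1 * single p x q + (-1) * b q).
    by have := PS_lin 1 (-1) (PS_single p x) hb; congr PS; apply/funext => z; rewrite mul1r mulN1r.
  have := Nd_single_le p PSu; rewrite {1}/single.
  by case: asboolP => // _; rewrite bp mulr0 addr0 mul1r.
(* Parallelogram law for [u x + h] and [u x]: their sum is [u (2 * x) + h] and their difference is
   [h]. *)
have P2 x : Pr (2 * x) + eta = 2 * Pr x + 2 * (cabs2 x * mono_norm2 p).
  have PSu : PS (fun z => u x z + h z) (fun q => 1 * single p x q + 1 * b q).
    by have := PS_lin 1 1 (PS_single p x) hb; congr PS; apply/funext => z; rewrite !mul1r.
  have := Nd_parallelogram PSu (PS_single p x).
  rewrite (_ : (fun z => _ + _ + _) = fun z => u (2 * x) z + h z); last first.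
    by apply/funext => z; rewrite /u; ring.
  rewrite (_ : (fun z => _ + _ - _) = h); last by apply/funext => z; rewrite /u; ring.
  by rewrite -/(P _) -/(P _) !PE hF Nd_single -!EFinM -!EFinD => -[].
have M2 x : Mr (2 * x) + eta = 2 * Mr x + 2 * (cabs2 x * mono_norm2 p).
  have PSu : PS (fun z => u x z - h z) (fun q => 1 * single p x q + (-1) * b q).
    by have := PS_lin 1 (-1) (PS_single p x) hb; congr PS; apply/funext => z; rewrite mul1r mulN1r.
  have := Nd_parallelogram (PS_single p x) PSu.
  rewrite (_ : (fun z => _ + (_ - _)) = fun z => u (2 * x) z - h z); last first.
    by apply/funext => z; rewrite /u; ring.
  rewrite (_ : (fun z => _ - (_ - _)) = h); last by apply/funext => z; rewrite /u; ring.
  rewrite -/(M _) -/(M _) !ME hF Nd_single -!EFinM -!EFinD => -[]; lra.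
(* [Pr x] and [Mr x] are each at least $\|xz^p\|^2$ and add up to $2\|xz^p\|^2+2\eta$, so they
   differ by at most $2\eta$, independently of [x]. *)
have d0 := @doubling_bounded (fun x => Pr x - Mr x) (2 * eta) _ _ c.
rewrite -/(P c) PE; congr EFin; have := sumr c.
have -> : Pr c = Mr c.
  apply/eqP; rewrite -subr_eq0 d0 // => x; first by have := P2 x; have := M2 x; lra.
  by rewrite ler_norml; have := sumr x; have := geP x; have := geM x; move=> *; apply/andP; split; lra.
lra.
Qed.

(** Since $\sum_k i^k=0$, the constant [eta] and the terms independent of $i^k$ cancel, leaving the
    cross term. *)
Lemma polarization (b : C) (c eta : R) :
  4^-1 * \sum_(k < 4) iC ^+ k * Complex (cabs2 (1 + iC ^+ k * b) * c + eta) 0 = conjc b * Complex c 0 :> C.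
Proof.
have n4 : (4 : C) != 0 by rewrite pnatr_eq0.
apply: (mulfI n4); rewrite mulVKf //.
have i2 : (iC : C) ^+ 2 = -1 by rewrite expr2; apply: complexP => /=; ring.
have i3 : (iC : C) ^+ 3 = - iC by rewrite exprS i2 mulrN1.
rewrite !big_ord_recr big_ord0 /= i2 i3 expr0 expr1 add0r.
case: b => x y.
have -> : (4 : C) = Complex 4 0 by rewrite -[RHS]/(real_complex R 4%:R) rmorph_nat.
apply: complexP; rewrite /iC /cabs2 ?(cReD, cImD, cReM, cImM, cReN, cImN) /=; ring.
Qed.

(** Write $g=b_pz^p+h$ with [h] free of $z^p$: each norm in the polarization sum becomes
    $|1+i^kb_p|^2\|z^p\|^2+\|h\|^2$. *)
Lemma ip_mono g b p : PS g b -> (Nd g < +oo)%E -> ip Nd (mono p) g = conjc (b p) * Complex (mono_norm2 p) 0.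
Proof.
move=> gb gfin.
pose h z : C := g z - b p * mono p z; pose d q : C := 1 * b q + (-1) * single p (b p) q.
have hd : PS h d.
  by have := PS_lin 1 (-1) gb (PS_single p (b p)); congr PS; apply/funext => z; rewrite mul1r mulN1r.
have dp : d p = 0 by rewrite /d /single; case: asboolP => // _; ring.
(* Finiteness is read off the parallelogram law, whose right-hand side is finite. *)
have hfin : (Nd h < +oo)%E.
  have := Nd_parallelogram gb (PS_single p (b p)); rewrite -/h => hE.
  apply: (@le_lt_trans _ _ (Nd (fun z => (g z + b p * mono p z)%R) + Nd h)%E); first by rewrite leeDr ?Nd_ge0.
  by rewrite hE Nd_single -EFinM lte_add_pinfty ?ltry // lte_mul_pinfty.
rewrite -(polarization (b p) (mono_norm2 p) (fine (Nd h))) /ip; congr (_ * _); apply: eq_bigr => k _.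
congr (_ * Complex _ _).
have kh : PS (fun z => iC ^+ k * h z) (fun q => iC ^+ k * d q + 0 * d q).
  have := PS_lin (iC ^+ k) 0 hd hd; congr PS; apply/funext => z; by rewrite mul0r addr0.
have kN : Nd (fun z => (iC ^+ k * h z)%R) = Nd h.
  rewrite (NdZ _ hd) (_ : cabs2 _ = 1) ?mul1e //.
  by rewrite cabs2E normcX (_ : normc iC = 1) ?expr1n // /normc /= expr0n expr1n add0r sqrtr1.
rewrite (_ : (fun z => _) = fun z => (1 + iC ^+ k * b p) * mono p z + iC ^+ k * h z); last first.
  by apply/funext => z; rewrite /h; ring.
rewrite (Nd_add_single _ kh) ?kN //.
by rewrite dp !mulr0 addr0.
Qed.

End DirichletNorm.

Section MonomialHolomorphic.
Context {R : realType} {n : nat}.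
Local Notation C := R[i].
Local Notation mi := ('I_n -> nat).

Lemma differentiable_mono (p : mi) (z : Cn R n) : differentiable (toCo (mono p)) z.
Proof.
have D1 j k : differentiable ((fun w : Cn R n => w 0 j ^+ k) : Cn R n -> C^o) z.
  elim: k => [|k IH].
    by rewrite (_ : (fun w => _) = cst (1 : C^o)) //; exact: differentiable_cst.
  rewrite (_ : (fun w => _) = ((fun w : Cn R n => w 0 j : C^o) * (fun w => w 0 j ^+ k))%R); last first.
    by apply/funext => w; rewrite exprS.
  by apply: differentiableM => //; exact: differentiable_coord.
rewrite /toCo /mono; move: (index_enum _) => s; elim: s => [|j s IH].
  rewrite (_ : (fun w => _) = cst (1 : C^o)); first exact: differentiable_cst.
  by apply/funext => w; rewrite big_nil.
rewrite (_ : (fun w => _) = ((fun w : Cn R n => w 0 j ^+ p j : C^o) * (fun w => \prod_(j <- s) w 0 j ^+ p j))%R).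
  by apply: differentiableM.
by apply/funext => w; rewrite big_cons.
Qed.

Lemma normc_conjc (x : C) : normc (conjc x) = normc x.
Proof. by case: x => a b; rewrite /normc /= sqrrN. Qed.

End MonomialHolomorphic.

(** * Taylor coefficients of a reproducing kernel *)

Section KernelSeries.
Context {R : realType} {n : nat}.
Local Notation C := R[i].
Local Notation mi := ('I_n -> nat).
Variables (sigma : Cn R n -> R) (D : set R) (m : nat) (U : set (Cn R n)) (K : Cn R n -> Cn R n -> C).
Hypothesis bsigma : borelR sigma.
Hypothesis sigma_rot : forall u z, (forall j, normc (u j) = 1) -> sigma (rotz u z) = sigma z.
Hypothesis D_gt0 : forall r, D r -> 0 < r.
Hypothesis D_neq0 : exists r, D r.
Hypothesis sigma_supp : forall z, sigma z != 0 -> U z.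
Hypothesis UE : forall z, U z <-> exists2 r, D r & cnorm2 z < r ^+ 2.
Local Notation Nd := (dir_norm2 m (wnorm2 sigma)).
Hypothesis fin_mono : forall p, (Nd (mono p) < +oo)%E.
Hypothesis HK : is_rkernel U Nd K.

Let supp z : sigma z != 0 -> exists2 r, D r & cnorm2 z < r ^+ 2.
Proof. by move=> /sigma_supp /UE. Qed.

Lemma holomorphic_PS f : holomorphic_on U f -> PS D f (tcoef f).
Proof.
by move=> fU r Dr; apply: holomorphic_PSon => z zr; apply: fU; apply/UE; exists r.
Qed.

(** The reproducing property tested on $z^p$. *)
Lemma kernel_coef w p : U w -> conjc (tcoef (K^~ w) p) * Complex (mono_norm2 sigma m p) 0 = mono p w.
Proof.
move=> Uw; have [[hK fK] rep] := HK Uw.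
have := rep (mono p); rewrite (ip_mono bsigma sigma_rot D_gt0 D_neq0 supp fin_mono p (holomorphic_PS hK) fK).
by move=> -> //; split => // z _; exact: differentiable_mono.
Qed.

(** A zero norm would force $w^p=0$ on all of [U] by [kernel_coef], which fails at a point with all
    coordinates positive. *)
Lemma mono_norm2_gt0 p : 0 < mono_norm2 sigma m p.
Proof.
have c0 : 0 <= mono_norm2 sigma m p by rewrite fine_ge0 // Nd_ge0.
have [r Dr] := D_neq0; have r0 := D_gt0 Dr.
(* Dividing by $n+1$ ensures $ne^2<r^2$. *)
pose e := r / (n.+1)%:R; have e0 : 0 < e by rewrite divr_gt0 // ltr0n.
pose w : Cn R n := \row_j Complex e 0.
have Uw : U w.
  apply/UE; exists r => //; rewrite cnorm2E (eq_bigr (fun=> e ^+ 2)); last first.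
    by move=> j _; rewrite mxE normcR ger0_norm // ltW.
  rewrite sumr_const card_ord -(mulr_natl (e ^+ 2)) /e expr_div_n mulrCA -[ltRHS]mulr1 ltr_pM2l ?exprn_gt0 //.
  rewrite ltr_pdivrMr ?exprn_gt0 ?ltr0n // mul1r -natrX ltr_nat.
  by rewrite (leq_trans (ltnSn n)) // -[X in (X <= _)%N]muln1 expnS leq_mul // expn1.
rewrite lt_neqAle c0 andbT; apply/eqP => c00; have := kernel_coef p Uw.
rewrite -c00 (_ : Complex 0 0 = 0) // mulr0 => /esym/eqP; rewrite /mono prodf_seq_eq0 => /hasP[j _] /=.
rewrite expf_eq0 => /andP[_]; rewrite mxE => /eqP[] ew; by move: e0; rewrite ew ltxx.
Qed.

Definition kterm p (z w : Cn R n) : C := Complex (mono_norm2 sigma m p)^-1 0 * (mono p z * conjc (mono p w)).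

Lemma tcoef_kernel w p : U w -> tcoef (K^~ w) p = Complex (mono_norm2 sigma m p)^-1 0 * conjc (mono p w).
Proof.
move=> Uw; rewrite -(kernel_coef p Uw).
have c0 := mono_norm2_gt0 p.
have cc : (Complex (mono_norm2 sigma m p) 0 : C) * Complex (mono_norm2 sigma m p)^-1 0 = 1.
  by apply: complexP; rewrite ?cReM ?cImM /= ?mulr0 ?mul0r ?subr0 ?addr0 ?mulfV // gt_eqF.
rewrite rmorphM /= conjcK oppr0.
by rewrite mulrCA (mulrC (Complex _ _)) cc mulr1.
Qed.

Lemma kernel_series z w : U z -> U w -> blim (fun p => kterm p z w) (K z w).
Proof.
move=> /UE[r Dr zr] Uw; have [[hK _] _] := HK Uw.
have := PSon_Dmulti (fun=> 0%N) (holomorphic_PS hK Dr) zr; rewrite Dmulti0.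
by apply: eq_blim => p; rewrite tterm0 tcoef_kernel // /kterm; ring.
Qed.

Lemma kernel_summable z w : U z -> U w ->
  exists B, forall N, bsum N (fun p => normc (kterm p z w)) <= B.
Proof.
move=> /UE[r Dr zr] Uw; have [[hK _] _] := HK Uw.
have [B BP] := PSon_summable (fun=> 0%N) (holomorphic_PS hK Dr) zr.
exists B => N; apply: le_trans (BP N); rewrite le_eqVlt; apply/orP; left; apply/eqP.
by apply: eq_bsum => p _; rewrite tterm0 tcoef_kernel // /kterm; congr normc; ring.
Qed.

End KernelSeries.

(** * The weights and the limit *)

Section GaussianFinite.
Context {R : realType}.
Local Notation C := R[i].

Lemma measurable_sqrt : measurable_fun setT (@Num.sqrt R).
Proof. by apply: continuous_measurable_fun; exact: sqrt_continuous. Qed.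

(** Up to a constant the integrand is the normal density of variance $1/(2a)$. *)
Lemma gauss_int (a : R) : 0 < a -> exists c : R,
  (\int[@lebesgue_measure R]_(t in [set: R]) (expR (- (a * t ^+ 2)))%:E = c%:E)%E.
Proof.
move=> a0; pose s : R := Num.sqrt (2 * a)^-1.
have s2 : s ^+ 2 = (2 * a)^-1 by rewrite sqr_sqrtr // invr_ge0 mulr_ge0 // ltW.
have s0 : s != 0 by rewrite gt_eqF // sqrtr_gt0 invr_gt0 mulr_gt0.
exists (normal_peak s)^-1.
have pk := normal_peak_gt0 s0.
have E t : expR (- (a * t ^+ 2)) = (normal_peak s)^-1 * normal_pdf 0 s t.
  rewrite /normal_pdf (negbTE s0) mulrA mulVf ?mul1r ?gt_eqF // /normal_fun subr0 s2.
  by congr expR; field; rewrite gt_eqF.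
transitivity (\int[@lebesgue_measure R]_(t in [set: R]) ((normal_peak s)^-1%:E * (normal_pdf 0 s t)%:E))%E.
  by apply: eq_integral => t _; rewrite E EFinM.
rewrite ge0_integralZl_EFin //.
- by rewrite integral_normal_pdf mule1.
- by move=> t _; rewrite lee_fin normal_pdf_ge0.
- by apply/measurable_EFinP; exact: measurable_normal_pdf.
- by rewrite invr_ge0 ltW.
Qed.

(** The first [k] coordinates are integrated and the others kept as parameters; this generality is
    what the induction needs. *)
Lemma iter_int_prod (gam : R -> R) (c : R) k N x : (forall t, 0 <= gam t) -> measurable_fun setT gam ->
  (\int[@lebesgue_measure R]_(t in [set: R]) (gam t)%:E = c%:E)%E -> (k <= N)%N ->
  iter_int k (fun y => (\prod_(0 <= i < N) gam (y i))%:E) x = (c ^+ k * \prod_(k <= i < N) gam (x i))%:E.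
Proof.
move=> g0 mg gc; elim: k x => [|k IH] x kN; first by rewrite /= expr0 mul1r.
rewrite iter_intS.
transitivity (\int[@lebesgue_measure R]_(t in [set: R])
    ((c ^+ k * \prod_(k.+1 <= i < N) gam (x i))%:E * (gam t)%:E))%E.
  apply: eq_integral => t _; rewrite IH ?(ltnW kN) // -EFinM; congr EFin.
  rewrite big_ltn // /subst eqxx -!mulrA; congr (_ * _); rewrite mulrC; congr (_ * _).
  by apply: eq_big_nat => i /andP[ki _]; rewrite gtn_eqF.
have c0 : 0 <= c by rewrite -lee_fin -gc; apply: integral_ge0 => t _; rewrite lee_fin.
rewrite ge0_integralZl_EFin //.
- by rewrite gc -EFinM exprSr; congr EFin; ring.
- by move=> t _; rewrite lee_fin.
- exact/measurable_EFinP.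
- by rewrite mulr_ge0 ?exprn_ge0 // prodr_ge0.
Qed.

(** The [k]-th power of $as/k\le e^{as/k}$. *)
Lemma pow_le_expR (a : R) k : 0 < a -> exists2 B : R, 0 <= B & forall s : R, 0 <= s -> s ^+ k <= B * expR (a * s).
Proof.
move=> a0; have [->|k0] := posnP k.
  by exists 1 => // s s0; rewrite expr0 mul1r -[leLHS]expR0 ler_expR mulr_ge0 // ltW.
have kR : 0 < (k%:R : R) by rewrite ltr0n.
exists ((k%:R / a) ^+ k) => [|s s0]; first by rewrite exprn_ge0 // divr_ge0 ?ltW.
rewrite (_ : a * s = k%:R * (a * s / k%:R)); last by field; rewrite gt_eqF.
rewrite expRM_natl -exprMn ler_pXn2r ?nnegrE ?mulr_ge0 ?divr_ge0 ?invr_ge0 ?expR_ge0 ?(ltW kR) ?(ltW a0) //.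
rewrite -ler_pdivrMl ?divr_gt0 // invf_div; apply: le_trans (expR_ge1Dx _).
by rewrite (_ : a / _ * s = a * s / k%:R) ?lerDr //; ring.

Qed.

Context {n : nat}.
Local Notation mi := ('I_n -> nat).

Lemma prod_double (f : nat -> R) k : \prod_(0 <= i < k.*2) f i = \prod_(j < k) (f j.*2 * f j.*2.+1).
Proof.
elim: k => [|k IH]; first by rewrite big_ord0 big_geq.
by rewrite doubleS !big_nat_recr //= big_ord_recr /= IH mulrA.
Qed.

Lemma expR_cnorm2 (a : R) (x : nat -> R) :
  expR (- (a * cnorm2 (toz x : Cn R n))) = \prod_(0 <= i < n.*2) expR (- (a * x i ^+ 2)).
Proof.
rewrite prod_double /cnorm2 mulr_sumr -sumrN expR_sum; apply: eq_bigr => j _.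
by rewrite -expRD mxE /cabs2 /= mulrDr opprD.
Qed.

Lemma tterm_gauss (nu : R) a l p : 0 < nu -> exists2 B : R, 0 <= B &
  forall z : Cn R n, cabs2 (tterm a l p z) <= B * expR (nu * cnorm2 z).
Proof.
move=> nu0.
have H j : {B : R | 0 <= B /\ forall x : C, cabs2 (efac (l j) (p j) x) <= B * expR (nu * cabs2 x)}.
  apply: cid; have [B B0 BP] := pow_le_expR (p j - l j) nu0.
  exists ((p j ^_ l j)%:R ^+ 2 * B); split=> [|x]; first by rewrite mulr_ge0 ?sqr_ge0.
  rewrite cabs2E normcM normcR_nat exprMn normcX -mulrA; apply: ler_wpM2l; first exact: sqr_ge0.
  by rewrite -exprM mulnC exprM -cabs2E; apply: BP; exact: cabs2_ge0.
exists (cabs2 (a p) * \prod_j sval (H j)).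
  rewrite mulr_ge0 ?cabs2_ge0 // prodr_ge0 // => j _; by have [] := svalP (H j).
move=> z; rewrite /tterm cabs2M -mulrA; apply: ler_wpM2l; first exact: cabs2_ge0.
rewrite cabs2E normc_prod -prodrXl /cnorm2 mulr_sumr expR_sum -big_split /=.
apply: ler_prod => j _; rewrite sqr_ge0 /= -cabs2E; by have [_] := svalP (H j).
Qed.

(** Half of the exponent absorbs the polynomial growth; the other half is an integrable Gaussian
    product. *)
Lemma gauss_tterm_fin (nu : R) a l p : 0 < nu ->
  (wnorm2 (fun z : Cn R n => Num.sqrt (expR (- (nu * cnorm2 z)))) (tterm a l p) < +oo)%E.
Proof.
move=> nu0; have nu2 : 0 < nu / 2 by rewrite divr_gt0.
have [B B0 BP] := tterm_gauss a l p nu2.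
have [c cE] := gauss_int nu2.
have mgam : measurable_fun setT (fun t : R => expR (- (nu / 2 * t ^+ 2))).
  apply: measurableT_comp => //; apply: measurableT_comp => //.
  by apply: measurable_funM; [exact: measurable_cst|exact: measurable_funX].
have bE : borelR (fun z : Cn R n => Num.sqrt (expR (- (nu * cnorm2 z)))).
  move=> d T u mu_; apply: (measurableT_comp measurable_sqrt).
  apply: measurableT_comp => //; apply: measurableT_comp => //.
  by apply: measurable_funM; [exact: measurable_cst|exact: borelR_cnorm2].
have bP : borel (fun y : nat -> R => (\prod_(0 <= i < n.*2) expR (- (nu / 2 * y i ^+ 2)))%:E).
  move=> d T u mu_; apply/measurable_EFinP; elim: n.*2 => [|k IH].
    by rewrite (_ : (fun t => _) = fun=> 1); [exact: measurable_cst|apply/funext => t; rewrite big_geq].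
  rewrite (_ : (fun t => _) = fun t => (\prod_(0 <= i < k) expR (- (nu / 2 * u i t ^+ 2))) * expR (- (nu / 2 * u k t ^+ 2))).
    by apply: measurable_funM => //; exact: measurableT_comp mgam (mu_ k).
  by apply/funext => t; rewrite big_nat_recr.
rewrite /wnorm2 intCnE.
apply: (@le_lt_trans _ _ (iter_int n.*2 (fun y => (B%:E * (\prod_(0 <= i < n.*2) expR (- (nu / 2 * y i ^+ 2)))%:E)%E) (fun=> 0))).
  apply: le_iter_int.
  - by move=> y; rewrite lee_fin mulr_ge0 ?cabs2_ge0 ?sqr_ge0.
  - exact: borelR_EFin (wmeas_borelR (borelC_wmeas bE (borelC_tterm a l p))).
  - by move=> d T u mu_; apply: measurable_funeM; exact: bP.
  - move=> y; rewrite -EFinM lee_fin -expR_cnorm2 sqr_sqrtr ?expR_ge0 //.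
    rewrite (_ : - (nu * _) = - (nu / 2 * cnorm2 (toz y : Cn R n)) - nu / 2 * cnorm2 (toz y : Cn R n)); last by field.
    rewrite expRD mulrCA [leRHS]mulrC; apply: ler_wpM2l; first exact: expR_ge0.
    by rewrite expRN ler_pdivrMr ?expR_gt0.
rewrite iter_intZ //; last by move=> y; rewrite lee_fin prodr_ge0 // => i _; exact: expR_ge0.
rewrite (iter_int_prod _ _ mgam cE) // -?EFinM ?ltry //.
Qed.

End GaussianFinite.

(** * Comparison of the weights *)

Section Weights.
Context {R : realType}.
Variable nu : R.
Hypothesis nu_gt0 : 0 < nu.

(** The weight as a function of $s=|z|^2$, with the cutoff built in, so that monotonicity in [r]
    also covers the growth of the ball. *)
Definition wball (r s : R) : R := if s < r ^+ 2 then (1 - s / r ^+ 2) `^ (nu * r ^+ 2) else 0.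
Definition wfock (s : R) : R := expR (- (nu * s)).

Lemma wball_ge0 r s : 0 <= wball r s.
Proof. by rewrite /wball; case: ifP => // _; exact: powR_ge0. Qed.

Lemma wballE r s : 0 < r -> s < r ^+ 2 -> wball r s = expR (nu * (r ^+ 2 * ln (1 - s / r ^+ 2))).
Proof.
move=> r0 sr; rewrite /wball sr /powR gt_eqF ?mulrA //.
by rewrite subr_gt0 ltr_pdivrMr ?exprn_gt0 // mul1r.
Qed.

Lemma wball_le_fock r s : 0 < r -> 0 <= s -> wball r s <= wfock s.
Proof.
move=> r0 s0; have [sr|sr] := ltP s (r ^+ 2); last by rewrite /wball ltNge sr /= expR_ge0.
have r2 : 0 < r ^+ 2 by rewrite exprn_gt0.
rewrite wballE // /wfock ler_expR -(mulrN nu) ler_pM2l //.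
have -> : - s = r ^+ 2 * - (s / r ^+ 2) by field; rewrite gt_eqF.
by rewrite ler_pM2l //; apply: le_ln1Dx; rewrite ltrN2 ltr_pdivrMr // mul1r.
Qed.

Lemma ln_scale (u l : R) : u < 1 -> 0 <= l <= 1 -> l * ln (1 - u) <= ln (1 - l * u).
Proof.
move=> u1 l01.
have /andP[l0 l1] := l01; have u0 : 0 < 1 - u by rewrite subr_gt0.
have := concave_ln (Itv01 l0 l1) u0 ltr01; rewrite !convRE ln1 mulr0 addr0 mulr1 /unstable.onem /=.
by congr (_ <= ln _); ring.
Qed.

(** After taking logarithms this is concavity of [ln] between $1-s/r^2$ and 1, with ratio
    $r^2/t^2$. *)
Lemma wball_mono r t s : 0 < r -> r <= t -> 0 <= s -> wball r s <= wball t s.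
Proof.
move=> r0 rt s0; have [sr|sr] := ltP s (r ^+ 2); last by rewrite {1}/wball ltNge sr /= wball_ge0.
have r2 : 0 < r ^+ 2 by rewrite exprn_gt0.
have t0 : 0 < t by exact: lt_le_trans rt.
have t2 : 0 < t ^+ 2 by rewrite exprn_gt0.
have rt2 : r ^+ 2 <= t ^+ 2 by rewrite ler_sqr ?nnegrE // ltW.
rewrite !wballE ?(lt_le_trans sr) // ler_expR ler_pM2l // -ler_pdivrMl // mulrA mulrC.
rewrite (_ : s / t ^+ 2 = (r ^+ 2 / t ^+ 2) * (s / r ^+ 2)); last by field; rewrite !gt_eqF.
rewrite (mulrC (ln _)) (mulrC _^-1); apply: ln_scale; first by rewrite ltr_pdivrMr // mul1r.
by rewrite divr_ge0 ?(ltW r2) ?(ltW t2) //= ler_pdivrMr // mul1r.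
Qed.

(** Squeezed between $\exp(-\nu s/(1-s/r^2))$ and the Gaussian: with $u=s/r^2$, the lower bound is
    $-\ln(1-u)\le u/(1-u)$. Integer radii suffice, as monotonicity fills the gaps. *)
Lemma wball_cvg s : 0 <= s -> wball k.+1%:R s @[k --> \oo] --> wfock s.
Proof.
move=> s0.
have hc : (fun k => s * (harmonic k * harmonic k) : R) @ \oo --> (0 : R).
  rewrite (_ : 0 = s * (0 * 0)); last by rewrite !mulr0.
  apply: cvgMr; apply: cvgM; exact: cvg_harmonic.
have hc' : (fun k => expR (- (nu * (s / (1 - s * (harmonic k * harmonic k)))))) @ \oo --> wfock s.
  rewrite (_ : wfock s = expR (- (nu * (s / (1 - 0))))); last by rewrite subr0 divr1.
  apply: continuous_cvg; first exact: continuous_expR.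
  apply: cvgN; apply: cvgMr; apply: cvgMr; apply: cvgV; first by rewrite subr0 oner_neq0.
  by apply: cvgB => //; exact: cvg_cst.
apply: (squeeze_cvgr _ hc'); last exact: cvg_cst.
have : \forall k \near \oo, s * (harmonic k * harmonic k) < 1.
  by apply: (cvgr_lt 0).
apply: filterS => k k1.
have k0 : 0 < k.+1%:R :> R by rewrite ltr0n.
have kE : s * (harmonic k * harmonic k) = s / k.+1%:R ^+ 2 by rewrite /harmonic /= expr2 invfM.
rewrite kE in k1 *; have k2 : 0 < k.+1%:R ^+ 2 :> R by rewrite exprn_gt0.
rewrite wball_le_fock // andbT wballE //; last by rewrite -(mul1r (_ ^+ 2)) -ltr_pdivrMr.
rewrite ler_expR -(mulrN nu) ler_pM2l // -ler_pdivrMl //; set u := s / _ in k1 *.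
have u1 : 0 < 1 - u by rewrite subr_gt0.
have := @le_ln1Dx R (u / (1 - u)) _.
rewrite (_ : 1 + u / (1 - u) = (1 - u)^-1); last by field; rewrite gt_eqF.
rewrite lnV ?posrE // => h.
rewrite lerNl in h; apply: le_trans (h _).
  rewrite le_eqVlt; apply/orP; left; apply/eqP.
  by rewrite mulrN mulrA (mulrC _^-1 s).
apply: lt_le_trans (_ : 0 <= _); first by rewrite ltrN10.
by rewrite divr_ge0 // ?divr_ge0 // ltW.
Qed.

End Weights.

(** * Convergence of the monomial norms *)

Section SpecificNorms.
Context {R : realType} {n : nat}.
Local Notation C := R[i].
Local Notation mi := ('I_n -> nat).
Variable nu : R.
Hypothesis nu_gt0 : 0 < nu.

Definition sball (r : R) (z : Cn R n) : R := Num.sqrt (wball nu r (cnorm2 z)).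
Definition sfock (z : Cn R n) : R := Num.sqrt (wfock nu (cnorm2 z)).

Lemma cnorm2_ge0 (z : Cn R n) : 0 <= cnorm2 z.
Proof. by rewrite cnorm2E sumr_ge0 // => j _; exact: sqr_ge0. Qed.

Lemma cnorm2_rotz u (z : Cn R n) : (forall j, normc (u j) = 1) -> cnorm2 (rotz u z) = cnorm2 z.
Proof. by move=> u1; rewrite !cnorm2E; apply: eq_bigr => j _; rewrite rotzE normcM u1 mul1r. Qed.

Lemma sball2 r z : sball r z ^+ 2 = wball nu r (cnorm2 z).
Proof. by rewrite sqr_sqrtr // wball_ge0. Qed.

Lemma sfock2 z : sfock z ^+ 2 = wfock nu (cnorm2 z).
Proof. by rewrite sqr_sqrtr // expR_ge0. Qed.

Lemma ball_norm2E r : ball_norm2 (nu * r ^+ 2) r = wnorm2 (sball r).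
Proof.
apply/funext => g; congr intCn; apply/funext => z; rewrite sball2 /wball.
by case: ifP; rewrite ?mulr0.
Qed.

Lemma fock_norm2E : fock_norm2 nu = wnorm2 sfock.
Proof. by apply/funext => g; congr intCn; apply/funext => z; rewrite sfock2. Qed.

Lemma borelR_sqrt_cnorm2 (phi : R -> R) : measurable_fun setT phi ->
  borelR (fun z : Cn R n => Num.sqrt (phi (cnorm2 z))).
Proof.
move=> mphi d T u mu_; apply: (measurableT_comp (@measurable_sqrt R)).
by apply: (measurableT_comp mphi); exact: borelR_cnorm2.
Qed.

Lemma borelR_sball r : borelR (sball r).
Proof.
apply: borelR_sqrt_cnorm2; apply: measurable_fun_ifT; last exact: measurable_cst.
  by apply: measurable_fun_ltr => //; exact: measurable_cst.
apply: (measurableT_comp (@measurable_powR R _)); apply: measurable_funB; first exact: measurable_cst.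
by apply: measurable_funM => //; exact: measurable_cst.
Qed.

Lemma borelR_sfock : borelR sfock.
Proof.
by apply: borelR_sqrt_cnorm2; apply: measurableT_comp => //; apply: measurableT_comp.
Qed.

Lemma sball_rot r u z : (forall j, normc (u j) = 1) -> sball r (rotz u z) = sball r z.
Proof. by move=> u1; rewrite /sball cnorm2_rotz. Qed.

Lemma sfock_rot u z : (forall j, normc (u j) = 1) -> sfock (rotz u z) = sfock z.
Proof. by move=> u1; rewrite /sfock cnorm2_rotz. Qed.

Lemma sball_supp r z : sball r z != 0 -> cnorm2 z < r ^+ 2.
Proof. by rewrite /sball /wball; case: ifP => //; rewrite sqrtr0 eqxx. Qed.

Lemma le_wnorm2 (s t : Cn R n -> R) g : borelR s -> borelR t -> borelC g ->
  (forall z, s z ^+ 2 <= t z ^+ 2) -> (wnorm2 s g <= wnorm2 t g)%E.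
Proof.
move=> bs bt bg st; rewrite /wnorm2 !intCnE; apply: le_iter_int.
- by move=> y; rewrite lee_fin weighted_ge0.
- exact: borelR_EFin (wmeas_borelR (borelC_wmeas bs bg)).
- exact: borelR_EFin (wmeas_borelR (borelC_wmeas bt bg)).
- by move=> y; rewrite lee_fin; apply: ler_wpM2l; [exact: cabs2_ge0|exact: st].
Qed.

(** Monotone convergence to a finite limit, with the error added to the approximant: no subtraction
    of extended reals occurs, and finite sums and nonnegative multiples pass through. *)
Definition increases_to (A : R -> \bar R) (L : \bar R) := [/\ (L < +oo)%E,
  forall r s, 0 < r -> r <= s -> [/\ (0 <= A r)%E, (A r <= A s)%E & (A s <= L)%E] &
  forall e : R, 0 < e -> exists2 r0, 0 < r0 & forall r, r0 <= r -> (L <= A r + e%:E)%E].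

Lemma increases_toD A B L M : increases_to A L -> increases_to B M ->
  increases_to (fun r => A r + B r)%E (L + M)%E.
Proof.
move=> [A1 A2 A3] [B1 B2 B3]; split; first exact: lte_add_pinfty.
  move=> r s r0 rs; have [a1 a2 a3] := A2 r s r0 rs; have [b1 b2 b3] := B2 r s r0 rs.
  by split; [exact: adde_ge0|exact: leeD|exact: leeD].
move=> e e0; have e2 : 0 < e / 2 by rewrite divr_gt0.
have [r0 r00 rP] := A3 _ e2; have [s0 s00 sP] := B3 _ e2.
exists (Num.max r0 s0) => [|r]; first by rewrite lt_max r00.
rewrite ge_max => /andP[h1 h2]; rewrite (splitr e) EFinD addeACA.
by apply: leeD; [exact: rP|exact: sP].
Qed.

Lemma increases_toZ A L (c : R) : 0 <= c -> increases_to A L ->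
  increases_to (fun r => c%:E * A r)%E (c%:E * L)%E.
Proof.
move=> c0 [A1 A2 A3].
have L0 : (0 <= L)%E by have [a1 _ a3] := A2 1 1 ltr01 (lexx _); exact: le_trans a3.
split; first by rewrite lte_mul_pinfty.
  move=> r s r0 rs; have [a1 a2 a3] := A2 r s r0 rs.
  by split; [exact: mule_ge0|exact: lee_wpmul2l|exact: lee_wpmul2l].
(* Dividing by [c + 1] covers the case [c = 0]. *)
move=> e e0; have c1 : 0 < c + 1 by rewrite ltr_wpDl.
have [r0 r00 rP] := A3 (e / (c + 1)) (divr_gt0 e0 c1); exists r0 => // r rr.
have [a1 _ _] := A2 r0 r r00 rr; have [a0 _ _] := A2 r r (lt_le_trans r00 rr) (lexx _).
apply: (@le_trans _ _ (c%:E * (A r + (e / (c + 1))%:E))%E); first by apply: lee_wpmul2l => //; exact: rP.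
rewrite ge0_muleDr ?lee_fin ?divr_ge0 ?(ltW e0) ?(ltW c1) //; apply: leeD2l.
by rewrite -EFinM lee_fin mulrCA -[leRHS]mulr1 ler_wpM2l ?(ltW e0) // ler_pdivrMr // mul1r lerDl.
Qed.

Lemma increases_to_sum (I : Type) (s : seq I) (P : pred I) (A : I -> R -> \bar R) (L : I -> \bar R) :
  (forall i, increases_to (A i) (L i)) ->
  increases_to (fun r => \sum_(i <- s | P i) A i r)%E (\sum_(i <- s | P i) L i)%E.
Proof.
move=> AL; elim: s => [|i s IH].
  rewrite big_nil (_ : (fun r => _) = fun=> 0%E); last by apply/funext => r; rewrite big_nil.
  split=> // e e0; exists 1 => // r _; rewrite add0e lee_fin; exact: ltW.
rewrite big_cons; case: ifP => Pi.
  rewrite (_ : (fun r => _) = fun r => (A i r + \sum_(j <- s | P j) A j r)%E); first exact: increases_toD.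
  by apply/funext => r; rewrite big_cons Pi.
rewrite (_ : (fun r => _) = fun r => (\sum_(j <- s | P j) A j r)%E) //.
by apply/funext => r; rewrite big_cons Pi.
Qed.

(* The weights increase with the radius to the Gaussian, so Fatou's lemma suffices. *)
Lemma wnorm2_increases g : borelC g -> (wnorm2 sfock g < +oo)%E -> increases_to (fun r => wnorm2 (sball r) g) (wnorm2 sfock g).
Proof.
move=> bg gfin; split => // [r s r0 rs|e e0].
  split; first exact: wnorm2_ge0.
    apply: le_wnorm2 => //; [exact: borelR_sball|exact: borelR_sball|move=> z].
    by rewrite !sball2; apply: wball_mono => //; exact: cnorm2_ge0.
  apply: le_wnorm2 => //; [exact: borelR_sball|exact: borelR_sfock|move=> z].
  by rewrite sball2 sfock2; apply: wball_le_fock => //; [exact: lt_le_trans rs|exact: cnorm2_ge0].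
apply: contrapT => H.
have Lfin : wnorm2 sfock g \is a fin_num by rewrite ge0_fin_numE ?wnorm2_ge0.
(* If one integer radius came within [e] of the limit, monotonicity would give the third clause; so
   all of them stay below by [e], against Fatou. *)
have Hk (k : nat) : (wnorm2 (sball k.+1%:R) g <= wnorm2 sfock g - e%:E)%E.
  rewrite leNgt; apply/negP => h; apply: H; exists k.+1%:R; first by rewrite ltr0n.
  move=> r kr; rewrite -leeBlDr; last by [].
  apply/ltW/(lt_le_trans h).
  apply: le_wnorm2 => //; [exact: borelR_sball|exact: borelR_sball|move=> z].
  by rewrite !sball2; apply: wball_mono => //; exact: cnorm2_ge0.
pose F k x := (cabs2 (g (toz x)) * sball k.+1%:R (toz x) ^+ 2)%:E.
have : (wnorm2 sfock g <= limn_einf (fun k => wnorm2 (sball k.+1%:R) g))%E.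
  have -> : wnorm2 sfock g = iter_int n.*2 (fun x => limn_einf (fun k => F k x)) (fun=> 0).
    rewrite /wnorm2 intCnE; congr (iter_int _ _ _); apply/funext => x.
    apply/esym; apply: (cvg_limn_einf_sup _).1; apply: cvg_EFin; first exact: nearW.
    rewrite sfock2 (_ : _ \o _ = fun k => cabs2 (g (toz x)) * wball nu k.+1%:R (cnorm2 (toz x : Cn R n))).
      by apply: cvgMr; apply: wball_cvg => //; exact: cnorm2_ge0.
    by apply/funext => k; rewrite /= sball2.
  apply: fatou_iter_int; first by move=> k y; rewrite lee_fin weighted_ge0.
  by move=> k; exact: borelR_EFin (wmeas_borelR (borelC_wmeas (borelR_sball _) bg)).
apply/negP; rewrite -ltNge.
apply: (@le_lt_trans _ _ (wnorm2 sfock g - e%:E)%E); last by rewrite -(fineK Lfin) -EFinB lte_fin ltrBlDr ltrDl.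
by rewrite -(cvg_limn_einf_sup (cvg_cst (wnorm2 sfock g - e%:E)%E)).1; apply: le_limn_einf.
Qed.

Lemma Dmulti_single (f : Cn R n -> C) (a : mi -> C) l p : PS [set r : R | 0 < r] f a -> (forall q, q <> p -> a q = 0) ->
  Dmulti l f = tterm a l p.
Proof.
move=> fa a0; apply/funext => z.
have r0 : 0 < cnorm2 z + 1 by rewrite ltr_wpDl ?cnorm2_ge0.
have zr : cnorm2 z < (cnorm2 z + 1) ^+ 2 by have := cnorm2_ge0 z; nra.
apply: (blim_unique (PSon_Dmulti l (fa _ r0) zr)).
by apply: (blim_single (t := tterm a l ^~ z)) => q qp; rewrite /tterm a0 // mul0r.
Qed.

(** Truncations and derivatives of a monomial are single [tterm]s, so its Dirichlet norm is a finite
    nonnegative combination of weighted norms of polynomials. *)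
Lemma Nd_mono_increases (m : nat) p :
  increases_to (fun r => dir_norm2 m (wnorm2 (sball r)) (mono p)) (dir_norm2 m (wnorm2 sfock) (mono p)).
Proof.
have pos : forall r : R, [set r : R | 0 < r] r -> 0 < r by [].
have ne : exists r : R, [set r : R | 0 < r] r by exists 1; exact: ltr01.
have PSm : PS [set r : R | 0 < r] (mono p : Cn R n -> C) (single p 1).
  by have := @PS_single R n [set r : R | 0 < r] p 1; congr PS; apply/funext => z; rewrite mul1r.
have s0 q : q <> p -> single p 1 q = 0 :> C by move=> qp; rewrite /single; case: asboolP.
have DE l := @Dmulti_single _ _ l p PSm s0.
have TE : trunc m (mono p : Cn R n -> C) = tterm (low m (single p 1)) (fun=> 0%N) p.
  rewrite -(Dmulti0 (trunc m (mono p))); apply: Dmulti_single; first exact: PS_trunc.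
  by move=> q qp; rewrite /low s0 // if_same.
have inc (a : mi -> C) l q : increases_to (fun r => wnorm2 (sball r) (tterm a l q)) (wnorm2 sfock (tterm a l q)).
  by apply: wnorm2_increases; [exact: borelC_tterm|exact: gauss_tterm_fin].
rewrite /dir_norm2 TE; apply: increases_toD; first exact: inc.
apply: increases_to_sum => l; apply: increases_toZ; first by rewrite divr_ge0 ?ler0n.
by rewrite DE; exact: inc.
Qed.

End SpecificNorms.

(** * Convergence of the kernels *)

Section Limit.
Context {R : realType} {n : nat}.
Local Notation C := R[i].
Local Notation mi := ('I_n -> nat).

Lemma eventually_finType (I : finType) (P : I -> R -> Prop) :
  (forall i, exists r0, forall r, r0 <= r -> P i r) -> exists r0, forall r, r0 <= r -> forall i, P i r.
Proof.
move=> /choice[f fP]; exists (\sum_i `|f i|) => r rr i; apply: fP; apply: le_trans rr.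
by rewrite (bigD1 i) //=; apply: (le_trans (ler_norm _)); rewrite lerDl sumr_ge0.
Qed.

Lemma compact_coord (S : set (Cn R n * Cn R n)) : compact S -> exists2 rho : R, 0 < rho &
  forall p, S p -> forall j, normc (p.1 0 j) <= rho /\ normc (p.2 0 j) <= rho.
Proof.
move=> cS.
have bd (g : Cn R n * Cn R n -> R) : continuous g -> exists B, forall r, B <= r -> forall p, S p -> g p <= r.
  move=> cg; have := compact_bounded (@continuous_compact _ _ g S (continuous_subspaceT cg) cS).
  move=> [B [_ BP]]; exists (B + 1) => r Br p Sp; apply: le_trans (ler_norm _) _.
  by apply: (BP r); [lra|exists p].
have c1 j : continuous (fun p : Cn R n * Cn R n => normc (p.1 0 j)).
  move=> p; apply: (@continuous_comp _ _ _ (fun p : Cn R n * Cn R n => p.1 0 j : CC R) (fun z : CC R => normc z)).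
    apply: (@continuous_comp _ _ _ (fun p : Cn R n * Cn R n => p.1) (fun w : Cn R n => w 0 j : CC R)); first exact: cvg_fst.
    exact: coord_continuous.
  exact: continuous_normc.
have c2 j : continuous (fun p : Cn R n * Cn R n => normc (p.2 0 j)).
  move=> p; apply: (@continuous_comp _ _ _ (fun p : Cn R n * Cn R n => p.2 0 j : CC R) (fun z : CC R => normc z)).
    apply: (@continuous_comp _ _ _ (fun p : Cn R n * Cn R n => p.2) (fun w : Cn R n => w 0 j : CC R)); first exact: cvg_snd.
    exact: coord_continuous.
  exact: continuous_normc.
have [B1 B1P] := eventually_finType (fun j => bd _ (c1 j)).
have [B2 B2P] := eventually_finType (fun j => bd _ (c2 j)).
exists (`|B1| + `|B2| + 1); first by rewrite ltr_wpDl ?addr_ge0.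
move=> p Sp j; split.
  by apply: (B1P _ _ j p Sp); apply: (le_trans (ler_norm _)); rewrite -addrA lerDl addr_ge0.
apply: (B2P _ _ j p Sp); apply: (le_trans (ler_norm _)).
by rewrite (addrC `|B1|) -addrA lerDl addr_ge0.
Qed.

(** The lower bound [c0] at a fixed radius keeps the denominators of $(c_2-c_1)q/(c_1c_2)$ away from
    0, and [q + 1] allows [q = 0]. *)
Lemma inv_gap (c0 c1 c2 q d : R) : 0 < c0 -> c0 <= c1 -> c1 <= c2 -> 0 <= q -> 0 <= d ->
  c2 <= c1 + d * c0 ^+ 2 / (q + 1) -> (c1^-1 - c2^-1) * q <= d.
Proof.
move=> c00 c01 c12 q0 d0 cl.
have c1_gt0 : 0 < c1 by exact: lt_le_trans c01.
have c2_gt0 : 0 < c2 by exact: lt_le_trans c12.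
have q1 : 0 < q + 1 by rewrite ltr_wpDl.
rewrite (_ : c1^-1 - c2^-1 = (c2 - c1) / (c1 * c2)); last by field; rewrite !gt_eqF.
apply: (@le_trans _ _ (d * c0 ^+ 2 / (q + 1) / (c0 ^+ 2) * q)).
  apply: ler_wpM2r => //; apply: ler_pM; first by rewrite subr_ge0.
  - by rewrite invr_ge0 mulr_ge0 // ltW.
  - by rewrite lerBlDl.
  rewrite lef_pV2 ?posrE ?mulr_gt0 ?exprn_gt0 // expr2.
  by apply: ler_pM; rewrite ?(ltW c00) ?(le_trans c01).
rewrite (_ : _ * q = d * (q / (q + 1))); last by field; rewrite !gt_eqF.
by rewrite -[leRHS]mulr1 ler_wpM2l // ler_pdivrMr // mul1r lerDl.
Qed.

Lemma normc_mono_le (p : mi) (z v : Cn R n) : (forall j, normc (z 0 j) <= normc (v 0 j)) ->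
  normc (mono p z) <= normc (mono p v).
Proof.
move=> zv; rewrite /mono !normc_prod; apply: ler_prod => j _.
by rewrite normc_ge0 !normcX /=; apply: lerXn2r; rewrite ?nnegrE ?normc_ge0.
Qed.

Variables (m : nat) (nu : R) (KR : R -> Cn R n -> Cn R n -> C) (K : Cn R n -> Cn R n -> C).
Hypothesis nu_gt0 : 0 < nu.
Hypothesis HKR : forall r : R, 0 < r ->
  is_rkernel (cball n r) (dir_norm2 m (ball_norm2 (nu * r ^+ 2) r)) (KR r).
Hypothesis HK : is_rkernel [set: Cn R n] (dir_norm2 m (fock_norm2 nu)) K.

Let cb r p := @mono_norm2 R n (sball nu r) m p.
Let cf p := @mono_norm2 R n (sfock nu) m p.

Let inc p := @Nd_mono_increases R n nu nu_gt0 m p.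

Let fin_ball (r : R) p : 0 < r -> (dir_norm2 m (wnorm2 (@sball R n nu r)) (mono p) < +oo)%E.
Proof.
move=> r0; have [h1 h2 _] := inc p; have [_ _ h3] := h2 r r r0 (lexx r).
exact: le_lt_trans h3 h1.
Qed.

Let fin_fock p : (dir_norm2 m (wnorm2 (@sfock R n nu)) (mono p) < +oo)%E.
Proof. by have [] := inc p. Qed.

Let HKR' (r : R) : 0 < r -> is_rkernel (cball n r) (dir_norm2 m (wnorm2 (@sball R n nu r))) (KR r).
Proof. by move=> r0; rewrite -ball_norm2E; exact: HKR. Qed.

Let HK' : is_rkernel [set: Cn R n] (dir_norm2 m (wnorm2 (@sfock R n nu))) K.
Proof. by rewrite -fock_norm2E. Qed.

Let posD1 (r : R) : 0 < r -> forall s : R, [set r] s -> 0 < s. Proof. by move=> r0 s ->. Qed.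
Let neD1 (r : R) : exists s : R, [set r] s. Proof. by exists r. Qed.
Let UEb (r : R) (z : Cn R n) : cball n r z <-> exists2 s, [set r] s & cnorm2 z < s ^+ 2.
Proof. by split=> [zr|[s -> //]]; exists r. Qed.
Let neD2 : exists s : R, [set s : R | 0 < s] s. Proof. by exists 1; exact: ltr01. Qed.
Let UEf (z : Cn R n) : [set: Cn R n] z <-> exists2 s, [set s : R | 0 < s] s & cnorm2 z < s ^+ 2.
Proof.
split=> // _; have z0 := cnorm2_ge0 z; exists (cnorm2 z + 1) => /=; first by rewrite ltr_wpDl.
by nra.
Qed.

Lemma ball_mono_norm2_gt0 (r : R) p : 0 < r -> 0 < cb r p.
Proof.
move=> r0; exact: (mono_norm2_gt0 (@borelR_sball R n nu r) (@sball_rot R n nu r) (posD1 r0) (neD1 r)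
  (@sball_supp R n nu r) (UEb r) (fun p => fin_ball p r0) (HKR' r0) p).
Qed.

Lemma ball_kernel_series (r : R) z w : 0 < r -> cball n r z -> cball n r w ->
  blim (fun p => kterm (sball nu r) m p z w) (KR r z w).
Proof.
move=> r0; exact: (kernel_series (@borelR_sball R n nu r) (@sball_rot R n nu r) (posD1 r0) (neD1 r)
  (@sball_supp R n nu r) (UEb r) (fun p => fin_ball p r0) (HKR' r0)).
Qed.

Lemma ball_kernel_summable (r : R) z w : 0 < r -> cball n r z -> cball n r w ->
  exists B, forall N, bsum N (fun p => normc (kterm (sball nu r) m p z w)) <= B.
Proof.
move=> r0; exact: (kernel_summable (@borelR_sball R n nu r) (@sball_rot R n nu r) (posD1 r0) (neD1 r)
  (@sball_supp R n nu r) (UEb r) (fun p => fin_ball p r0) (HKR' r0)).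
Qed.

Lemma fock_kernel_series z w : blim (fun p => kterm (sfock nu) m p z w) (K z w).
Proof.
exact: (kernel_series (@borelR_sfock R n nu) (@sfock_rot R n nu) (fun s => id) neD2
  (fun _ _ => I) UEf fin_fock HK' I I).
Qed.

Lemma mono_norm2_mono (r s : R) p : 0 < r -> r <= s -> cb r p <= cb s p <= cf p.
Proof.
move=> r0 rs; have [_ h _] := inc p; have [h1 h2 h3] := h r s r0 rs.
have s0 : 0 < s by exact: lt_le_trans rs.
have fr : dir_norm2 m (wnorm2 (@sball R n nu r)) (mono p) \is a fin_num.
  by rewrite ge0_fin_numE; [exact: fin_ball|exact: h1].
have fs : dir_norm2 m (wnorm2 (@sball R n nu s)) (mono p) \is a fin_num.
  by rewrite ge0_fin_numE; [exact: fin_ball|exact: le_trans h2].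
have ff : dir_norm2 m (wnorm2 (@sfock R n nu)) (mono p) \is a fin_num.
  by rewrite ge0_fin_numE; [exact: fin_fock|exact: le_trans (le_trans h1 h2) h3].
by apply/andP; split; [exact: (fine_le fr fs h2)|exact: (fine_le fs ff h3)].
Qed.

Lemma mono_norm2_lim p (e : R) : 0 < e -> exists r0, forall r, r0 <= r -> cf p <= cb r p + e.
Proof.
move=> e0; have [_ h2 h] := inc p; have [r0 r00 rP] := h e e0; exists r0 => r rr.
have rp : 0 < r by exact: lt_le_trans rr.
have [h1 _ h3] := h2 r r rp (lexx r).
have fb : dir_norm2 m (wnorm2 (@sball R n nu r)) (mono p) \is a fin_num by rewrite ge0_fin_numE ?fin_ball.
have ff : dir_norm2 m (wnorm2 (@sfock R n nu)) (mono p) \is a fin_num.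
  by rewrite ge0_fin_numE; [exact: fin_fock|exact: le_trans h3].
by rewrite -lee_fin EFinD /cb /cf /mono_norm2 !fineK //; exact: rP.
Qed.

Lemma normc_kterm (s : Cn R n -> R) p (z w : Cn R n) : 0 < mono_norm2 s m p -> normc (kterm s m p z w) = (mono_norm2 s m p)^-1 * (normc (mono p z) * normc (mono p w)).
Proof.
by move=> c0; rewrite /kterm normcM normcM normc_conjc normcR ger0_norm // invr_ge0 ltW.
Qed.

(** The difference is split into two tails and a finite box sum, each at most [eps / 4], which
    leaves the inequality strict. *)
Lemma kernel_limit_polydisc (rho eps : R) : 0 < rho -> 0 < eps -> exists r0, forall r, r0 <= r ->
  forall z w : Cn R n, (forall j, normc (z 0 j) <= rho) -> (forall j, normc (w 0 j) <= rho) ->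
  normc (KR r z w - K z w) < eps.
Proof.
move=> rho0 eps0; pose R0 := n.+1%:R * (rho + 1).
have rho1 : 0 < rho + 1 by rewrite addr_gt0.
have R00 : 0 < R0 by rewrite mulr_gt0 // ltr0n.
(* The corner of the polydisc: monomials are largest there, so the diagonal series at [v] for the
   radius [R0] is the majorant. *)
pose v : Cn R n := \row_j Complex rho 0.
have nv j : normc (v 0 j) = rho by rewrite mxE normcR ger0_norm // ltW.
have inb (r : R) (z : Cn R n) : R0 <= r -> (forall j, normc (z 0 j) <= rho) -> cball n r z.
  move=> Rr zr; rewrite /cball /= cnorm2E.
  apply: (@le_lt_trans _ _ (\sum_(j < n) rho ^+ 2)).
    by apply: ler_sum => j _; rewrite ler_sqr ?nnegrE ?normc_ge0 ?(ltW rho0).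
  rewrite sumr_const card_ord -(mulr_natl (rho ^+ 2)).
  apply: (@lt_le_trans _ _ (R0 ^+ 2)); last by rewrite ler_sqr ?nnegrE ?(ltW R00) // (le_trans (ltW R00)).
  rewrite /R0 exprMn; apply: ltr_pM; rewrite ?ler0n ?sqr_ge0 //.
    by rewrite -natrX ltr_nat expnS expn1 (leq_trans (ltnSn n)) // leq_pmulr.
  by rewrite ltr_sqr ?nnegrE ?(ltW rho0) ?(ltW rho1) // ltrDl.
have vR : cball n R0 v by apply: inb => // j; rewrite nv.
have [B BP] := ball_kernel_summable R00 vR vR.
have cR p : 0 < cb R0 p by exact: ball_mono_norm2_gt0.
set T := fun p => normc (kterm (sball nu R0) m p v v) in BP.
have T0 p : 0 <= T p by exact: normc_ge0.
have e4 : 0 < eps / 4 by rewrite divr_gt0.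
have [N N0 NP] := bounded_bsum_tail T0 BP e4.
have dom (s : Cn R n -> R) p (z w : Cn R n) : cb R0 p <= mono_norm2 s m p -> (forall j, normc (z 0 j) <= rho) -> (forall j, normc (w 0 j) <= rho) ->
    normc (kterm s m p z w) <= T p.
  move=> cs zr wr; have c0 : 0 < mono_norm2 s m p by exact: lt_le_trans cs.
  rewrite /T (normc_kterm _ _ c0) (normc_kterm _ _ (cR p)).
  apply: ler_pM; rewrite ?invr_ge0 ?(ltW c0) ?mulr_ge0 ?normc_ge0 //.
    by rewrite lef_pV2; [exact: cs|exact: c0|exact: (cR p)].
  by apply: ler_pM; rewrite ?normc_ge0 //; apply: normc_mono_le => j; rewrite nv.
pose I := {ffun 'I_n -> 'I_N}; pose ev (i : I) : mi := fun j => nat_of_ord (i j).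
pose de := eps / 4 / (#|I|%:R + 1).
have card1 : 0 < #|I|%:R + 1 :> R by rewrite ltr_wpDl.
have de0 : 0 < de by rewrite divr_gt0.
pose q p := normc (mono p v) ^+ 2.
have q0 p : 0 <= q p by exact: sqr_ge0.
(* Convergence of the coefficients is used only for the finitely many indices of the box, each
   allowed the error [de]. *)
have [r1 r1P] : exists r1, forall r, r1 <= r -> forall i : I, R0 <= r ->
    ((cb r (ev i))^-1 - (cf (ev i))^-1) * q (ev i) <= de.
  apply: eventually_finType => i; set p := ev i.
  have e0 : 0 < de * cb R0 p ^+ 2 / (q p + 1) by rewrite divr_gt0 ?mulr_gt0 ?exprn_gt0 // ltr_wpDl.
  have [r2 r2P] := mono_norm2_lim p e0; exists r2 => r rr Rr.
  have := r2P r rr; have /andP[a1 a2] := mono_norm2_mono p R00 Rr.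
  have c0 := cR p.
  by move=> cl; exact: (inv_gap c0 a1 a2 (q0 p) (ltW de0) cl).
exists (Num.max R0 r1) => r; rewrite ge_max => /andP[Rr rr] z w zr wr.
have r0 : 0 < r by exact: lt_le_trans Rr.
have h1 : normc (KR r z w - bsum N (fun p => kterm (sball nu r) m p z w)) <= eps / 4.
  apply: (blim_tail N0 (ball_kernel_series r0 (inb _ _ Rr zr) (inb _ _ Rr wr)) (u := T)) => [p|M NM]; last exact: NP.
  by apply: dom => //; have /andP[] := mono_norm2_mono p R00 Rr.
have h2 : normc (K z w - bsum N (fun p => kterm (sfock nu) m p z w)) <= eps / 4.
  apply: (blim_tail N0 (fock_kernel_series z w) (u := T)) => [p|M NM]; last exact: NP.
  by apply: dom => //; have /andP[a1] := mono_norm2_mono p R00 Rr; exact: le_trans.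
have h3 : normc (bsum N (fun p => kterm (sball nu r) m p z w) - bsum N (fun p => kterm (sfock nu) m p z w)) <= eps / 4.
  rewrite -bsumB; apply: (le_trans (normc_bsum _ _)).
  apply: (@le_trans _ _ (\sum_(i : I) de)); last first.
    rewrite sumr_const -(mulr_natr de) /de -mulrA ler_piMr ?(ltW e4) // mulrC ler_pdivrMr // mul1r.
    by rewrite lerDl.
  apply: ler_sum => i _; rewrite -/(ev i); set p := ev i; apply: le_trans (r1P r rr i Rr).
  have /andP[a1 a2] := mono_norm2_mono p R00 Rr.
  have c1 : 0 < cb r p by exact: lt_le_trans a1.
  rewrite /kterm -mulrBl normcM (_ : _ - _ = Complex ((cb r p)^-1 - (cf p)^-1) 0); last first.
    by apply: complexP; rewrite ?cReD ?cImD ?cReN ?cImN /= ?subr0.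
  rewrite normcR ger0_norm; last by rewrite subr_ge0 lef_pV2 ?posrE // (lt_le_trans c1).
  apply: ler_wpM2l; first by rewrite subr_ge0 lef_pV2 ?posrE // (lt_le_trans c1).
  rewrite normcM normc_conjc /q expr2.
  by apply: ler_pM; rewrite ?normc_ge0 //; apply: normc_mono_le => j; rewrite nv.
rewrite (_ : KR r z w - K z w = (KR r z w - bsum N (fun p => kterm (sball nu r) m p z w))
  + ((bsum N (fun p => kterm (sball nu r) m p z w) - bsum N (fun p => kterm (sfock nu) m p z w))
  + (bsum N (fun p => kterm (sfock nu) m p z w) - K z w))); last by ring.
apply: (le_lt_trans (normcD _ _)); have := normcD (bsum N (fun p => kterm (sball nu r) m p z w) - bsum N (fun p => kterm (sfock nu) m p z w))
   (bsum N (fun p => kterm (sfock nu) m p z w) - K z w).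
rewrite (normc_distC _ (K z w)); lra.
Qed.

Lemma kernel_limit_compact (S : set (Cn R n * Cn R n)) (eps : R) : compact S -> 0 < eps ->
  exists r0 : R, forall r, r0 < r -> forall p, S p -> `|KR r p.1 p.2 - K p.1 p.2| < Complex eps 0.
Proof.
move=> cS eps0; have [rho rho0 Srho] := compact_coord cS.
have [r0 r0P] := kernel_limit_polydisc rho0 eps0.
exists r0 => r /ltW rr p Sp; rewrite normCE ltCR; apply: r0P => // j; by have [] := Srho p Sp j.
Qed.

(** The case of a one-point compact set. *)
Lemma kernel_limit_pointwise z w : ((KR r z w : CC R) @[r --> +oo]) --> (K z w : CC R).
Proof.
apply/cvgrPdist_lt => e; case: e => a b; rewrite ltcE /= => /andP[/eqP -> a0].
have [r0 r0P] := kernel_limit_compact (@compact_set1 _ (z, w)) a0.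
exists r0; split; first exact: num_real.
by move=> r rr; rewrite distrC; exact: (r0P r rr (z, w)).
Qed.

End Limit.

Theorem theorem3 (R : realType) (n m : nat) (nu : R)
  (KR : R -> Cn R n -> Cn R n -> R[i])
  (K : Cn R n -> Cn R n -> R[i]) :
  (1 <= n)%N -> 0 < nu ->
  (forall r : R, 0 < r ->
     is_rkernel (cball n r) (dir_norm2 m (ball_norm2 (nu * r ^+ 2) r)) (KR r)) ->
  is_rkernel [set: Cn R n] (dir_norm2 m (fock_norm2 nu)) K ->
  (forall z w : Cn R n, ((KR r z w : CC R) @[r --> +oo]) --> (K z w : CC R)) /\
  (forall S : set (Cn R n * Cn R n), compact S ->
     forall eps : R, 0 < eps ->
     exists r0 : R, forall r, r0 < r ->
       forall p, S p -> `|KR r p.1 p.2 - K p.1 p.2| < Complex eps 0).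
Proof.
move=> _ nu0 HKR HK; split; first by move=> z w; exact: (kernel_limit_pointwise nu0 HKR HK).
by move=> S cS eps; exact: (kernel_limit_compact nu0 HKR HK).
Qed.
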